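(* There exist an absolute constant $C\ge1$, for each $(\boldsymbol{\Sigma}_{\mathbf{x}},\boldsymbol{\sigma}_{\mathbf{x},y})$ and $s$ a constant $\widetilde{C}_s\ge1$ depending only on $(\boldsymbol{\Sigma}_{\mathbf{x}},\boldsymbol{\sigma}_{\mathbf{x},y})$ and $s$, and for each $(\boldsymbol{\Sigma}_{\mathbf{q}},\boldsymbol{\sigma}_{\mathbf{q},y})$ a constant $C_{r_{\mathbf{q}}}\ge1$ depending only on $(\boldsymbol{\Sigma}_{\mathbf{q}},\boldsymbol{\sigma}_{\mathbf{q},y})$, such that, with $\widetilde{M}_s$ and $K_{\widetilde{\mathcal{B}}_s}$ defined in the context from these constants, the following holds. Let $(\mathbf{x},y)\in\mathbb{R}^p\times\mathbb{R}$ be a centered random pair with finite second moments, $\boldsymbol{\sigma}_{\mathbf{x},y}\ne\mathbf{0}_p$, $\sigma_y^2=\mathbb{E}(y^2)>0$, $1\le r_{\mathbf{x}}=\operatorname{rk}(\boldsymbol{\Sigma}_{\mathbf{x}})\le p$, and finite moment-ratios $L_y$ and $L_{\mathcal{B}}$ for every linear subspace $\mathcal{B}\subseteq\mathcal{R}(\boldsymbol{\Sigma}_{\mathbf{x}})$, following the extended latent factor model (see context) with latent features $\mathbf{q}$ of rank $r_{\mathbf{q}}$ and noise parameter $\sigma\ge0$ satisfying $\sigma^2<\lambda_{r_{\mathbf{q}}}(\boldsymbol{\Sigma}_{\mathbf{q}})/(2\{C_{r_{\mathbf{q}}}+1\})$. Let $(\mathbf{X},\mathbf{y})\in\mathbb{R}^{n\times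 p}\times\mathbb{R}^n$ be a dataset of $n$ i.i.d. realizations of $(\mathbf{x},y)$, let $1\le s\le r_{\mathbf{q}}$, and let $\widehat{\boldsymbol{\beta}}_{\mathrm{PLS},s}$ be the sample PLS coefficients. Assume: (i) $\dim(\widehat{\mathcal{K}}_p(\mathbf{x},y))\ge\dim(\mathcal{K}_p(\mathbf{x},y))$; (ii) $\delta_{\widetilde{\mathcal{B}}_s,n}\to0$ as $n\to\infty$ and $\nu_{\widetilde{\mathcal{B}}_s,n}:=\widetilde{M}_sK_{\widetilde{\mathcal{B}}_s}\delta_{\widetilde{\mathcal{B}}_s,n}<\frac12$. Let $\nu_{\widetilde{\mathcal{B}}_s,n}<\nu_{s,n}<\frac12$ and let $\boldsymbol{\alpha}_{\mathrm{LS}}=\boldsymbol{\Sigma}_{\mathbf{q}}^\dagger\boldsymbol{\sigma}_{\mathbf{q},y}$ be the minimum-$L^2$-norm solution of $\arg\min_{\boldsymbol{\alpha}\in\mathbb{R}^p}\mathbb{E}(y-\mathbf{q}^t\boldsymbol{\alpha})^2$. Then the event $\{\widehat{\varepsilon}(\mathbf{x},y)\le K_{\widetilde{\mathcal{B}}_s}\nu_{s,n}^{-1}\delta_{\widetilde{\mathcal{B}}_s,n}\}$ has probability at least $1-2\nu_{s,n}$, and on this event $$\frac{\|\widehat{\boldsymbol{\beta}}_{\mathrm{PLS},s}-\boldsymbol{\alpha}_{\mathrm{LS}}\|_2}{\|\boldsymbol{\alpha}_{\mathrm{LS}}\|_2}\le\frac72\sqrt{r_{\mathbf{q}}-s}+5\{C_{r_{\mathbf{q}}}+1\}\frac{\sigma^2}{\lambda_{r_{\mathbf{q}}}(\boldsymbol{\Sigma}_{\mathbf{q}})}+\frac52\,\widetilde{M}_sK_{\widetilde{\mathcal{B}}_s}\sqrt{\frac{\rho_{\widetilde{\mathcal{B}}_s,n}\log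 r_{\mathbf{x}}}{n\,\nu_{s,n}^2}}.$$
   Context: Notation: $\boldsymbol{\Sigma}_{\mathbf{u}}=\mathbb{E}(\mathbf{u}\mathbf{u}^t)$, $\boldsymbol{\sigma}_{\mathbf{u},y}=\mathbb{E}(\mathbf{u}y)$; $\mathcal{R}(\cdot)$ range; $\dagger$ Moore–Penrose inverse; $\lambda_1(\cdot)\ge\lambda_2(\cdot)\ge\cdots$ sorted eigenvalues; $\|\cdot\|_{op}$ operator norm; $\kappa_2(\mathbf{A})$ is the ratio of the largest to the smallest nonzero eigenvalue of a positive semidefinite $\mathbf{A}$; $a\vee b=\max(a,b)$; $\mathcal{K}_s(\mathbf{A},\mathbf{b})=\operatorname{span}\{\mathbf{b},\dots,\mathbf{A}^{s-1}\mathbf{b}\}$. Relevant features. For $\mathcal{B}\subseteq\mathcal{R}(\boldsymbol{\Sigma}_{\mathbf{x}})$, $\mathbf{x}_{\mathcal{B}}$ is the orthogonal projection of $\mathbf{x}$ onto $\mathcal{B}$. The relevant subspace $\mathcal{B}_y$ is the (unique) subspace $\mathcal{B}\subseteq\mathcal{R}(\boldsymbol{\Sigma}_{\mathbf{x}})$ of smallest dimension such that, with $\mathcal{B}^\perp$ its orthogonal complement in $\mathcal{R}(\boldsymbol{\Sigma}_{\mathbf{x}})$, $\mathbb{E}(\mathbf{x}_{\mathcal{B}^\perp}y)=\mathbf{0}_p$ and $\mathbb{E}(\mathbf{x}_{\mathcal{B}^\perp}\mathbf{x}_{\mathcal{B}}^t)=\mathbf{0}_{p\times p}$. Then $\mathbf{x}=\mathbf{x}_y+\mathbf{x}_{y^\perp}$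 with $\mathbf{x}_y,\mathbf{x}_{y^\perp}$ the projections of $\mathbf{x}$ onto $\mathcal{B}_y$ and onto its complement $\mathcal{B}_y^\perp$ in $\mathcal{R}(\boldsymbol{\Sigma}_{\mathbf{x}})$; $r_y=\operatorname{rk}(\boldsymbol{\Sigma}_{\mathbf{x}_y})=\dim\mathcal{B}_y$. Extended latent factor model: $y=\mathbf{q}^t\boldsymbol{\alpha}+\varepsilon$ and $\mathbf{x}=\mathbf{x}_y+\mathbf{x}_{y^\perp}=\mathbf{q}+\sigma\mathbf{e}+\mathbf{x}_{y^\perp}$ (so $\mathbf{x}_y=\mathbf{q}+\sigma\mathbf{e}$), where $\mathbf{q}\in\mathbb{R}^p$ is a centered random vector with $1\le r_{\mathbf{q}}=\operatorname{rk}(\boldsymbol{\Sigma}_{\mathbf{q}})\le r_y$ and $\mathcal{R}(\boldsymbol{\Sigma}_{\mathbf{q}})\subseteq\mathcal{B}_y$, $\boldsymbol{\alpha}\in\mathbb{R}^p$ is deterministic, $\varepsilon\in\mathbb{R}$ is an independent centered random variable, $\sigma\ge0$, and $\mathbf{e}\in\mathbb{R}^p$ is an independent centered random vector with $\mathcal{R}(\boldsymbol{\Sigma}_{\mathbf{e}})=\mathcal{B}_y$ and $\lambda_1(\boldsymbol{\Sigma}_{\mathbf{e}})=1$. Hence $\boldsymbol{\sigma}_{\mathbf{x},y}=\boldsymbol{\sigma}_{\mathbf{q},y}$ and $\boldsymbol{\Sigma}_{\mathbf{x}}=\boldsymbol{\Sigma}_{\mathbf{q}}+\sigma^2\boldsymbol{\Sigma}_{\mathbf{e}}+\boldsymbol{\Sigma}_{\mathbf{x}_{y^\perp}}$.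 Standing convention: $\mathcal{R}(\boldsymbol{\Sigma}_{\mathbf{q}})=\mathcal{K}_{r_{\mathbf{q}}}(\boldsymbol{\Sigma}_{\mathbf{q}},\boldsymbol{\sigma}_{\mathbf{q},y})$. Parsimonious reductions. For $1\le s\le r_y$: $\mathcal{B}_s=\mathcal{K}_s(\boldsymbol{\Sigma}_{\mathbf{x}_y},\boldsymbol{\sigma}_{\mathbf{x}_y,y})$, $\mathbf{x}_s$ is the orthogonal projection of $\mathbf{x}_y$ onto $\mathcal{B}_s$, and $\mathcal{B}_s^\perp$ is the orthogonal complement of $\mathcal{B}_s$ in $\mathcal{B}_y$; $m_y=\dim(\mathcal{B}_{r_y})$. Sample PLS. $\widehat{\boldsymbol{\Sigma}}_{\mathbf{x}}=n^{-1}\mathbf{X}^t\mathbf{X}$, $\widehat{\boldsymbol{\sigma}}_{\mathbf{x},y}=n^{-1}\mathbf{X}^t\mathbf{y}$, $\mathcal{K}_s(\mathbf{x},y)=\mathcal{K}_s(\boldsymbol{\Sigma}_{\mathbf{x}},\boldsymbol{\sigma}_{\mathbf{x},y})$, $\widehat{\mathcal{K}}_s(\mathbf{x},y)=\mathcal{K}_s(\widehat{\boldsymbol{\Sigma}}_{\mathbf{x}},\widehat{\boldsymbol{\sigma}}_{\mathbf{x},y})$; $\widehat{\boldsymbol{\beta}}_{\mathrm{PLS},s}$ is the minimum-$L^2$-norm minimizer of $\boldsymbol{\beta}^t\widehat{\boldsymbol{\Sigma}}_{\mathbf{x}}\boldsymbol{\beta}-2\boldsymbol{\beta}^t\widehat{\boldsymbol{\sigma}}_{\mathbf{x},y}$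 over $\widehat{\mathcal{K}}_s(\mathbf{x},y)$. Perturbation size: $$\widehat{\varepsilon}(\mathbf{x},y)=\frac{\|\widehat{\boldsymbol{\Sigma}}_{\mathbf{x}}-\boldsymbol{\Sigma}_{\mathbf{x}}\|_{op}}{\|\boldsymbol{\Sigma}_{\mathbf{x}}\|_{op}}\vee\frac{\|\widehat{\boldsymbol{\sigma}}_{\mathbf{x},y}-\boldsymbol{\sigma}_{\mathbf{x},y}\|_2}{\|\boldsymbol{\sigma}_{\mathbf{x},y}\|_2}.$$ Moment ratios and geometry. $L_y=\mathbb{E}(y^4)^{1/4}/\mathbb{E}(y^2)^{1/2}$, $L_{\mathcal{B}}=\mathbb{E}(\|\mathbf{x}_{\mathcal{B}}\|_2^4)^{1/4}/\mathbb{E}(\|\mathbf{x}_{\mathcal{B}}\|_2^2)^{1/2}$ ($L_{\mathcal{B}}=1$ if the denominator is zero). $\rho_{\mathcal{B},n}=\mathbb{E}(\max_{1\le i\le n}\|\mathbf{x}_{\mathcal{B},i}\|_2^2)/\|\boldsymbol{\Sigma}_{\mathbf{x}_{\mathcal{B}}}\|_{op}$, where $\mathbf{x}_{\mathcal{B},i}$ is the projection of the $i$-th observation. $\widetilde{\mathcal{B}}_s$ is a maximizer of $L_{\mathcal{B}}\|\boldsymbol{\Sigma}_{\mathbf{x}_{\mathcal{B}}}\|_{op}\,\rho_{\mathcal{B},n}$ over $\mathcal{B}\in\{\mathcal{B}_s,\mathcal{B}_s^\perp,\mathcal{B}_y^\perp\}$ (the product is read as $0$ if $\boldsymbol{\Sigma}_{\mathbf{x}_{\mathcal{B}}}=0$),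 and $\delta_{\widetilde{\mathcal{B}}_s,n}=\sqrt{\rho_{\widetilde{\mathcal{B}}_s,n}\log(r_{\mathbf{x}})/n}$. Constants. For $1\le s\le m_y$, $$\widetilde{M}_s=2\,\kappa_2(\boldsymbol{\Sigma}_{\mathbf{x}_s})\{4\widetilde{C}_s+1\}\left\{\frac{\|\boldsymbol{\Sigma}_{\mathbf{x}}\|_{op}}{\|\boldsymbol{\Sigma}_{\mathbf{x}_s}\|_{op}}\vee\frac{\|\boldsymbol{\sigma}_{\mathbf{x},y}\|_2}{\|\boldsymbol{\sigma}_{\mathbf{x}_s,y}\|_2}\right\},\qquad K_{\widetilde{\mathcal{B}}_s}=99\,C\,L_yL_{\widetilde{\mathcal{B}}_s}\left\{\frac{\sigma_y\|\boldsymbol{\Sigma}_{\mathbf{x}_{\widetilde{\mathcal{B}}_s}}\|_{op}^{1/2}}{\|\boldsymbol{\sigma}_{\mathbf{x},y}\|_2}\vee\frac{\|\boldsymbol{\Sigma}_{\mathbf{x}_{\widetilde{\mathcal{B}}_s}}\|_{op}}{\|\boldsymbol{\Sigma}_{\mathbf{x}}\|_{op}}\right\}.$$ Condition (i) is understood to hold almost surely for the sample.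
   Formalization: The probability bound 1−2ν for the event is asserted only when r_x ≥ 2; for r_x = 1, log r_x = 0 makes the event require sample moments equal to population moments, and the bound fails (e.g. p = n = 1, x uniform on {±1,±2}, y = q = x). The error bound on the event is kept for r_x = 1. *)

(* Defs.v *)
From HB Require Import structures.
From mathcomp Require Import all_boot all_order all_algebra.
From mathcomp Require Import all_classical all_reals all_analysis.

Set Implicit Arguments.
Unset Strict Implicit.
Unset Printing Implicit Defensive.

Import Order.TTheory GRing.Theory Num.Theory.
Import numFieldNormedType.Exports.

Local Open Scope classical_set_scope.
Local Open Scope ring_scope.

(* Matrices carry the product sigma-algebra of their entries, so that
   {RV P >-> 'cV[R]_p} is the type of random vectors of R^p. *)
Section matrix_measurable.
Context (R : realType) (m n : nat).

Definition mx_cylinder : set (set 'M[R]_(m, n)) :=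
  \bigcup_(ij in [set: 'I_m * 'I_n])
    preimage_set_system setT (fun M : 'M[R]_(m, n) => M ij.1 ij.2) measurable.

Let mx_measurable0 : <<s mx_cylinder >> set0.
Proof. exact: sigma_algebra0. Qed.

Let mx_measurableC A : <<s mx_cylinder >> A -> <<s mx_cylinder >> (~` A).
Proof. exact: sigma_algebraC. Qed.

Let mx_measurable_bigcup (F : (set 'M[R]_(m, n))^nat) :
  (forall i, <<s mx_cylinder >> (F i)) -> <<s mx_cylinder >> (\bigcup_i F i).
Proof. exact: sigma_algebra_bigcup. Qed.

HB.instance Definition _ := @isMeasurable.Build default_measure_display
  'M[R]_(m, n) <<s mx_cylinder >>
  mx_measurable0 mx_measurableC mx_measurable_bigcup.

End matrix_measurable.

Section linear_algebra.
Context {R : realType} {p : nat}.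
Implicit Types (A S : 'M[R]_p) (b u v : 'cV[R]_p) (V : {vspace 'cV[R]_p}).

Definition norm2 v : R := Num.sqrt (\sum_(i < p) v i 0 ^+ 2).

Definition opnorm A : R :=
  sup [set norm2 (A *m v) | v in [set v | norm2 v <= 1]].

Definition mxrange A : {vspace 'cV[R]_p} := limg (linfun (mulmx A)).

Definition krylov A b (s : nat) : {vspace 'cV[R]_p} :=
  <<[seq A ^+ k *m b | k <- iota 0 s]>>%VS.

Definition orthc V : {vspace 'cV[R]_p} :=
  (\bigcap_(u <- vbasis V) lker (linfun (mulmx u^T)))%VS.

(* Orthogonal complement of V inside W, and orthogonal projector onto V. *)
Definition orthc_in (W V : {vspace 'cV[R]_p}) : {vspace 'cV[R]_p} :=
  (W :&: orthc V)%VS.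

Definition orthproj V : 'End('cV[R]_p) := daddv_pi V (orthc V).

(* Eigenvalues with multiplicity, in nonincreasing order; nil when the
   characteristic polynomial does not split, which never happens for a
   symmetric matrix. *)
Definition spectrum A : seq R :=
  xget [::] [set t | sorted >=%R t /\
                     char_poly A = \prod_(a <- t) ('X - a%:P)].

(* Numbered from 1, as in lambda_1 >= lambda_2 >= ... *)
Definition eigval A (k : nat) : R := nth 0 (spectrum A) k.-1.

Definition kappa2 A : R :=
  head 0 (spectrum A) / last 0 [seq a <- spectrum A | a != 0].

Definition is_mpinv A S : Prop :=
  [/\ A *m S *m A = A, S *m A *m S = S,
      (A *m S)^T = A *m S & (S *m A)^T = S *m A].

Definition mpinv A : 'M[R]_p := xget 0 [set S | is_mpinv A S].

Definition is_argmin V (f : 'cV[R]_p -> R) b : Prop :=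
  b \in V /\ forall c, c \in V -> f b <= f c.

Definition is_min_norm_argmin V (f : 'cV[R]_p -> R) b : Prop :=
  is_argmin V f b /\ forall c, is_argmin V f c -> norm2 b <= norm2 c.

Definition pls_objective S v b : R :=
  (b^T *m S *m b) 0 0 - 2 * (b^T *m v) 0 0.

(* The minimum-norm minimizer exists and is unique when S = n^-1 X^T X and
   v = n^-1 X^T y; the default value 0 of xget is then not used. *)
Definition pls S v (s : nat) : 'cV[R]_p :=
  xget 0 [set b | is_min_norm_argmin (krylov S v s) (pls_objective S v) b].

Definition perturbation S v (Shat : 'M[R]_p) (vhat : 'cV[R]_p) : R :=
  Num.max (opnorm (Shat - S) / opnorm S) (norm2 (vhat - v) / norm2 v).

End linear_algebra.

Section moments.
Context {d : measure_display} {T : measurableType d} {R : realType}.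
Context (P : probability T R) {p : nat}.
Implicit Types (u v : T -> 'cV[R]_p) (y : T -> R) (B : {vspace 'cV[R]_p}).

Definition mean (f : T -> R) : R := fine 'E_P[f]%E.

Definition crossmom u v : 'M[R]_p :=
  \matrix_(i, j) mean (fun w => u w i 0 * v w j 0).

Definition Sigma u : 'M[R]_p := crossmom u u.

Definition sigmav u y : 'cV[R]_p :=
  \col_i mean (fun w => u w i 0 * y w).

Definition centered u : Prop :=
  forall i, 'E_P[fun w => (u w i 0)%R]%E = 0%E.

Definition square_integrable u : Prop :=
  ('E_P[fun w => (norm2 (u w) ^+ 2)%R] < +oo)%E.

Definition proj_rv B u : T -> 'cV[R]_p := fun w => orthproj B (u w).

Definition moment_ratio (f : T -> R) : R :=
  (mean (fun w => f w ^+ 4)) `^ 4^-1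
    / (mean (fun w => f w ^+ 2)) `^ 2^-1.

Definition L_sub u B : R :=
  if mean (fun w => norm2 (proj_rv B u w) ^+ 2) == 0 then 1
  else moment_ratio (fun w => norm2 (proj_rv B u w)).

Definition finite_moment_ratios u y : Prop :=
  ('E_P[fun w => (y w ^+ 4)%R] < +oo)%E /\
  forall B, (B <= mxrange (Sigma u))%VS ->
    ('E_P[fun w => (norm2 (proj_rv B u w) ^+ 4)%R] < +oo)%E.

Definition splits_relevance u y B : Prop :=
  let Bc := orthc_in (mxrange (Sigma u)) B in
  [/\ (B <= mxrange (Sigma u))%VS,
      sigmav (proj_rv Bc u) y = 0
    & crossmom (proj_rv Bc u) (proj_rv B u) = 0].

Definition is_relevant_subspace u y B : Prop :=
  splits_relevance u y B /\
  forall B', splits_relevance u y B' -> (\dim B <= \dim B')%N.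

Definition independent3 (q e : T -> 'cV[R]_p) (eps : T -> R) : Prop :=
  forall (A B : set 'cV[R]_p) (C : set R),
    measurable A -> measurable B -> measurable C ->
    P (q @^-1` A `&` e @^-1` B `&` eps @^-1` C) =
    (P (q @^-1` A) * P (e @^-1` B) * P (eps @^-1` C))%E.

Record latent_factor_model (x : T -> 'cV[R]_p) (y : T -> R)
    (By : {vspace 'cV[R]_p}) (q : T -> 'cV[R]_p) (alpha : 'cV[R]_p)
    (eps : T -> R) (sigma : R) (e : T -> 'cV[R]_p) : Prop :=
  LatentFactorModel {
    lfm_y : {ae P, forall w, y w = ((q w)^T *m alpha) 0 0 + eps w};
    lfm_xy : {ae P, forall w, proj_rv By x w = q w + sigma *: e w};
    lfm_x : {ae P, forall w, x w = q w + sigma *: e w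
               + proj_rv (orthc_in (mxrange (Sigma x)) By) x w};
    lfm_q_centered : centered q;
    lfm_q_square : square_integrable q;
    lfm_q_rank :
      (1 <= \rank (Sigma q) <= \rank (Sigma (proj_rv By x)))%N;
    lfm_q_range : (mxrange (Sigma q) <= By)%VS;
    lfm_eps_centered : 'E_P[eps]%E = 0%E;
    lfm_sigma_ge0 : 0 <= sigma;
    lfm_e_centered : centered e;
    lfm_e_square : square_integrable e;
    lfm_e_range : mxrange (Sigma e) = By;
    lfm_e_norm : eigval (Sigma e) 1 = 1;
    lfm_independent : independent3 q e eps;
    lfm_krylov :
      mxrange (Sigma q) = krylov (Sigma q) (sigmav q y) (\rank (Sigma q))
  }.

Definition parsimonious u y (By : {vspace 'cV[R]_p}) (s : nat) :
    {vspace 'cV[R]_p} :=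
  krylov (Sigma (proj_rv By u)) (sigmav (proj_rv By u) y) s.

Definition Mtilde u y By (s : nat) (Ct : R) : R :=
  let xs := proj_rv (parsimonious u y By s) (proj_rv By u) in
  2 * kappa2 (Sigma xs) * (4 * Ct + 1)
    * Num.max (opnorm (Sigma u) / opnorm (Sigma xs))
              (norm2 (sigmav u y) / norm2 (sigmav xs y)).

Definition Kconst u y (C : R) B : R :=
  99 * C * moment_ratio y * L_sub u B
    * Num.max
        ((mean (fun w => y w ^+ 2)) `^ 2^-1
           * opnorm (Sigma (proj_rv B u)) `^ 2^-1 / norm2 (sigmav u y))
        (opnorm (Sigma (proj_rv B u)) / opnorm (Sigma u)).

End moments.

Section sample.
Context {d : measure_display} {T : measurableType d} {R : realType}.
Context (P : probability T R) {p : nat}.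
Context {d' : measure_display} {T' : measurableType d'}.
Context (P' : probability T' R) {n : nat}.
Variables (x : T -> 'cV[R]_p) (y : T -> R).
Variable Z : 'I_n -> T' -> 'cV[R]_p * R.

(* The sample may live on another probability space than the pair (x, y). *)
Definition iid_copies : Prop :=
  (forall i (A : set ('cV[R]_p * R)), measurable A ->
     P' (Z i @^-1` A) = P ((fun w => (x w, y w)) @^-1` A)) /\
  (forall A : 'I_n -> set ('cV[R]_p * R), (forall i, measurable (A i)) ->
     P' (\bigcap_(i in [set: 'I_n]) (Z i @^-1` A i)) =
     (\prod_(i < n) fine (P' (Z i @^-1` A i)))%:E).

Definition dataX (w : T') : 'M[R]_(n, p) := \matrix_(i, j) (Z i w).1 j 0.

Definition datay (w : T') : 'cV[R]_n := \col_i (Z i w).2.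

Definition Sigma_hat (w : T') : 'M[R]_p :=
  n%:R^-1 *: ((dataX w)^T *m dataX w).

Definition sigmav_hat (w : T') : 'cV[R]_p :=
  n%:R^-1 *: ((dataX w)^T *m datay w).

Definition rho (B : {vspace 'cV[R]_p}) : R :=
  mean P' (fun w =>
    \big[Num.max/0]_(i < n) norm2 (orthproj B (Z i w).1) ^+ 2)
  / opnorm (Sigma P (proj_rv B x)).

Definition delta (B : {vspace 'cV[R]_p}) : R :=
  Num.sqrt (rho B * ln (\rank (Sigma P x))%:R / n%:R).

(* The middle factor makes this 0 when the second-moment matrix of the
   projection onto B is 0. *)
Definition subspace_score (B : {vspace 'cV[R]_p}) : R :=
  L_sub P x B * opnorm (Sigma P (proj_rv B x)) * rho B.

Definition is_worst_subspace (By : {vspace 'cV[R]_p}) (s : nat)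
    (B : {vspace 'cV[R]_p}) : Prop :=
  let Bs := parsimonious P x y By s in
  let cand := [:: Bs; orthc_in By Bs; orthc_in (mxrange (Sigma P x)) By] in
  B \in cand /\
  forall B', B' \in cand -> subspace_score B' <= subspace_score B.

End sample.

(* Main.v *)
Require Import Defs.
From HB Require Import structures.
From mathcomp Require Import all_boot all_order all_algebra.
From mathcomp Require Import all_classical all_reals all_analysis.
From mathcomp Require Import measurable_realfun.
From mathcomp Require Import complex spectral.
From mathcomp Require Import ring lra.

Set Implicit Arguments.
Unset Strict Implicit.
Unset Printing Implicit Defensive.

Import Order.TTheory GRing.Theory Num.Theory.
Import numFieldNormedType.Exports.

Local Open Scope classical_set_scope.
Local Open Scope ring_scope.

(** The argument has a deterministic and a probabilistic half, linked by one
    event: that both relative errors of the sample moments are small.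

    Deterministic half.  Wherever the Gram matrix of the Krylov vectors is
    invertible, the PLS coefficients are a rational function of the second
    moments [pls_closedE], hence locally Lipschitz [pls_lipschitz].  The
    constants of the theorem are chosen, separately for each population, from
    these Lipschitz constants.  The error then splits into three parts.
    - Sample against population: the moment errors are at most the inverse of
      the amplification factor, which stays within the neighbourhood where the
      Lipschitz bound holds [sample_constantP]; the amplification factor
      dominates the constant because the condition number and the maximum of
      ratios that enter it are at least 1 [Mtilde_ge].
    - Population against latent features: on the Krylov space of the population
      the second moments of x act as those of the latent part plus sigma^2
      times those of the noise [Sigma_relevant], [Sigma_latent], so the
      difference is a Lipschitz perturbation of size sigma^2
      [latent_constantP].
    - Latent coefficients after s steps against all steps: both coincide when
      s is the rank; otherwise, as for conjugate gradients, the increments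
      between successive steps have nonnegative inner products, so the
      remaining error is at most the norm of the least-squares coefficients
      [pls_shrinkage], whereas the right-hand side is at least 7/2 of it.

    Probabilistic half.  By Markov's inequality it suffices to bound the two
    expected relative moment errors by the product of K and delta.
    Symmetrization with an independent copy of the sample replaces each error
    by an average over random signs [symmetrization].  For the cross moment
    it is bounded by its mean square, which is explicit because distinct signs
    are uncorrelated.  For the matrix, a trace moment whose order is
    the logarithm of the rank is computed by flipping one sign at a time
    [rademacher_step], an inequality between mixed moments of two symmetric
    matrices closing the recursion.  Both averages involve the expected largest
    squared norm in the sample, which by Pythagoras is the sum of the
    contributions of the three candidate subspaces; each is at most the score
    of the worst one since the fourth-moment ratios are at least 1.  The matrix
    error appears on both sides of the resulting bound, a quadratic inequality
    that is solved in [matrix_deviation_bound]; the absolute constant of the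
    theorem can be taken equal to 1. *)

(** * Euclidean geometry of column vectors *)

Section dot.
Context {R : realType}.

Definition dot {p} (u v : 'cV[R]_p) : R := (u^T *m v) 0 0.

Lemma dotE p (u v : 'cV[R]_p) : dot u v = \sum_(i < p) u i 0 * v i 0.
Proof. by rewrite /dot mxE; apply: eq_bigr => i _; rewrite mxE. Qed.

Lemma dotC p (u v : 'cV[R]_p) : dot u v = dot v u.
Proof. by rewrite !dotE; apply: eq_bigr => i _; rewrite mulrC. Qed.

Lemma dotDr p (u v w : 'cV[R]_p) : dot u (v + w) = dot u v + dot u w.
Proof. by rewrite /dot mulmxDr mxE. Qed.

Lemma dotDl p (u v w : 'cV[R]_p) : dot (v + w) u = dot v u + dot w u.
Proof. by rewrite dotC dotDr !(dotC u). Qed.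

Lemma dotZr p a (u v : 'cV[R]_p) : dot u (a *: v) = a * dot u v.
Proof. by rewrite /dot -scalemxAr mxE. Qed.

Lemma dotZl p a (u v : 'cV[R]_p) : dot (a *: u) v = a * dot u v.
Proof. by rewrite dotC dotZr dotC. Qed.

Lemma dotNr p (u v : 'cV[R]_p) : dot u (- v) = - dot u v.
Proof. by rewrite -scaleN1r dotZr mulN1r. Qed.

Lemma dotNl p (u v : 'cV[R]_p) : dot (- u) v = - dot u v.
Proof. by rewrite dotC dotNr dotC. Qed.

Lemma dotBr p (u v w : 'cV[R]_p) : dot u (v - w) = dot u v - dot u w.
Proof. by rewrite dotDr dotNr. Qed.

Lemma dotBl p (u v w : 'cV[R]_p) : dot (v - w) u = dot v u - dot w u.
Proof. by rewrite dotDl dotNl. Qed.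

Lemma dot0r p (u : 'cV[R]_p) : dot u 0 = 0.
Proof. by rewrite /dot mulmx0 mxE. Qed.

Lemma dot0l p (u : 'cV[R]_p) : dot 0 u = 0.
Proof. by rewrite dotC dot0r. Qed.

Lemma dot_sumr p (I : Type) (r : seq I) (P : pred I) (F : I -> 'cV[R]_p) u :
  dot u (\sum_(i <- r | P i) F i) = \sum_(i <- r | P i) dot u (F i).
Proof.
by elim/big_rec2: _ => [|i y x _ <-]; rewrite ?dot0r// dotDr.
Qed.

Lemma dot_suml p (I : Type) (r : seq I) (P : pred I) (F : I -> 'cV[R]_p) u :
  dot (\sum_(i <- r | P i) F i) u = \sum_(i <- r | P i) dot (F i) u.
Proof. by rewrite dotC dot_sumr; apply: eq_bigr => i _; rewrite dotC. Qed.

Lemma dot_mulmxr p q (A : 'M[R]_(p, q)) u v : dot u (A *m v) = dot (A^T *m u) v.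
Proof. by rewrite /dot trmx_mul trmxK mulmxA. Qed.

Lemma dot_sym p (A : 'M[R]_p) u v : A^T = A -> dot u (A *m v) = dot (A *m u) v.
Proof. by move=> sA; rewrite dot_mulmxr sA. Qed.

Lemma dot_ge0 p (u : 'cV[R]_p) : 0 <= dot u u.
Proof. by rewrite dotE sumr_ge0// => i _; rewrite -expr2 sqr_ge0. Qed.

Lemma dot_eq0 p (u : 'cV[R]_p) : dot u u = 0 -> u = 0.
Proof.
rewrite dotE => /eqP; rewrite psumr_eq0; last by move=> i _; rewrite -expr2 sqr_ge0.
move=> /allP h; apply/colP => i; rewrite mxE; apply/eqP.
by have := h i (mem_index_enum _); rewrite mulf_eq0 orbb.
Qed.

Lemma dot_delta p (u : 'cV[R]_p) i : dot (delta_mx i 0) u = u i 0.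
Proof.
rewrite dotE (bigD1 i)//= mxE !eqxx mul1r big1 ?addr0// => j ji.
by rewrite mxE (negbTE ji) mul0r.
Qed.

Lemma norm2E p (u : 'cV[R]_p) : norm2 u = Num.sqrt (dot u u).
Proof. by rewrite /norm2 dotE; congr Num.sqrt; apply: eq_bigr => i _; rewrite expr2. Qed.

Lemma norm2_sqr p (u : 'cV[R]_p) : norm2 u ^+ 2 = dot u u.
Proof. by rewrite norm2E sqr_sqrtr// dot_ge0. Qed.

Lemma norm2_ge0 p (u : 'cV[R]_p) : 0 <= norm2 u.
Proof. by rewrite /norm2 sqrtr_ge0. Qed.

Lemma norm2_eq0 p (u : 'cV[R]_p) : norm2 u = 0 -> u = 0.
Proof. by move=> u0; apply: dot_eq0; rewrite -norm2_sqr u0 expr0n. Qed.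

Lemma norm2_0 p : norm2 (0 : 'cV[R]_p) = 0.
Proof. by rewrite norm2E dot0r sqrtr0. Qed.

Lemma norm2_gt0 p (u : 'cV[R]_p) : u != 0 -> 0 < norm2 u.
Proof.
by move=> u0; rewrite lt0r norm2_ge0 andbT; apply: contra_neq u0; exact: norm2_eq0.
Qed.

Lemma norm2Z p a (u : 'cV[R]_p) : norm2 (a *: u) = `|a| * norm2 u.
Proof.
by rewrite !norm2E dotZl dotZr mulrA -expr2 sqrtrM ?sqr_ge0// sqrtr_sqr.
Qed.

Lemma norm2N p (u : 'cV[R]_p) : norm2 (- u) = norm2 u.
Proof. by rewrite -scaleN1r norm2Z normrN1 mul1r. Qed.

Lemma norm2_leP p (u : 'cV[R]_p) c : 0 <= c -> (norm2 u <= c) = (dot u u <= c ^+ 2).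
Proof. by move=> c0; rewrite -norm2_sqr ler_pXn2r ?nnegrE// norm2_ge0. Qed.

Lemma cauchy_schwarz p (u v : 'cV[R]_p) : dot u v <= norm2 u * norm2 v.
Proof.
have [->|v0] := eqVneq v 0; first by rewrite dot0r norm2_0 mulr0.
have nv := norm2_gt0 v0.
have := dot_ge0 (norm2 v ^+ 2 *: u - dot u v *: v).
rewrite !(dotBl, dotBr, dotZl, dotZr) (dotC v u) -!norm2_sqr => h.
have h1 : 0 <= norm2 v ^+ 2 * ((norm2 u * norm2 v) ^+ 2 - dot u v ^+ 2) by nra.
have h2 : dot u v ^+ 2 <= (norm2 u * norm2 v) ^+ 2.
  by rewrite -subr_ge0 -(pmulr_rge0 _ (exprn_gt0 2 nv)).
have [d0|d0] := leP (dot u v) 0; first by rewrite (le_trans d0) ?mulr_ge0 ?norm2_ge0.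
by rewrite -(@ler_pXn2r _ 2)// ?nnegrE ?mulr_ge0 ?norm2_ge0// ltW.
Qed.

Lemma norm2D p (u v : 'cV[R]_p) : norm2 (u + v) <= norm2 u + norm2 v.
Proof.
rewrite norm2_leP ?addr_ge0 ?norm2_ge0//.
rewrite !(dotDl, dotDr) (dotC v u) sqrrD -!norm2_sqr.
have := cauchy_schwarz u v; lra.
Qed.

Lemma norm2_sum p (I : Type) (r : seq I) (P : pred I) (F : I -> 'cV[R]_p) :
  norm2 (\sum_(i <- r | P i) F i) <= \sum_(i <- r | P i) norm2 (F i).
Proof.
elim/big_rec2: _ => [|i y x _ h]; first by rewrite norm2_0.
by rewrite (le_trans (norm2D _ _))// lerD2l.
Qed.

Lemma norm2_entry p (u : 'cV[R]_p) i : `|u i 0| <= norm2 u.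
Proof.
rewrite -(@ler_pXn2r _ 2)// ?nnegrE ?norm2_ge0// real_normK ?num_real//.
rewrite norm2_sqr dotE (bigD1 i)//= -expr2 lerDl sumr_ge0// => j _.
by rewrite -expr2 sqr_ge0.
Qed.

Lemma norm2_delta p (i : 'I_p) : norm2 (delta_mx i 0 : 'cV[R]_p) = 1.
Proof. by rewrite norm2E dot_delta mxE !eqxx sqrtr1. Qed.

Lemma col_sum_delta p (u : 'cV[R]_p) : u = \sum_i u i 0 *: delta_mx i 0.
Proof.
apply/colP => i; rewrite summxE (bigD1 i)//= !mxE !eqxx mulr1 big1 ?addr0//.
by move=> j ji; rewrite !mxE eq_sym (negbTE ji) mulr0.
Qed.

Lemma norm2_le_sum p (u : 'cV[R]_p) : norm2 u <= \sum_i `|u i 0|.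
Proof.
rewrite {1}(col_sum_delta u) (le_trans (norm2_sum _ _ _))// ler_sum// => i _.
by rewrite norm2Z norm2_delta mulr1.
Qed.

Lemma norm2_mulmx_le_sum p (A : 'M[R]_p) v :
  norm2 (A *m v) <= (\sum_i \sum_j `|A i j|) * norm2 v.
Proof.
rewrite (le_trans (norm2_le_sum _))// mulr_suml ler_sum// => i _.
rewrite mxE (le_trans (ler_norm_sum _ _ _))// mulr_suml ler_sum// => j _.
by rewrite normrM ler_wpM2l// norm2_entry.
Qed.

Lemma opnorm_has_sup p (A : 'M[R]_p) :
  has_sup [set norm2 (A *m v) | v in [set v | norm2 v <= 1]].
Proof.
split; first by exists (norm2 (A *m 0)), 0 => //=; rewrite norm2_0.
exists (\sum_i \sum_j `|A i j|) => _ [v /= v1 <-].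
rewrite (le_trans (norm2_mulmx_le_sum _ _))// ler_piMr// sumr_ge0// => i _.
by rewrite sumr_ge0.
Qed.

Lemma opnorm_ge0 p (A : 'M[R]_p) : 0 <= opnorm A.
Proof.
apply: le_trans (norm2_ge0 (A *m 0)) _; apply: ub_le_sup.
  by case: (opnorm_has_sup A).
by exists 0 => //=; rewrite norm2_0.
Qed.

Lemma norm2_mulmx_le p (A : 'M[R]_p) v : norm2 (A *m v) <= opnorm A * norm2 v.
Proof.
have [->|v0] := eqVneq v 0; first by rewrite mulmx0 norm2_0 mulr0.
have nv := norm2_gt0 v0.
rewrite -ler_pdivrMr// -[X in _ / X]gtr0_norm// mulrC -normfV -norm2Z scalemxAr.
apply: ub_le_sup; first by case: (opnorm_has_sup A).
by exists ((norm2 v)^-1 *: v) => //=; rewrite norm2Z normfV gtr0_norm// mulVf// gt_eqF.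
Qed.

Lemma opnorm_le p (A : 'M[R]_p) c : 0 <= c ->
  (forall v, norm2 (A *m v) <= c * norm2 v) -> opnorm A <= c.
Proof.
move=> c0 h; apply: ge_sup; first by case: (opnorm_has_sup A).
by move=> _ [v /= v1 <-]; rewrite (le_trans (h v))// ler_piMr.
Qed.

Lemma opnorm_le_dual p (A : 'M[R]_p) c : 0 <= c ->
  (forall u v, norm2 u <= 1 -> norm2 v <= 1 -> dot u (A *m v) <= c) ->
  opnorm A <= c.
Proof.
move=> c0 h; apply: ge_sup; first by case: (opnorm_has_sup A).
move=> _ [v /= v1 <-].
have [->|Av0] := eqVneq (A *m v) 0; first by rewrite norm2_0.
have nv := norm2_gt0 Av0.
have := h ((norm2 (A *m v))^-1 *: (A *m v)) v.
rewrite norm2Z normfV gtr0_norm// mulVf ?gt_eqF// => /(_ (lexx _) v1).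
by rewrite dotZl -norm2_sqr expr2 mulKf// gt_eqF.
Qed.

Lemma dot_opnorm p (A : 'M[R]_p) u v : dot u (A *m v) <= opnorm A * (norm2 u * norm2 v).
Proof.
rewrite (le_trans (cauchy_schwarz _ _))// mulrCA ler_wpM2l ?norm2_ge0//.
exact: norm2_mulmx_le.
Qed.

Lemma opnorm_entry p (A : 'M[R]_p) i j : `|A i j| <= opnorm A.
Proof.
have -> : A i j = (A *m (delta_mx j 0 : 'cV_p)) i 0 by rewrite -colE mxE.
rewrite (le_trans (norm2_entry _ _))// (le_trans (norm2_mulmx_le _ _))//.
by rewrite norm2_delta mulr1.
Qed.

Lemma opnorm_le_sum p (A : 'M[R]_p) : opnorm A <= \sum_i \sum_j `|A i j|.
Proof.
apply: opnorm_le; last exact: norm2_mulmx_le_sum.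
by rewrite sumr_ge0// => i _; rewrite sumr_ge0.
Qed.

Lemma opnorm_eq0 p (A : 'M[R]_p) : opnorm A = 0 -> A = 0.
Proof.
move=> A0; apply/matrixP => i j; apply/eqP; rewrite mxE -normr_le0.
by rewrite -A0 opnorm_entry.
Qed.

Lemma opnormD p (A B : 'M[R]_p) : opnorm (A + B) <= opnorm A + opnorm B.
Proof.
apply: opnorm_le; first by rewrite addr_ge0 ?opnorm_ge0.
move=> v; rewrite mulmxDl mulrDl (le_trans (norm2D _ _))// lerD//;
exact: norm2_mulmx_le.
Qed.

Lemma opnormZ p a (A : 'M[R]_p) : 0 <= a -> opnorm (a *: A) <= a * opnorm A.
Proof.
move=> a0; apply: opnorm_le; first by rewrite mulr_ge0 ?opnorm_ge0.
move=> v; rewrite -scalemxAl norm2Z ger0_norm// -mulrA ler_wpM2l//.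
exact: norm2_mulmx_le.
Qed.

Lemma mulmx_eqP p q (A B : 'M[R]_(p, q)) : (forall v : 'cV_q, A *m v = B *m v) -> A = B.
Proof.
move=> h; apply/matrixP => i j; have := h (delta_mx j 0); rewrite -!colE.
by move/colP/(_ i); rewrite !mxE.
Qed.

End dot.

(** * Positive semidefinite matrices *)

Section psd.
Context {R : realType}.

Definition psd {p} (S : 'M[R]_p) : Prop := S^T = S /\ forall u, 0 <= dot u (S *m u).

(** Otherwise moving u along S u would make the form negative to first order. *)
Lemma psd_ker p (S : 'M[R]_p) u : psd S -> dot u (S *m u) = 0 -> S *m u = 0.
Proof.
move=> [sS pS] u0; apply: dot_eq0; set w := S *m u.
have h t : 0 <= 2 * t * dot w w + t ^+ 2 * dot w (S *m w).
  have := pS (u + t *: w).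
  rewrite mulmxDr -scalemxAr !(dotDl, dotDr, dotZl, dotZr) u0 (dot_sym u w sS).
  rewrite -/w; lra.
have [w0|w0] := eqVneq (dot w (S *m w)) 0.
  by have := h (-1); rewrite w0; have := dot_ge0 w; lra.
have wp : 0 < dot w (S *m w) by rewrite lt0r w0 pS.
have := h (- dot w w / dot w (S *m w)).
set a := dot w w; set b := dot w (S *m w).
have -> : 2 * (- a / b) * a + (- a / b) ^+ 2 * b = - (a ^+ 2 / b).
  by field; rewrite gt_eqF.
rewrite oppr_ge0 => h0; have : a ^+ 2 / b = 0.
  by apply/eqP; rewrite eq_le h0 divr_ge0 ?sqr_ge0// ltW.
by move/eqP; rewrite mulf_eq0 invr_eq0 (gt_eqF wp) orbF sqrf_eq0 => /eqP.
Qed.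

Lemma psd_congr p q (S : 'M[R]_p) (K : 'M[R]_(p, q)) : psd S -> psd (K^T *m S *m K).
Proof.
move=> [sS pS]; split; first by rewrite !trmx_mul trmxK sS mulmxA.
by move=> u; rewrite -!mulmxA dot_mulmxr trmxK; exact: pS.
Qed.

Lemma psd_outer p n (X : 'M[R]_(n, p)) : psd (X^T *m X).
Proof.
split; first by rewrite trmx_mul trmxK.
by move=> u; rewrite -mulmxA dot_mulmxr trmxK dot_ge0.
Qed.

Lemma psdZ p a (S : 'M[R]_p) : 0 <= a -> psd S -> psd (a *: S).
Proof.
move=> a0 [sS pS]; split; first by rewrite linearZ /= sS.
by move=> u; rewrite -scalemxAl dotZr mulr_ge0.
Qed.

Lemma psdD p (S S' : 'M[R]_p) : psd S -> psd S' -> psd (S + S').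
Proof.
move=> [sS pS] [sS' pS']; split; first by rewrite linearD /= sS sS'.
by move=> u; rewrite mulmxDl dotDr addr_ge0.
Qed.

Lemma psd_diag_ge0 p (S : 'M[R]_p) i : psd S -> 0 <= S i i.
Proof.
by move=> [_ /(_ (delta_mx i 0))]; rewrite dot_delta -colE mxE.
Qed.

(** The form is nonnegative at the sum and at the difference of two basis
    vectors. *)
Lemma psd_entry_le p (S : 'M[R]_p) i j : psd S -> `|S i j| <= \tr S.
Proof.
move=> pS; have [sS dS] := pS.
have Sji : S j i = S i j by rewrite -[in LHS]sS mxE.
have dii k l : dot (delta_mx k 0) (S *m delta_mx l 0) = S k l.
  by rewrite dot_delta -colE mxE.
have h1 := dS (delta_mx i 0 + delta_mx j 0).
have h2 := dS (delta_mx i 0 - delta_mx j 0).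
move: h1 h2; rewrite mulmxDr mulmxBr !(dotDl, dotDr, dotBl, dotBr, dotNl, dotNr).
rewrite !dii Sji => h1 h2.
have h3 : S i i + S j j <= 2 * \tr S.
  have tri k : S k k <= \tr S.
    rewrite /mxtrace (bigD1 k)//= lerDl sumr_ge0// => l _; exact: psd_diag_ge0.
  by have := tri i; have := tri j; lra.
by rewrite ler_norml; lra.
Qed.

End psd.

(** * Spectral measures of real symmetric matrices *)

Section spectral.
Context {R : realType}.
Local Notation rc := (real_complex R).

Lemma char_poly_conj (F : fieldType) p (P A : 'M[F]_p) : P \in unitmx ->
  char_poly (invmx P *m A *m P) = char_poly A.
Proof.
move=> uP; rewrite /char_poly.
have PP : map_mx polyC (invmx P) *m map_mx polyC P = 1%:M.
  by rewrite -map_mxM mulVmx// map_mx1.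
have -> : char_poly_mx (invmx P *m A *m P) =
    map_mx polyC (invmx P) *m char_poly_mx A *m map_mx polyC P.
  rewrite /char_poly_mx mulmxBr mulmxBl -!map_mxM; congr (_ - _).
  by rewrite mul_mx_scalar -scalemxAl PP scalemx1.
by rewrite !det_mulmx mulrAC -det_mulmx PP det1 mul1r.
Qed.

(** The matrix is diagonalized over the complex numbers; [d] lists its
    eigenvalues, and [a x] the squared moduli of the coordinates of x in an
    orthonormal eigenbasis.  Quadratic forms of all powers become sums against
    one nonnegative measure, which avoids real eigenvectors altogether. *)
Lemma symmetric_spectral_measure p (A : 'M[R]_p) : A^T = A ->
  exists (d : 'I_p -> R) (a : 'cV[R]_p -> 'I_p -> R),
  [/\ forall x i, 0 <= a x i,
      forall x q, dot x (A ^+ q *m x) = \sum_i d i ^+ q * a x i,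
      forall q, \tr (A ^+ q) = \sum_i d i ^+ q
    & char_poly A = \prod_i ('X - (d i)%:P)].
Proof.
move=> sA; pose AC := map_mx rc A; pose U := spectralmx AC.
pose D := spectral_diag AC; pose Us := map_mx Num.conj U^T.
have sAC : AC \is symmetricmx.
  by apply/is_hermitianmxP/matrixP => i j; rewrite !mxE -[in LHS]sA expr0 mul1r !mxE.
have rAC : AC \is a mxOver Num.real.
  by apply/mxOverP => i j; rewrite !mxE; apply/complex_realP; exists (A i j).
have hAC := realsym_hermsym sAC rAC.
have uU : U \is unitarymx by exact: spectral_unitarymx.
have UUs : U *m Us = 1%:M by exact/unitarymxP.
have UsU : Us *m U = 1%:M by exact: mulmx1C.
have iU : invmx U = Us by exact: invmx_unitary.
have eAC : AC = Us *m diag_mx D *m U.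
  by rewrite -iU; apply/orthomx_spectralP/hermitian_normalmx.
have rD := hermitian_spectral_diag_real hAC.
pose d i := complex.Re (D 0 i).
have dE i : rc (d i) = D 0 i by apply: RRe_real; exact: (mxOverP rD).
have eACq q : AC ^+ q = Us *m diag_mx (\row_i D 0 i ^+ q) *m U.
  elim: q => [|q IH].
    rewrite expr0; have -> : diag_mx (\row_i D 0 i ^+ 0) = 1%:M.
      by rewrite -diag_const_mx; congr diag_mx; apply/rowP => i; rewrite !mxE.
    by rewrite mulmx1 UsU.
  rewrite exprSr -mulmxE IH eAC -!mulmxA (mulmxA U) UUs mul1mx.
  have <- : diag_mx (\row_i D 0 i ^+ q) *m diag_mx D = diag_mx (\row_i D 0 i ^+ q.+1).
    by rewrite mulmx_diag; congr diag_mx; apply/rowP => i; rewrite !mxE exprSr.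
  by rewrite -!mulmxA.
pose z (x : 'cV[R]_p) := U *m map_mx rc x.
pose a x i := complex.Re (z x i 0) ^+ 2 + complex.Im (z x i 0) ^+ 2.
have mapAq q : map_mx rc (A ^+ q) = AC ^+ q.
  by elim: q => [|q IH]; rewrite ?expr0 ?map_mx1// !exprSr -!mulmxE map_mxM IH.
exists d, a; split.
- by move=> x i; rewrite addr_ge0 ?sqr_ge0.
- move=> x q; apply: (@complexI R).
  have -> : rc (dot x (A ^+ q *m x)) =
      ((map_mx rc x)^T *m (AC ^+ q *m map_mx rc x)) 0 0.
    by rewrite -mapAq -map_mxM map_trmx -map_mxM mxE.
  rewrite eACq -!mulmxA -/(z x) mulmxA.
  have -> : (map_mx rc x)^T *m Us = map_mx Num.conj (z x)^T.
    rewrite /z trmx_mul map_mxM; congr (_ *m _); apply/matrixP => i j.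
    by rewrite !mxE; apply/esym/CrealP/complex_realP; exists (x j i).
  rewrite mxE rmorph_sum/=; apply: eq_bigr => i _.
  rewrite mul_diag_mx !mxE -dE mulrCA; rewrite rmorphM rmorphXn/=; congr (_ * _).
  by rewrite /a add_Re2_Im2 normCK mulrC /z mxE.
- move=> q; apply: (@complexI R); rewrite -trace_map_mx mapAq eACq mxtrace_mulC.
  rewrite mulmxA UUs mul1mx mxtrace_diag rmorph_sum; apply: eq_bigr => i _.
  by rewrite mxE -dE rmorphXn.
- apply: (@map_poly_inj _ _ rc); rewrite map_char_poly -/AC eAC -iU.
  rewrite char_poly_conj ?spectral_unit// char_poly_trig ?diag_mx_is_trig//.
  rewrite rmorph_prod; apply: eq_bigr => i _.
  by rewrite rmorphB/= map_polyX map_polyC/= dE !mxE eqxx mulr1n.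
Qed.

End spectral.

(** * Eigenvalues and the condition number *)

Section eigenvalues.
Context {R : realType}.

(** The default value in the definition of the spectrum is not reached. *)
Lemma spectrum_symmetric p (A : 'M[R]_p) : A^T = A ->
  sorted >=%R (spectrum A) /\ char_poly A = \prod_(a <- spectrum A) ('X - a%:P).
Proof.
move=> sA; have [d [a [_ _ _ cA]]] := symmetric_spectral_measure sA.
apply: (@xgetPex _ [::] [set t | sorted >=%R t /\
  char_poly A = \prod_(a <- t) ('X - a%:P)]).
exists (sort >=%R (codom d)); split.
  by apply: sort_sorted => x y; exact: ge_total.
rewrite (perm_big (codom d)) ?perm_sort//= cA.
by rewrite codomE big_map big_enum.
Qed.

Lemma spectrum_le_head p (A : 'M[R]_p) a : A^T = A -> a \in spectrum A ->
  a <= head 0 (spectrum A).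
Proof.
move=> /spectrum_symmetric[+ _]; case: (spectrum A) => //= b t.
rewrite path_sortedE; last exact: ge_trans.
by move=> /andP[/allP bt _]; rewrite inE => /orP[/eqP->//|/bt].
Qed.

Lemma mem_spectrum p (A : 'M[R]_p) a : A^T = A ->
  (a \in spectrum A) = root (char_poly A) a.
Proof. by move=> /spectrum_symmetric[_ ->]; rewrite root_prod_XsubC. Qed.

Lemma spectrum_psd_ge0 p (S : 'M[R]_p) a : psd S -> a \in spectrum S -> 0 <= a.
Proof.
move=> [sS pS]; rewrite mem_spectrum// -eigenvalue_root_char.
move=> /eigenvalueP[v vS v0].
have := pS v^T; have -> : S *m v^T = a *: v^T.
  by rewrite -{1}sS -trmx_mul vS linearZ.
rewrite dotZr pmulr_lge0// -norm2_sqr exprn_gt0// norm2_gt0//.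
by rewrite trmx_eq0.
Qed.

Lemma mxtrace_le_head p (S : 'M[R]_p) : S^T = S ->
  \tr S <= p%:R * head 0 (spectrum S).
Proof.
move=> sS; have [d [a [_ _ tS cS]]] := symmetric_spectral_measure sS.
rewrite -[S in \tr S]expr1 tS -[p in p%:R]card_ord -sum1_card natr_sum mulr_suml.
apply: ler_sum => i _; rewrite mul1r expr1 spectrum_le_head// mem_spectrum//.
by rewrite cS (bigD1 i)//= rootM root_XsubC eqxx.
Qed.

Lemma kappa2_ge1 p (S : 'M[R]_p) : psd S -> S != 0 -> 1 <= kappa2 S.
Proof.
move=> pS S0; have [sS _] := pS.
have h0 : 0 < head 0 (spectrum S).
  rewrite lt0r; apply/andP; split; last first.
    have : forall a, a \in spectrum S -> 0 <= a by move=> a; exact: spectrum_psd_ge0.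
    by case: (spectrum S) => //= a t; apply; rewrite mem_head.
  apply: contra S0 => /eqP h0; apply/eqP/matrixP => i j; apply/eqP.
  rewrite mxE -normr_le0 (le_trans (psd_entry_le i j pS))//.
  by rewrite (le_trans (mxtrace_le_head sS))// h0 mulr0.
have hin : head 0 (spectrum S) \in spectrum S.
  by move: h0; case: (spectrum S) => [|a t]; rewrite /= ?ltxx// mem_head.
set l := last 0 [seq a <- spectrum S | a != 0].
have : l \in [seq a <- spectrum S | a != 0].
  have : head 0 (spectrum S) \in [seq a <- spectrum S | a != 0].
    by rewrite mem_filter hin (gt_eqF h0).
  by rewrite /l; case: [seq _ <- _ | _] => //= a t _; rewrite mem_last.
rewrite mem_filter => /andP[l0 lin].
have lp : 0 < l by rewrite lt0r l0 (spectrum_psd_ge0 pS).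
by rewrite /kappa2 -/l ler_pdivlMr// mul1r spectrum_le_head.
Qed.

End eigenvalues.

(** * Orthogonal projections *)

Section orthproj.
Context {R : realType} {p : nat}.
Implicit Types (V W : {vspace 'cV[R]_p}) (u v : 'cV[R]_p) (A : 'M[R]_p).

Lemma linfun_mulmxE m (A : 'M[R]_(m, p)) u : linfun (mulmx A) u = A *m u.
Proof. by rewrite lfunE. Qed.

Lemma memv_orthcP V u :
  reflect (forall v, v \in V -> dot v u = 0) (u \in orthc V).
Proof.
have -> : (u \in orthc V) = all (fun b => dot b u == 0) (vbasis V).
  rewrite /orthc; elim: (tval (vbasis V)) => [|b l IH].
    by rewrite big_nil memvf.
  rewrite big_cons memv_cap IH /=; congr (_ && _).
  rewrite memv_ker linfun_mulmxE /dot; apply/eqP/eqP => [->|h]; first by rewrite mxE.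
  by apply/matrixP => i j; rewrite !ord1 h mxE.
apply: (iffP allP) => [h v vV|h b bV].
  rewrite (coord_vbasis vV) dot_suml big1// => i _.
  have /h/eqP bu : (vbasis V)`_i \in vbasis V by rewrite mem_nth// size_tuple.
  by rewrite dotZl bu mulr0.
by apply/eqP/h; exact: vbasis_mem.
Qed.

Lemma orthc_cap V : (V :&: orthc V)%VS = 0%VS.
Proof.
apply/eqP; rewrite -subv0; apply/subvP => u; rewrite memv_cap memv0.
by move=> /andP[uV /memv_orthcP/(_ _ uV)/dot_eq0/eqP].
Qed.

(** Orthogonality to a basis of V is a system of dim V linear equations, so its
    solutions have codimension at most dim V. *)
Lemma orthc_add V : (V + orthc V)%VS = fullv.
Proof.
pose B : 'M[R]_(\dim V, p) := \matrix_(i, j) (vbasis V)`_i j 0.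
have kB : lker (linfun (mulmx B)) = orthc V.
  apply/eqP; rewrite eqEsubv; apply/andP; split; apply/subvP => u.
    rewrite memv_ker linfun_mulmxE => /eqP Bu; apply/memv_orthcP => v vV.
    rewrite (coord_vbasis vV) dot_suml big1// => i _; rewrite dotZl.
    have /colP/(_ i) := Bu; rewrite !mxE dotE => Bui; rewrite -[RHS](mulr0 (coord (vbasis V) i v)).
    by congr (_ * _); rewrite -[RHS]Bui; apply: eq_bigr => j _; rewrite mxE.
  move=> /memv_orthcP h; rewrite memv_ker linfun_mulmxE; apply/eqP/colP => i.
  rewrite !mxE -[RHS](h (vbasis V)`_i) ?dotE; last first.
    by apply: vbasis_mem; rewrite mem_nth// size_tuple.
  by apply: eq_bigr => j _; rewrite mxE.
apply/eqP; rewrite -dimv_leqif_eq ?subvf//; rewrite eqn_leq dimvS ?subvf//=.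
have := limg_ker_dim (linfun (mulmx B : 'cV_p -> 'cV_(\dim V))) fullv.
rewrite capfv kB => <-.
rewrite dimv_disjoint_sum ?orthc_cap// addnC leq_add2r.
by rewrite (leq_trans (dimvS (subvf _)))// dimvf dim_matrix mulr1.
Qed.

Lemma orthproj_mem V u : orthproj V u \in V.
Proof. exact: memv_pi. Qed.

Lemma orthproj_id V u : u \in V -> orthproj V u = u.
Proof. by move=> uV; apply: daddv_pi_id => //; exact: orthc_cap. Qed.

Lemma orthproj_sub V u : u - orthproj V u \in orthc V.
Proof.
have := @daddv_pi_add _ _ V (orthc V) u (orthc_cap V).
rewrite orthc_add memvf => /(_ isT) h; rewrite -{1}h addrC addKr; exact: memv_pi.
Qed.

Lemma orthproj_dotr V u v : dot (orthproj V u) v = dot (orthproj V u) (orthproj V v).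
Proof.
have /memv_orthcP/(_ _ (orthproj_mem V u)) := orthproj_sub V v.
by rewrite dotBr => /eqP; rewrite subr_eq0 => /eqP.
Qed.

Lemma orthproj_self_adj V u v : dot (orthproj V u) v = dot u (orthproj V v).
Proof. by rewrite orthproj_dotr dotC -orthproj_dotr dotC. Qed.

Lemma orthproj_uniq V u w : w \in V -> u - w \in orthc V -> orthproj V u = w.
Proof.
move=> wV uw; have dV : orthproj V u - w \in V by rewrite memvB// orthproj_mem.
have dO : orthproj V u - w \in orthc V.
  have -> : orthproj V u - w = (u - w) - (u - orthproj V u).
    by rewrite opprB addrCA addrAC subrr add0r.
  by rewrite memvB// orthproj_sub.
have /memv_orthcP/(_ _ dV)/dot_eq0/eqP := dO.
by rewrite subr_eq0 => /eqP.
Qed.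

(** The projection as a matrix, to be multiplied with moment matrices. *)
Definition projmx V : 'M[R]_p := \matrix_(i, j) orthproj V (delta_mx j 0) i 0.

Lemma projmxE V u : projmx V *m u = orthproj V u.
Proof.
rewrite {2}(col_sum_delta u) linear_sum/=; apply/colP => i; rewrite !mxE summxE.
by apply: eq_bigr => j _; rewrite linearZ/= !mxE mulrC.
Qed.

Lemma projmx_sym V : (projmx V)^T = projmx V.
Proof.
apply/matrixP => i j; rewrite !mxE.
rewrite -(dot_delta (orthproj V (delta_mx i 0)) j).
by rewrite -(dot_delta (orthproj V (delta_mx j 0)) i) -orthproj_self_adj dotC.
Qed.

Lemma projmx_idem V : projmx V *m projmx V = projmx V.
Proof.
by apply: mulmx_eqP => u; rewrite -mulmxA !projmxE orthproj_id// orthproj_mem.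
Qed.

Lemma norm2_orthproj V u : norm2 (orthproj V u) <= norm2 u.
Proof.
rewrite norm2_leP ?norm2_ge0// norm2_sqr -orthproj_dotr.
have := dot_ge0 (u - orthproj V u).
rewrite !(dotBl, dotBr) (dotC u) -orthproj_dotr; lra.
Qed.

Lemma mxrangeP A u : reflect (exists z, u = A *m z) (u \in mxrange A).
Proof.
apply: (iffP memv_imgP) => [[z _ ->]|[z ->]]; exists z => //.
  by rewrite linfun_mulmxE.
  exact: memvf.
by rewrite linfun_mulmxE.
Qed.

Lemma orthproj_mxrange A u : A^T = A -> A *m orthproj (mxrange A) u = A *m u.
Proof.
move=> sA; apply/eqP; rewrite -subr_eq0 -opprB oppr_eq0 -mulmxBr; apply/eqP.
apply: dot_eq0; set w := u - _.
have /memv_orthcP h := orthproj_sub (mxrange A) u.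
by rewrite (dotC _ (A *m w)) dot_mulmxr sA h//; apply/mxrangeP; exists (A *m w).
Qed.

Lemma range_ker A u : A^T = A -> u \in mxrange A -> A *m u = 0 -> u = 0.
Proof.
move=> sA /mxrangeP[z ->] Au; apply: dot_eq0.
by rewrite dot_mulmxr sA Au dot0l.
Qed.

(** In a full-rank factorization Q = C B of an idempotent, B C is the identity,
    of size the rank. *)
Lemma mxtrace_idem (Q : 'M[R]_p) : Q *m Q = Q -> \tr Q = (\rank Q)%:R.
Proof.
move=> QQ; have := mulmx_base Q; set C := col_base Q; set B := row_base Q => CB.
have BC : B *m C = 1%:M.
  apply: (row_free_inj (row_base_free Q)); rewrite -/B mul1mx.
  have fC : row_free C^T by rewrite /row_free mxrank_tr; exact: col_base_full.
  apply: trmx_inj; apply: (row_free_inj fC).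
  have e : C *m (B *m C *m B) = C *m B by rewrite -mulmxA mulmxA CB QQ.
  by rewrite -[LHS]trmx_mul -[RHS]trmx_mul e.
have -> : \tr Q = \tr (C *m B) by rewrite CB.
by rewrite mxtrace_mulC BC mxtrace1.
Qed.

Lemma mxtrace_projmx_range A : \tr (projmx (mxrange A)) <= (\rank A)%:R.
Proof.
rewrite mxtrace_idem ?projmx_idem// ler_nat.
have [Z ->] : exists Z, projmx (mxrange A) = A *m Z.
  have /(_ _)/cid-/all_sig[f fE] i := 
    mxrangeP A _ (orthproj_mem (mxrange A) (delta_mx i 0)).
  exists (\matrix_(i, j) f j i 0); apply: mulmx_eqP => u.
  rewrite projmxE (col_sum_delta u) linear_sum/= mulmx_sumr; apply: eq_bigr => i _.
  rewrite linearZ/= fE -scalemxAr; congr (_ *: _); rewrite -mulmxA -colE.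
  by congr (_ *m _); apply/colP => j; rewrite !mxE.
exact: mxrankM_maxl.
Qed.

Lemma orthc_inP V W u :
  (u \in orthc_in W V) <-> u \in W /\ forall v, v \in V -> dot v u = 0.
Proof.
rewrite /orthc_in memv_cap; split => [/andP[uW /memv_orthcP]//|[-> h]/=].
exact/memv_orthcP.
Qed.

(** This is the decomposition behind every use of Pythagoras below. *)
Lemma orthproj_orthc_in V W u : (V <= W)%VS ->
  orthproj W u = orthproj V u + orthproj (orthc_in W V) u.
Proof.
move=> /subvP VW; apply: orthproj_uniq.
  apply: memvD; first by rewrite VW ?orthproj_mem.
  by have /orthc_inP[] := orthproj_mem (orthc_in W V) u.
apply/memv_orthcP => w wW.
set a := orthproj V u; set b := orthproj _ u.
have hw : w - orthproj V w \in orthc_in W V.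
  apply/orthc_inP; split; first by rewrite memvB// VW// orthproj_mem.
  exact/memv_orthcP/orthproj_sub.
have h1 : dot (orthproj V w) (u - a) = 0.
  by move/memv_orthcP: (orthproj_sub V u); apply; exact: orthproj_mem.
have h2 : dot (w - orthproj V w) (u - b) = 0.
  by move/memv_orthcP: (orthproj_sub (orthc_in W V) u); apply.
have h3 : dot (orthproj V w) b = 0.
  by have /orthc_inP[_] := orthproj_mem (orthc_in W V) u; apply; exact: orthproj_mem.
have h4 : dot (w - orthproj V w) a = 0.
  by rewrite dotC; have /orthc_inP[_] := hw; apply; exact: orthproj_mem.
by move: h1 h2 h3 h4; rewrite opprD !(dotDl, dotDr, dotNl, dotNr); lra.
Qed.

Lemma dot_orthproj_orthc_in V W u : 
  dot (orthproj V u) (orthproj (orthc_in W V) u) = 0.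
Proof.
by have /orthc_inP[_] := orthproj_mem (orthc_in W V) u; apply; exact: orthproj_mem.
Qed.

Lemma norm2_orthc_in V W u : (V <= W)%VS ->
  norm2 (orthproj W u) ^+ 2 =
  norm2 (orthproj V u) ^+ 2 + norm2 (orthproj (orthc_in W V) u) ^+ 2.
Proof.
move=> VW; rewrite !norm2_sqr (orthproj_orthc_in _ VW) !(dotDl, dotDr).
rewrite (dotC (orthproj (orthc_in W V) u) (orthproj V u)) dot_orthproj_orthc_in; lra.
Qed.

End orthproj.

(** * Krylov spaces and the closed form of the PLS coefficients *)

Section krylov.
Context {R : realType} {p : nat}.
Implicit Types (S : 'M[R]_p) (v : 'cV[R]_p).

(** The columns are the Krylov vectors, so that Krylov coordinates are column
    vectors. *)
Definition krylovmx S v s : 'M[R]_(p, s) := \matrix_(i, k) (S ^+ k *m v) i 0.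

Lemma krylovmx_mul S v s (c : 'cV_s) :
  krylovmx S v s *m c = \sum_k c k 0 *: (S ^+ k *m v).
Proof.
apply/colP => i; rewrite summxE !mxE; apply: eq_bigr => k _.
by rewrite [krylovmx _ _ _ _ _]mxE [in RHS]mxE mulrC.
Qed.

Lemma krylovP S v s u :
  reflect (exists c, u = krylovmx S v s *m c) (u \in krylov S v s).
Proof.
rewrite /krylov; set X := [seq _ | _ <- _].
have szX : size X == s by rewrite size_map size_iota.
have nX (k : 'I_s) : X`_k = S ^+ k *m v.
  by rewrite (nth_map 0%N) ?size_iota// nth_iota// add0n.
apply: (iffP idP) => [uX|[c ->]].
  exists (\col_k coord (Tuple szX) k u); rewrite krylovmx_mul.
  rewrite {1}(@coord_span _ _ _ (Tuple szX) u uX).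
  by apply: eq_bigr => k _; rewrite mxE nX.
rewrite krylovmx_mul; apply: rpred_sum => k _; apply: rpredZ.
by apply: memv_span; apply/mapP; exists (val k); rewrite ?mem_iota/=.
Qed.

Lemma krylov_power S v s (k : 'I_s) : S ^+ k *m v \in krylov S v s.
Proof. by apply: memv_span; apply/mapP; exists (val k); rewrite ?mem_iota/=. Qed.

Lemma krylov_sub S v s (V : {vspace 'cV[R]_p}) : (forall k : 'I_s, S ^+ k *m v \in V) ->
  (krylov S v s <= V)%VS.
Proof.
move=> h; apply/subvP => u /krylovP[c ->]; rewrite krylovmx_mul.
by apply: rpred_sum => k _; apply: rpredZ.
Qed.

Lemma krylov_mono S v s t : (s <= t)%N -> (krylov S v s <= krylov S v t)%VS.
Proof.
move=> st; apply: krylov_sub => k.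
exact: (krylov_power S v (widen_ord st k)).
Qed.

Lemma krylov_mulmx S v s u : u \in krylov S v s -> S *m u \in krylov S v s.+1.
Proof.
move=> /krylovP[c ->]; rewrite krylovmx_mul mulmx_sumr; apply: rpred_sum => k _.
rewrite -scalemxAr; apply: rpredZ; rewrite mulmxA mulmxE -exprS.
exact: (krylov_power S v (lift ord0 k)).
Qed.

Definition independent_krylov S v s := forall c : 'cV_s, krylovmx S v s *m c = 0 -> c = 0.

(** A relation between the first vectors extends by zero coefficients. *)
Lemma independent_krylov_le S v s t : (s <= t)%N ->
  independent_krylov S v t -> independent_krylov S v s.
Proof.
move=> st h c; rewrite krylovmx_mul => c0.
pose c' : 'cV[R]_t := \col_k (if insub (val k) is Some j then c j 0 else 0).
have /h c'0 : krylovmx S v t *m c' = 0.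
  rewrite krylovmx_mul -[RHS]c0.
  transitivity (\sum_(0 <= k < t)
      (if insub k is Some j then c j 0 else 0) *: (S ^+ k *m v)).
    by rewrite big_mkord; apply: eq_bigr => k _; rewrite mxE.
  rewrite (big_cat_nat _ st)//= [X in _ + X]big1_seq ?addr0; last first.
    move=> k; rewrite mem_index_iota => /andP[_ /andP[sk _]].
    by rewrite insubF ?scale0r// ltnNge sk.
  by rewrite big_mkord; apply: eq_bigr => k _; rewrite valK.
apply/colP => k; have /colP/(_ (widen_ord st k)) := c'0.
by rewrite !mxE /= valK.
Qed.

Definition gram S v s := (krylovmx S v s)^T *m S *m krylovmx S v s.

(** A vector in the kernel of the Gram matrix gives a Krylov vector that S
    kills; since the Krylov vectors lie in the range of S, it vanishes. *)
Lemma gram_unit S v s : psd S -> v \in mxrange S -> independent_krylov S v s ->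
  gram S v s \in unitmx.
Proof.
move=> pS vS iK; have [sS dS] := pS.
rewrite -unitmx_tr -row_free_unit -kermx_eq0; apply/eqP/row_matrixP => i.
rewrite row0; set r := row i _; have : r *m (gram S v s)^T = 0.
  by apply/sub_kermxP; rewrite row_sub.
move=> /(congr1 trmx); rewrite trmx_mul trmxK trmx0 => Gr.
apply: trmx_inj; rewrite trmx0; apply: iK.
set u := krylovmx S v s *m r^T.
have Su : S *m u = 0.
  apply: psd_ker => //; rewrite /u -[in RHS](dot0r (r^T)) -Gr /gram.
  by rewrite -!mulmxA [in RHS]dot_mulmxr trmxK.
apply: (range_ker sS _ Su).
rewrite /u krylovmx_mul; apply: rpred_sum => k _; apply: rpredZ.
case: k => [[|k]] /= _; first by rewrite expr0 mul1mx.
by apply/mxrangeP; exists (S ^+ k *m v); rewrite exprS -mulmxE mulmxA.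
Qed.

Definition pls_closed S v s : 'cV[R]_p :=
  krylovmx S v s *m (invmx (gram S v s) *m ((krylovmx S v s)^T *m v)).

(** Completing the square in the Krylov coordinates; the minimizer is unique
    there, hence also the one of minimum norm. *)
Lemma pls_closedE S v s : psd S -> gram S v s \in unitmx ->
  pls S v s = pls_closed S v s.
Proof.
move=> pS uG; have [sS dS] := pS.
set K := krylovmx S v s; set G := gram S v s; set g := K^T *m v.
pose c0 := invmx G *m g.
have Gc0 : G *m c0 = g by rewrite mulmxA mulmxV// mul1mx.
have pG : psd G by exact: psd_congr.
have [sG dG] := pG.
have fE c : pls_objective S v (K *m c) = dot (c - c0) (G *m (c - c0)) - dot c0 g.
  have -> : pls_objective S v (K *m c) = dot c (G *m c) - 2 * dot c g.
    rewrite /pls_objective -/(dot (K *m c) v) -mulmxA -/(dot (K *m c) (S *m (K *m c))).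
    by rewrite /G /gram /g -!mulmxA !(dot_mulmxr (krylovmx S v s)^T c) trmxK.
  rewrite mulmxBr Gc0 !(dotBl, dotBr) (dot_sym c0 c sG) Gc0 (dotC g c); ring.
have argP b : is_argmin (krylov S v s) (pls_objective S v) b <-> b = K *m c0.
  split=> [[/krylovP[c ->] /(_ (K *m c0))]|->].
    have -> : K *m c0 \in krylov S v s by apply/krylovP; exists c0.
    move=> /(_ isT); rewrite !fE subrr mulmx0 dot0r lerD2r => h.
    have /(psd_ker pG) : dot (c - c0) (G *m (c - c0)) = 0.
      by apply/eqP; rewrite eq_le h dG.
    move=> /(congr1 (mulmx (invmx G))); rewrite mulKmx// mulmx0.
    by move=> /eqP; rewrite subr_eq0 => /eqP ->.
  split; first by apply/krylovP; exists c0.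
  move=> _ /krylovP[c ->]; rewrite !fE subrr mulmx0 dot0r lerD2r; exact: dG.
have mnP b : is_min_norm_argmin (krylov S v s) (pls_objective S v) b <-> b = K *m c0.
  split=> [[/argP]//|->]; split; first exact/argP.
  by move=> c /argP ->.
apply/mnP; apply: (@xgetPex _ 0 [set b | is_min_norm_argmin _ _ b]).
by exists (K *m c0); apply/mnP.
Qed.

Lemma pls_mem S v s : psd S -> gram S v s \in unitmx -> pls S v s \in krylov S v s.
Proof. by move=> pS uG; rewrite pls_closedE//; apply/krylovP; eexists. Qed.

(** The normal equations of the minimization; [pls_uniq] is their converse. *)
Lemma pls_residual S v s u : psd S -> gram S v s \in unitmx ->
  u \in krylov S v s -> dot u (v - S *m pls S v s) = 0.
Proof.
move=> pS uG /krylovP[c ->]; rewrite dotC dot_mulmxr dotC pls_closedE// /pls_closed.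
by rewrite mulmxBr !mulmxA -/(gram S v s) mulmxV// mul1mx subrr dot0r.
Qed.

Lemma pls_uniq S v s b : psd S -> gram S v s \in unitmx -> b \in krylov S v s ->
  (forall u, u \in krylov S v s -> dot u (v - S *m b) = 0) -> pls S v s = b.
Proof.
move=> pS uG /krylovP[c ->] h; rewrite pls_closedE// /pls_closed; congr (_ *m _).
suff -> : (krylovmx S v s)^T *m v = gram S v s *m c by rewrite mulmxA mulVmx// mul1mx.
apply/eqP; rewrite -subr_eq0 /gram -!mulmxA -mulmxBr; apply/eqP/dot_eq0.
by rewrite dot_mulmxr trmxK h//; apply/krylovP; eexists.
Qed.

End krylov.

(** * Shrinkage of the PLS coefficients *)

Section shrinkage.
Context {R : realType} {p : nat}.
Variables (S : 'M[R]_p) (v a : 'cV[R]_p) (r : nat).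
Hypotheses (pS : psd S) (iK : independent_krylov S v r).
Hypotheses (aK : a \in krylov S v r) (vE : v = S *m a).

Let sS : S^T = S. Proof. by case: pS. Qed.

Let gU j : (j <= r)%N -> gram S v j \in unitmx.
Proof.
move=> jr; apply: gram_unit => //; first by apply/mxrangeP; exists a.
exact: independent_krylov_le iK.
Qed.

Let b j := pls S v j.
Let res j := v - S *m b j.
Let d j := b j.+1 - b j.
Let E j := dot (d j) (S *m d j).

Let bK j k : (j <= k)%N -> (j <= r)%N -> b j \in krylov S v k.
Proof. by move=> jk jr; apply: (subvP (krylov_mono S v jk)); exact/pls_mem/gU. Qed.

Let resK j k : (j < k)%N -> (j <= r)%N -> res j \in krylov S v k.
Proof.
move=> jk jr; apply: (subvP (krylov_mono S v jk)); apply: memvB.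
  by have := krylov_power S v (@ord0 j); rewrite expr0 mul1mx.
exact/krylov_mulmx/bK.
Qed.

Let res_orth j u : (j <= r)%N -> u \in krylov S v j -> dot u (res j) = 0.
Proof. by move=> jr; apply: pls_residual => //; exact: gU. Qed.

Let dK i k : (i < k)%N -> (i < r)%N -> d i \in krylov S v k.
Proof. by move=> ik ir; apply: memvB; apply: bK => //; exact: ltnW. Qed.

Let Sd i : S *m d i = res i - res i.+1.
Proof. by rewrite /d mulmxBr /res opprB [RHS]addrC addrA subrK. Qed.

(** Inner products of an increment with the residuals: zero with the later
    ones by the normal equations, and with all the earlier ones the energy of
    the increment in the form S. *)
Let d_res_lt i k : (i < k <= r)%N -> dot (d i) (res k) = 0.
Proof.
by move=> /andP[ik kr]; apply: res_orth => //; apply: dK => //; exact: leq_trans kr.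
Qed.

Let d_res_ge i k : (k <= i < r)%N -> dot (d i) (res k) = E i.
Proof.
move=> /andP[ki ir]; have ir' := ltnW ir; have kr := leq_trans ki ir'.
have -> : res k = res i + S *m (b i - b k).
  by rewrite /res mulmxBr addrA subrK.
rewrite dotDr (dot_sym _ _ sS) Sd.
have bb : b i - b k \in krylov S v i by apply: memvB; apply: bK.
have bb1 := subvP (krylov_mono S v (leqnSn i)) _ bb.
rewrite [X in _ + X]dotBl !(dotC _ (b i - b k)) (res_orth ir' bb).
rewrite (res_orth ir bb1) subrr addr0.
by rewrite /E Sd dotBr (@d_res_lt i i.+1) ?ltnSn// subr0.
Qed.

Let E_ge0 i : 0 <= E i. Proof. by case: pS => _; apply. Qed.

(** A vanishing residual would be a linear relation between Krylov vectors
    with coefficient 1 on the first one. *)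
Let res_neq0 k : (k < r)%N -> res k != 0.
Proof.
move=> kr; apply/eqP => rk0.
have /krylovP[c bc] := bK (leqnn k) (ltnW kr).
pose c' : 'cV[R]_k.+1 := \col_i (if unlift ord0 i is Some l then - c l 0 else 1).
have /(independent_krylov_le kr iK)/colP/(_ ord0) : krylovmx S v k.+1 *m c' = 0.
  rewrite krylovmx_mul big_ord_recl mxE unlift_none scale1r expr0 mul1mx -[RHS]rk0.
  rewrite /res bc krylovmx_mul mulmx_sumr -sumrN; congr (_ + _).
  apply: eq_bigr => l _; rewrite mxE liftK scaleNr -scalemxAr; congr (- (_ *: _)).
  by rewrite mulmxA mulmxE -exprS.
by rewrite !mxE unlift_none; apply/eqP; rewrite oner_eq0.
Qed.

Let res_res k l : (k < r)%N -> (l < r)%N -> k != l -> dot (res k) (res l) = 0.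
Proof.
move=> kr lr; rewrite neq_ltn => /orP[kl|lk].
  by apply: res_orth; [exact: ltnW|apply: resK => //; exact: ltnW].
by rewrite dotC; apply: res_orth; [exact: ltnW|apply: resK => //; exact: ltnW].
Qed.

(** The residuals are nonzero, pairwise orthogonal and as many as the
    dimension, so they span the Krylov space. *)
Let res_total j u : (j < r)%N -> u \in krylov S v j.+1 ->
  (forall k, (k <= j)%N -> dot (res k) u = 0) -> u = 0.
Proof.
move=> jr /krylovP[c ->] h; set K := krylovmx S v j.+1 in h *.
have resC (k : 'I_j.+1) : {c | res k = K *m c}.
  apply: cid; apply/krylovP; apply: resK => //.
  by rewrite (leq_trans _ (ltnW jr))// -ltnS.
pose Rm : 'M[R]_(p, j.+1) := \matrix_(i, k) res k i 0.
pose C : 'M[R]_j.+1 := \matrix_(i, k) (sval (resC k)) i 0.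
have RmE : Rm = K *m C.
  apply/matrixP => i k; rewrite mxE (svalP (resC k)) !mxE; apply: eq_bigr => l _.
  by rewrite [C _ _]mxE.
have RR : Rm^T *m Rm = diag_mx (\row_k dot (res k) (res k)).
  apply/matrixP => k l; rewrite !mxE.
  transitivity (dot (res k) (res l)).
    by rewrite dotE; apply: eq_bigr => i _; rewrite !mxE.
  have kr : (k < r)%N by exact: leq_trans jr.
  have lr : (l < r)%N by exact: leq_trans jr.
  have [->|kl] := eqVneq k l; first by rewrite mulr1n.
  by rewrite mulr0n res_res.
have uRR : Rm^T *m Rm \in unitmx.
  rewrite RR unitmxE det_diag unitfE; apply/prodf_neq0 => k _; rewrite mxE.
  rewrite -norm2_sqr expf_neq0// gt_eqF// norm2_gt0// res_neq0//.
  exact: leq_trans jr.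
have uC : C \in unitmx by move: uRR; rewrite {2}RmE mulmxA unitmx_mul => /andP[].
have KE : K *m c = Rm *m (invmx C *m c) by rewrite RmE mulmxA mulmxK.
rewrite KE; suff -> : invmx C *m c = 0 by rewrite mulmx0.
rewrite -[LHS](mulKmx uRR) -!mulmxA -KE.
suff -> : Rm^T *m (K *m c) = 0 by rewrite mulmx0.
apply/colP => k; rewrite [RHS]mxE; transitivity (dot (res k) (K *m c)).
  by rewrite mxE dotE; apply: eq_bigr => i _; rewrite 2![in LHS]mxE.
by apply: h; rewrite -ltnS.
Qed.

Let d_expand j : (j < r)%N -> 
  d j = \sum_(k < j.+1) (E j / dot (res k) (res k)) *: res k.
Proof.
move=> jr; apply/eqP; rewrite -subr_eq0; apply/eqP; apply: (res_total jr).
  apply: memvB; first exact: dK.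
  apply: rpred_sum => k _; apply: rpredZ; apply: resK => //.
  by rewrite (leq_trans _ (ltnW jr))// -ltnS.
move=> k kj; rewrite dotBr dotC d_res_ge ?kj//.
rewrite dot_sumr (bigD1 (Ordinal (n := j.+1) (m := k) kj))//= big1 ?addr0; last first.
  move=> l lk; rewrite dotZr [X in _ * X]res_res ?mulr0//.
  - exact: leq_ltn_trans jr.
  - exact: leq_trans jr.
  - by rewrite eq_sym.
rewrite dotZr -mulrA mulVf ?mulr1 ?subrr//.
rewrite -norm2_sqr expf_neq0// gt_eqF// norm2_gt0// res_neq0//.
exact: leq_ltn_trans jr.
Qed.

Let dd_ge0 i j : (i < j < r)%N -> 0 <= dot (d i) (d j).
Proof.
move=> /andP[ij jr]; have ir := ltn_trans ij jr.
rewrite (d_expand jr) dot_sumr sumr_ge0// => k _.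
rewrite dotZr mulr_ge0//; first by rewrite divr_ge0 ?E_ge0 ?dot_ge0.
have [ki|ik] := leqP k i; first by rewrite d_res_ge ?ki.
by rewrite d_res_lt// ik (leq_trans _ jr)// ltnW.
Qed.

(** The increments of the PLS solutions have nonnegative pairwise inner
    products: each is a nonnegative combination of the residuals, and its
    inner product with a residual is either 0 or its own energy.  Hence the
    error at step s makes an angle of at most 90 degrees with the solution. *)
Lemma pls_shrinkage s : (s <= r)%N -> norm2 (pls S v s - a) <= norm2 a.
Proof.
move=> sr; rewrite -/(b s).
have b0 : b 0 = 0.
  have /krylovP[c ->] := bK (leqnn 0) (leq0n r).
  by rewrite krylovmx_mul big_ord0.
have br : b r = a.
  by apply: pls_uniq => //; [exact: gU|move=> u _; rewrite -vE subrr dot0r].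
have bs : b s = \sum_(0 <= i < s) d i by rewrite telescope_sumr// b0 subr0.
have abs : a - b s = \sum_(s <= j < r) d j by rewrite telescope_sumr// br.
have h : 0 <= dot (b s) (a - b s).
  rewrite abs bs dot_suml big_seq sumr_ge0// => i; rewrite mem_index_iota => is_.
  rewrite dot_sumr big_seq sumr_ge0// => j; rewrite mem_index_iota => /andP[sj jr].
  by apply: dd_ge0; rewrite jr (leq_trans _ sj).
rewrite norm2_leP ?norm2_ge0// norm2_sqr.
have := dot_ge0 (b s); move: h.
rewrite !(dotBl, dotBr) (dotC a (b s)); lra.
Qed.

Lemma pls_full : pls S v r = a.
Proof.
by apply: pls_uniq => //; [exact: gU|move=> u _; rewrite -vE subrr dot0r].
Qed.

End shrinkage.

(** * Local Lipschitz continuity of the PLS coefficients *)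

Section lipschitz_at.
Context {R : realType} {Z : Type} (g : Z -> R).
Implicit Types (f h : Z -> R) (a b : R).

(** [g z] measures how far [z] is from a base point, where [f] takes the
    value [a].  The constants are existential so that the class is closed under
    all rational operations without computing them. *)
Definition lipschitz_at f a :=
  exists eta L, [/\ 0 < eta, 0 <= L &
    forall z, 0 <= g z <= eta -> `|f z - a| <= L * g z].

Lemma lipschitz_at_cst a : lipschitz_at (fun=> a) a.
Proof. by exists 1, 0; split=> // z _; rewrite subrr normr0 mul0r. Qed.

Lemma lipschitz_atD f h a b : lipschitz_at f a -> lipschitz_at h b ->
  lipschitz_at (fun z => f z + h z) (a + b).
Proof.
move=> [e [L [e0 L0 H]]] [e' [L' [e'0 L'0 H']]]; exists (Num.min e e'), (L + L').
split; rewrite ?lt_min ?e0 ?addr_ge0// => z; rewrite le_min => /and3P[g0 ge ge'].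
have := H z; rewrite g0 ge => /(_ isT); have := H' z; rewrite g0 ge' => /(_ isT).
have := ler_normD (f z - a) (h z - b).
have -> : f z - a + (h z - b) = f z + h z - (a + b) by ring.
by lra.
Qed.

Lemma lipschitz_atM f h a b : lipschitz_at f a -> lipschitz_at h b ->
  lipschitz_at (fun z => f z * h z) (a * b).
Proof.
move=> [e [L [e0 L0 H]]] [e' [L' [e'0 L'0 H']]].
exists (Num.min e e'), ((`|a| + L * e) * L' + `|b| * L); split.
- by rewrite lt_min e0.
- by rewrite addr_ge0 ?mulr_ge0 ?addr_ge0 ?mulr_ge0// ltW.
move=> z; rewrite le_min => /and3P[g0 ge ge'].
have := H z; rewrite g0 ge => /(_ isT) Hz.
have := H' z; rewrite g0 ge' => /(_ isT) Hz'.
have -> : f z * h z - a * b = f z * (h z - b) + b * (f z - a) by ring.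
rewrite (le_trans (ler_normD _ _))// !normrM mulrDl lerD//; last first.
  by rewrite -mulrA ler_wpM2l.
rewrite -mulrA; apply: ler_pM => //.
have := ler_normD (f z - a) a; rewrite subrK => /le_trans; apply.
by rewrite addrC lerD2l (le_trans Hz)// ler_wpM2l.
Qed.

Lemma lipschitz_at_sum (I : Type) (r : seq I) (P : pred I) (F : I -> Z -> R) (A : I -> R) :
  (forall i, P i -> lipschitz_at (F i) (A i)) ->
  lipschitz_at (fun z => \sum_(i <- r | P i) F i z) (\sum_(i <- r | P i) A i).
Proof.
move=> H; elim: r => [|i r IH].
  rewrite big_nil (_ : (fun _ => _) = fun=> 0); first exact: lipschitz_at_cst.
  by apply/funext => z; rewrite big_nil.
rewrite big_cons (_ : (fun z => \sum_(_ <- _ :: _ | _) _) = fun z => if P i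
    then F i z + \sum_(i <- r | P i) F i z else \sum_(i <- r | P i) F i z); last first.
  by apply/funext => z; rewrite big_cons.
by case: ifP => // Pi; apply: lipschitz_atD => //; exact: H.
Qed.

Lemma lipschitz_at_prod (I : Type) (r : seq I) (F : I -> Z -> R) (A : I -> R) :
  (forall i, lipschitz_at (F i) (A i)) ->
  lipschitz_at (fun z => \prod_(i <- r) F i z) (\prod_(i <- r) A i).
Proof.
move=> H; elim: r => [|i r IH].
  rewrite big_nil (_ : (fun _ => _) = fun=> 1); first exact: lipschitz_at_cst.
  by apply/funext => z; rewrite big_nil.
rewrite big_cons (_ : (fun z => \prod_(_ <- _ :: _) _) =
  fun z => F i z * \prod_(i <- r) F i z); first exact: lipschitz_atM.
by apply/funext => z; rewrite big_cons.
Qed.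

Lemma lipschitz_at_half f a : a != 0 -> lipschitz_at f a ->
  exists2 eta, 0 < eta & forall z, 0 <= g z <= eta -> `|a| / 2 <= `|f z|.
Proof.
move=> a0 [e [L [e0 L0 H]]]; have na : 0 < `|a| by rewrite normr_gt0.
exists (Num.min e (`|a| / 2 / (L + 1))).
  by rewrite lt_min e0 !divr_gt0// ltr_wpDl.
move=> z; rewrite le_min => /and3P[g0 ge]; rewrite ler_pdivlMr ?ltr_wpDl// => gL.
have := H z; rewrite g0 ge => /(_ isT); rewrite distrC => Hz.
have := ler_normD (a - f z) (f z); rewrite subrK => h.
by nra.
Qed.

Lemma lipschitz_atV f a : a != 0 -> lipschitz_at f a ->
  lipschitz_at (fun z => (f z)^-1) a^-1.
Proof.
move=> a0 Hf; have [e1 e10 H1] := lipschitz_at_half a0 Hf.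
have [e [L [e0 L0 H]]] := Hf; have na : 0 < `|a| by rewrite normr_gt0.
exists (Num.min e e1), (L * (2 / `|a| ^+ 2)); split.
- by rewrite lt_min e0.
- by rewrite mulr_ge0// divr_ge0// exprn_ge0.
move=> z; rewrite le_min => /and3P[g0 ge ge1].
have := H z; rewrite g0 ge => /(_ isT) Hz.
have := H1 z; rewrite g0 ge1 => /(_ isT) H1z.
have fz : 0 < `|f z| by apply: lt_le_trans H1z; rewrite divr_gt0.
have fz0 : f z != 0 by rewrite -normr_gt0.
have -> : (f z)^-1 - a^-1 = - (f z - a) * (f z * a)^-1 by field; rewrite fz0 a0.
rewrite normrM normrN mulrAC ler_pM// normfV normrM -div1r.
rewrite ler_pdivrMr ?mulr_gt0//.
have -> : 2 / `|a| ^+ 2 * (`|f z| * `|a|) = 2 * `|f z| / `|a|.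
  by field; rewrite gt_eqF.
by rewrite ler_pdivlMr//; lra.
Qed.

Definition lipschitz_mx_at m n (F : Z -> 'M[R]_(m, n)) (A : 'M[R]_(m, n)) :=
  forall i j, lipschitz_at (fun z => F z i j) (A i j).

Lemma lipschitz_mx_at_cst m n (A : 'M[R]_(m, n)) : lipschitz_mx_at (fun=> A) A.
Proof. by move=> i j; exact: lipschitz_at_cst. Qed.

Lemma lipschitz_mx_at_mul m n k (F : Z -> 'M[R]_(m, n)) (H : Z -> 'M[R]_(n, k)) A B :
  lipschitz_mx_at F A -> lipschitz_mx_at H B ->
  lipschitz_mx_at (fun z => F z *m H z) (A *m B).
Proof.
move=> HF HH i j; rewrite mxE.
rewrite (_ : (fun _ => _) = fun z => \sum_k F z i k * H z k j); last first.
  by apply/funext => z; rewrite mxE.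
by apply: lipschitz_at_sum => l _; exact: lipschitz_atM.
Qed.

Lemma lipschitz_mx_at_tr m n (F : Z -> 'M[R]_(m, n)) A :
  lipschitz_mx_at F A -> lipschitz_mx_at (fun z => (F z)^T) A^T.
Proof.
move=> HF i j; rewrite mxE (_ : (fun _ => _) = fun z => F z j i)//.
by apply/funext => z; rewrite mxE.
Qed.

Lemma lipschitz_mx_at_exp n (F : Z -> 'M[R]_n) A k :
  lipschitz_mx_at F A -> lipschitz_mx_at (fun z => F z ^+ k) (A ^+ k).
Proof.
move=> HF; elim: k => [|k IH]; first exact: lipschitz_mx_at_cst.
rewrite exprS (_ : (fun _ => _) = fun z => F z *m F z ^+ k).
  exact: lipschitz_mx_at_mul.
by apply/funext => z; rewrite exprS.
Qed.

Lemma lipschitz_at_det n (F : Z -> 'M[R]_n) A :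
  lipschitz_mx_at F A -> lipschitz_at (fun z => \det (F z)) (\det A).
Proof.
move=> HF; apply: lipschitz_at_sum => s _; apply: lipschitz_atM.
  exact: lipschitz_at_cst.
by apply: lipschitz_at_prod => i; exact: HF.
Qed.

(** By Cramer's rule. *)
Lemma lipschitz_mx_at_inv n (F : Z -> 'M[R]_n) A : A \in unitmx ->
  (forall z, F z \in unitmx) ->
  lipschitz_mx_at F A -> lipschitz_mx_at (fun z => invmx (F z)) (invmx A).
Proof.
move=> uA uF HF i j; rewrite /invmx uA.
rewrite (_ : (fun _ => _) = fun z => (\det (F z))^-1 *
    ((-1) ^+ (j + i) * \det (row' j (col' i (F z))))); last first.
  by apply/funext => z; rewrite uF 2!mxE.
rewrite 2!mxE; apply: lipschitz_atM.
  apply: lipschitz_atV; last exact: lipschitz_at_det.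
  by move: uA; rewrite unitmxE unitfE.
apply: lipschitz_atM; first exact: lipschitz_at_cst.
apply: lipschitz_at_det => k l; rewrite !mxE.
by rewrite (_ : (fun _ => _) = fun z => F z (lift j k) (lift i l))//;
  apply/funext => z; rewrite !mxE.
Qed.

Lemma lipschitz_mx_at_norm2 n (F : Z -> 'cV[R]_n) A : lipschitz_mx_at F A ->
  exists eta L, [/\ 0 < eta, 0 <= L &
    forall z, 0 <= g z <= eta -> norm2 (F z - A) <= L * g z].
Proof.
move=> HF.
have [eta [L [e0 L0 H]]] : lipschitz_at (fun z => \sum_i `|F z i 0 - A i 0|) 0.
  rewrite [X in lipschitz_at _ X](_ : 0 = \sum_(i < n) 0); last by rewrite big1.
  apply: lipschitz_at_sum => i _.
  have [eta [L [e0 L0 H]]] := HF i 0; exists eta, L; split=> // z zg.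
  by rewrite subr0 normr_id; exact: H.
exists eta, L; split=> // z /H; rewrite subr0 ger0_norm ?sumr_ge0//.
apply: le_trans; rewrite (le_trans (norm2_le_sum _))//.
by apply: ler_sum => i _; rewrite !mxE.
Qed.

End lipschitz_at.

Section pls_lipschitz.
Context {R : realType} {p : nat}.
Implicit Types (S : 'M[R]_p) (v : 'cV[R]_p).

Definition moment_dist S v S' v' : R :=
  \sum_i \sum_j `|S' i j - S i j| + \sum_i `|v' i 0 - v i 0|.

Lemma moment_dist_ge0 S v S' v' : 0 <= moment_dist S v S' v'.
Proof. by rewrite addr_ge0 ?sumr_ge0// => i _; rewrite sumr_ge0. Qed.

Lemma moment_dist_entry_mx S v S' v' i j : `|S' i j - S i j| <= moment_dist S v S' v'.
Proof.
rewrite /moment_dist (bigD1 i)//= (bigD1 j)//= -!addrA lerDl.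
by rewrite !addr_ge0 ?sumr_ge0// => k _; rewrite sumr_ge0.
Qed.

Lemma moment_dist_entry S v S' v' i : `|v' i 0 - v i 0| <= moment_dist S v S' v'.
Proof.
rewrite /moment_dist [leRHS]addrC (bigD1 i)//= -!addrA lerDl.
by rewrite !addr_ge0 ?sumr_ge0// => k _; rewrite sumr_ge0.
Qed.

Section at_point.
Variables (S : 'M[R]_p) (v : 'cV[R]_p) (s : nat).
Hypothesis uG : gram S v s \in unitmx.

Let krylovmx_lip (Z : Type) (f : Z -> 'M[R]_p * 'cV[R]_p) (g : Z -> R) :
  lipschitz_mx_at g (fst \o f) S -> lipschitz_mx_at g (snd \o f) v ->
  lipschitz_mx_at g (fun z => krylovmx (f z).1 (f z).2 s) (krylovmx S v s).
Proof.
move=> l1 l2 i k; rewrite mxE.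
rewrite (_ : (fun _ => _) = fun z => ((f z).1 ^+ k *m (f z).2) i 0); last first.
  by apply/funext => z; rewrite mxE.
by apply: lipschitz_mx_at_mul => //; exact: lipschitz_mx_at_exp.
Qed.

Let gram_lip (Z : Type) (f : Z -> 'M[R]_p * 'cV[R]_p) (g : Z -> R) :
  lipschitz_mx_at g (fst \o f) S -> lipschitz_mx_at g (snd \o f) v ->
  lipschitz_mx_at g (fun z => gram (f z).1 (f z).2 s) (gram S v s).
Proof.
move=> l1 l2; have lK := krylovmx_lip l1 l2.
by apply: lipschitz_mx_at_mul => //; apply: lipschitz_mx_at_mul => //; exact: lipschitz_mx_at_tr.
Qed.

Let D z := moment_dist S v z.1 z.2.

Let base_lip (Z : Type) (f : Z -> 'M[R]_p * 'cV[R]_p) :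
  lipschitz_mx_at (D \o f) (fst \o f) S /\ lipschitz_mx_at (D \o f) (snd \o f) v.
Proof.
split=> i j; exists 1, 1; split=> // z _; rewrite mul1r /=.
  exact: moment_dist_entry_mx.
by rewrite !ord1; exact: moment_dist_entry.
Qed.

(** Invertibility of the Gram matrix persists near the base point, and there
    the closed form of the coefficients is a rational function. *)
Lemma pls_lipschitz : exists eta L, [/\ 0 < eta, 0 <= L &
  forall S' v', psd S' -> moment_dist S v S' v' <= eta ->
    gram S' v' s \in unitmx /\
    norm2 (pls S' v' s - pls_closed S v s) <= L * moment_dist S v S' v'].
Proof.
have dG : \det (gram S v s) != 0 by move: uG; rewrite unitmxE unitfE.
have [lS lv] := @base_lip ('M[R]_p * 'cV[R]_p)%type id.
have [eta1 eta10 H1] :=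
  lipschitz_at_half dG (lipschitz_at_det (@gram_lip _ id _ lS lv)).
pose Z := {z : 'M[R]_p * 'cV[R]_p | gram z.1 z.2 s \in unitmx}.
pose f (z : Z) := sval z.
have [lS' lv'] := base_lip f.
have lK := krylovmx_lip lS' lv'.
have lG := lipschitz_mx_at_inv uG (fun z => svalP z) (gram_lip lS' lv').
have [eta [L [eta0 L0 H]]] := lipschitz_mx_at_norm2
  (lipschitz_mx_at_mul lK (lipschitz_mx_at_mul lG (lipschitz_mx_at_mul (lipschitz_mx_at_tr lK) lv'))).
exists (Num.min eta1 eta), L; split=> //; first by rewrite lt_min eta10.
move=> S' v' pS'; rewrite le_min => /andP[le1 le2].
have uG' : gram S' v' s \in unitmx.
  rewrite unitmxE unitfE -normr_gt0; apply: lt_le_trans (H1 (S', v') _).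
    by rewrite divr_gt0// normr_gt0.
  by rewrite le1 andbT moment_dist_ge0.
split=> //; rewrite pls_closedE//.
apply: (H (exist _ (S', v') uG')).
by rewrite le2 andbT moment_dist_ge0.
Qed.

End at_point.

End pls_lipschitz.

(** * Rademacher sums of rank-one matrices *)

Section moments_of_symmetric.
Context {R : realType} {p : nat}.
Implicit Types (W Y : 'M[R]_p) (x : 'cV[R]_p).

Lemma symX W k : W^T = W -> (W ^+ k)^T = W ^+ k.
Proof.
move=> sW; elim: k => [|k IH]; first by rewrite expr0 trmx1.
by rewrite [in LHS]exprS -mulmxE trmx_mul sW IH mulmxE -exprSr.
Qed.

Lemma dot_expr0 W x y : dot x (W ^+ 0 *m y) = dot x y.
Proof. by rewrite expr0 mul1mx. Qed.

(** Both orderings of the exponents are compared with the pure powers: the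
    difference factors as the product of two differences of the same sign. *)
Lemma mixed_power_le (a b : R) q r :
  ~~ odd (q + r) -> a ^+ q * b ^+ r + a ^+ r * b ^+ q <= a ^+ (q + r) + b ^+ (q + r).
Proof.
move=> qr; have ev c : c ^+ (q + r) = `|c| ^+ (q + r) :> R.
  by rewrite -normrX ger0_norm// exprn_even_ge0.
rewrite (ev a) (ev b); apply: (@le_trans _ _ (`|a| ^+ q * `|b| ^+ r + `|a| ^+ r * `|b| ^+ q)).
  by rewrite -!normrX -!normrM lerD// ler_norm.
set s := `|a|; set t := `|b|; rewrite -subr_ge0.
have -> : s ^+ (q + r) + t ^+ (q + r) - (s ^+ q * t ^+ r + s ^+ r * t ^+ q) =
    (s ^+ q - t ^+ q) * (s ^+ r - t ^+ r) by rewrite !exprD; ring.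
have s0 : 0 <= s by rewrite normr_ge0.
have t0 : 0 <= t by rewrite normr_ge0.
have [st|/ltW ts] := leP s t.
  by rewrite mulr_le0// subr_le0 lerXn2r.
by rewrite mulr_ge0// subr_ge0 lerXn2r.
Qed.

(** Integrate [mixed_power_le] against the product of the spectral
    measures of both matrices at the vector x. *)
Lemma mixed_moment_le W Y x q r : W^T = W -> Y^T = Y -> ~~ odd (q + r) ->
  dot x (W ^+ q *m x) * dot x (Y ^+ r *m x) + dot x (W ^+ r *m x) * dot x (Y ^+ q *m x)
  <= dot x x * (dot x (W ^+ (q + r) *m x) + dot x (Y ^+ (q + r) *m x)).
Proof.
move=> sW sY qr.
have [l [a [a0 aE _ _]]] := symmetric_spectral_measure sW.
have [m [b [b0 bE _ _]]] := symmetric_spectral_measure sY.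
have xa : dot x x = \sum_i a x i.
  rewrite -(dot_expr0 W) aE.
  by apply: eq_bigr => i _; rewrite expr0 mul1r.
have xb : dot x x = \sum_i b x i.
  rewrite -(dot_expr0 Y) bE.
  by apply: eq_bigr => i _; rewrite expr0 mul1r.
rewrite mulrDr {1}xb xa !aE !bE.
have e (F G : 'I_p -> R) : (\sum_i F i) * (\sum_j G j) = \sum_i \sum_j F i * G j.
  by rewrite mulr_suml; apply: eq_bigr => i _; rewrite mulr_sumr.
rewrite [X in _ <= X + _]mulrC !e -!big_split/=; apply: ler_sum => i _.
rewrite -!big_split/=; apply: ler_sum => j _.
have ab := mulr_ge0 (a0 x i) (b0 x j).
have -> : l i ^+ q * a x i * (m j ^+ r * b x j) + l i ^+ r * a x i * (m j ^+ q * b x j) =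
  (a x i * b x j) * (l i ^+ q * m j ^+ r + l i ^+ r * m j ^+ q) by ring.
have -> : l i ^+ (q + r) * a x i * b x j + a x i * (m j ^+ (q + r) * b x j) =
  (a x i * b x j) * (l i ^+ (q + r) + m j ^+ (q + r)) by ring.
by rewrite ler_wpM2l// mixed_power_le.
Qed.

Lemma sum_mixed_moment_le W Y x k : W^T = W -> Y^T = Y ->
  2 * \sum_(q < k.*2.+1) dot x (W ^+ q *m x) * dot x (Y ^+ (k.*2 - q) *m x) <=
  k.*2.+1%:R * (dot x x * (dot x (W ^+ k.*2 *m x) + dot x (Y ^+ k.*2 *m x))).
Proof.
move=> sW sY; rewrite mulr_natl mulr2n.
rewrite {2}(reindex_inj rev_ord_inj)/= -big_split/=.
rewrite -[k.*2.+1 in X in _ <= X]card_ord -sum1_card natr_sum mulr_suml.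
apply: ler_sum => q _; rewrite mul1r.
have qk : (q <= k.*2)%N by rewrite -ltnS.
rewrite subSS subKn//; have := @mixed_moment_le W Y x q (k.*2 - q) sW sY.
by rewrite subnKC// odd_double => /(_ isT).
Qed.

(** The factorization of a difference of powers, for matrices that need not
    commute. *)
Lemma subrXX_telescope W Y N :
  W ^+ N - Y ^+ N = \sum_(q < N) W ^+ q *m (W - Y) *m Y ^+ (N.-1 - q).
Proof.
elim: N => [|N IH]; first by rewrite big_ord0 !expr0 subrr.
rewrite big_ord_recr/= subnn expr0 mulmx1.
have -> : \sum_(i < N) W ^+ i *m (W - Y) *m Y ^+ (N - i) = (W ^+ N - Y ^+ N) *m Y.
  rewrite IH mulmx_suml; apply: eq_bigr => i _; rewrite -[RHS]mulmxA; congr (_ *m _).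
  by rewrite mulmxE -exprSr; congr (_ ^+ _); case: N i {IH} => [[]//|N i]; rewrite -subSn// -ltnS.
by rewrite mulmxBl mulmxBr !mulmxE -!exprSr addrC addrA subrK.
Qed.

Lemma dot_mul_outer (u v x : 'cV[R]_p) W Y :
  dot u (W *m (x *m x^T) *m Y *m v) = dot u (W *m x) * dot x (Y *m v).
Proof.
rewrite -!mulmxA [x^T *m _]mx11_scalar mul_mx_scalar.
by rewrite -scalemxAr dotZr mulrC.
Qed.

Lemma trace_outer (x : 'cV[R]_p) W : \tr (x *m x^T *m W) = dot x (W *m x).
Proof. by rewrite -mulmxA mxtrace_mulC -mulmxA /dot trace_mx11. Qed.

Lemma sum_norm_power_col W k : W^T = W ->
  \sum_j dot (W ^+ k *m delta_mx j 0) (W ^+ k *m delta_mx j 0) = \tr (W ^+ k.*2).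
Proof.
move=> sW; apply: eq_bigr => j _.
rewrite -(dot_sym _ _ (symX k sW)) mulmxA mulmxE -exprD addnn.
by rewrite dot_delta -colE mxE.
Qed.

(** The norm of a symmetric matrix is attained on its spectrum, whose even
    powers sum to the trace. *)
Lemma opnorm_le_trace W k : W^T = W -> (0 < k)%N ->
  opnorm W ^+ k.*2 <= \tr (W ^+ k.*2).
Proof.
move=> sW k0.
have [l [a [a0 aE trE _]]] := symmetric_spectral_measure sW.
have ev (c : R) : 0 <= c ^+ k.*2 by rewrite exprn_even_ge0// odd_double.
have tr0 : 0 <= \tr (W ^+ k.*2) by rewrite trE sumr_ge0.
have evn c : c ^+ k.*2 = `|c| ^+ k.*2 :> R.
  by rewrite -normrX ger0_norm.
have li i : l i ^+ k.*2 <= \tr (W ^+ k.*2).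
  by rewrite trE (bigD1 i)//= lerDl sumr_ge0.
pose c := \big[Num.max/0]_i `|l i|.
have c0 : 0 <= c by rewrite /c; elim/big_rec: _ => // i y _ y0; rewrite le_max y0 orbT.
have lc i : `|l i| <= c by rewrite /c; exact: le_bigmax.
have opc : opnorm W <= c.
  apply: opnorm_le => // u; rewrite norm2_leP ?mulr_ge0 ?norm2_ge0//.
  rewrite -(dot_sym _ _ sW) mulmxA mulmxE -expr2 aE exprMn norm2_sqr.
  rewrite -(dot_expr0 W) aE mulr_sumr; apply: ler_sum => i _.
  by rewrite expr0 mul1r ler_wpM2r// -[X in X <= _]real_normK ?num_real// lerXn2r.
apply: (@le_trans _ _ (c ^+ k.*2)); first by rewrite lerXn2r// nnegrE opnorm_ge0.
rewrite /c; elim/big_ind: _ => //.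
- by rewrite expr0n double_eq0 eqn0Ngt k0.
- by move=> s t hs ht; rewrite /Num.max; case: ifP.
- by move=> i _; rewrite -evn.
Qed.

End moments_of_symmetric.

Section rademacher.
Context {R : realType} {p n : nat}.
Variable x : 'I_n -> 'cV[R]_p.

Definition rsign (e : {ffun 'I_n -> bool}) i : R := (-1) ^+ e i.

Definition flip (i : 'I_n) (e : {ffun 'I_n -> bool}) : {ffun 'I_n -> bool} :=
  [ffun j => (j == i) (+) e j].

Lemma card_signs : #|{ffun 'I_n -> bool}| = (2 ^ n)%N.
Proof. by rewrite card_ffun card_bool card_ord. Qed.

Lemma flipK i : involutive (flip i).
Proof. by move=> e; apply/ffunP => j; rewrite !ffunE addbA addbb. Qed.

Lemma rsign_flip i e : rsign (flip i e) i = - rsign e i.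
Proof. by rewrite /rsign ffunE eqxx /=; case: (e i); rewrite ?expr0 ?expr1 ?opprK. Qed.

Lemma rsign_flip_neq i j e : j != i -> rsign (flip i e) j = rsign e j.
Proof. by move=> ji; rewrite /rsign ffunE (negbTE ji). Qed.

Lemma rsign_sq e i : rsign e i * rsign e i = 1.
Proof. by rewrite /rsign -expr2 sqrr_sign. Qed.

Definition rsum e : 'M[R]_p := \sum_i rsign e i *: (x i *m (x i)^T).

Lemma rsum_sym e : (rsum e)^T = rsum e.
Proof.
rewrite /rsum linear_sum; apply: eq_bigr => i _ /=.
by rewrite linearZ/= trmx_mul trmxK.
Qed.

Lemma rsum_flip i e :
  rsum e - rsum (flip i e) = (2 * rsign e i) *: (x i *m (x i)^T).
Proof.
rewrite /rsum (bigD1 i)//= [X in _ - X](bigD1 i)//= rsign_flip.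
rewrite [X in _ - (_ + X)](eq_bigr (fun j => rsign e j *: (x j *m (x j)^T))); last first.
  by move=> j ji; rewrite rsign_flip_neq.
by rewrite opprD addrACA subrr addr0 scaleNr opprK -scalerDl -mulr2n mulr_natl.
Qed.

(** Exchanging a sign and its opposite turns the linear term into the
    increment of a power, which telescopes into mixed moments. *)
Lemma rademacher_step k :
  \sum_e \tr (rsum e ^+ k.+1.*2) <=
  k.*2.+1%:R * \sum_e \sum_i dot (x i) (x i) * dot (x i) (rsum e ^+ k.*2 *m x i).
Proof.
have -> : \sum_e \tr (rsum e ^+ k.+1.*2) =
    \sum_i \sum_e rsign e i * dot (x i) (rsum e ^+ k.*2.+1 *m x i).
  rewrite [RHS]exchange_big; apply: eq_bigr => e _ /=.
  rewrite doubleS exprS -mulmxE {1}/rsum mulmx_suml linear_sum; apply: eq_bigr => i _ /=.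
  by rewrite -scalemxAl linearZ/= trace_outer.
rewrite [X in _ <= _ * X]exchange_big /= mulr_sumr; apply: ler_sum => i _.
set f := fun e => rsign e i * dot (x i) (rsum e ^+ k.*2.+1 *m x i).
set w := fun e => dot (x i) (rsum e ^+ k.*2 *m x i).
have f2 : \sum_e f e = 2^-1 * \sum_e (f e + f (flip i e)).
  rewrite big_split/= [X in _ + X](_ : _ = \sum_e f e); last first.
    by rewrite [RHS](reindex_inj (inv_inj (flipK i))).
  lra.
have w2 : \sum_e dot (x i) (x i) * w e =
    2^-1 * \sum_e dot (x i) (x i) * (w e + w (flip i e)).
  under [X in _ = _ * X]eq_bigr do rewrite mulrDr.
  rewrite big_split/= [X in _ + X](_ : _ = \sum_e dot (x i) (x i) * w e); last first.
    by rewrite [RHS](reindex_inj (inv_inj (flipK i))).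
  lra.
rewrite f2 w2 mulrCA ler_wpM2l ?invr_ge0// mulr_sumr; apply: ler_sum => e _.
apply: le_trans (sum_mixed_moment_le (x i) k (rsum_sym e) (rsum_sym (flip i e))).
rewrite /f rsign_flip mulNr -mulrBr -dotBr -mulmxBl subrXX_telescope.
rewrite mulmx_suml dot_sumr mulr_sumr mulr_sumr; apply: ler_sum => q _.
rewrite rsum_flip -scalemxAr -!scalemxAl dotZr.
rewrite dot_mul_outer.
rewrite le_eqVlt; apply/orP; left; apply/eqP.
by rewrite -[RHS]mul1r -(rsign_sq e i) /=; ring.
Qed.

Variable v : R.
Hypothesis v0 : 0 <= v.
Hypothesis xv : forall u, \sum_i dot (x i) (x i) * dot (x i) u ^+ 2 <= v * dot u u.

(** The hypothesis bounds the sum of the squares of the rank-one terms by v;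
    it is applied to the columns of a power of the Rademacher sum. *)
Lemma rademacher_step_le k :
  \sum_e \tr (rsum e ^+ k.+1.*2) <= k.*2.+1%:R * v * \sum_e \tr (rsum e ^+ k.*2).
Proof.
apply: le_trans (rademacher_step k) _; rewrite -mulrA ler_wpM2l// mulr_sumr.
apply: ler_sum => e _; have sX := rsum_sym e; have sXk := symX k sX.
rewrite -sum_norm_power_col// mulr_sumr.
have -> : \sum_i dot (x i) (x i) * dot (x i) (rsum e ^+ k.*2 *m x i) =
    \sum_j \sum_i dot (x i) (x i) * dot (x i) (rsum e ^+ k *m delta_mx j 0) ^+ 2.
  rewrite [RHS]exchange_big; apply: eq_bigr => i _ /=; rewrite -mulr_sumr; congr (_ * _).
  rewrite -addnn exprD -mulmxE -mulmxA (dot_sym _ _ sXk) dotE.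
  by apply: eq_bigr => j _; rewrite (dot_sym _ _ sXk) dotC dot_delta expr2.
by apply: ler_sum => j _; exact: xv.
Qed.

Lemma rademacher_moment K k : (k <= K)%N ->
  \sum_e \tr (rsum e ^+ k.+1.*2) <=
  K.*2.+1%:R ^+ k.+1 * v ^+ k * (\sum_i dot (x i) (x i) ^+ 2) * (2 ^ n)%:R.
Proof.
elim: k => [_|k IH kK].
  rewrite expr1 expr0 mulr1; apply: le_trans (rademacher_step 0) _.
  have -> : \sum_e \sum_i dot (x i) (x i) * dot (x i) (rsum e ^+ 0 *m x i) =
      (\sum_i dot (x i) (x i) ^+ 2) * (2 ^ n)%:R.
    rewrite -card_signs mulr_natr -sumr_const; apply: eq_bigr => e _.
    by apply: eq_bigr => i _; rewrite expr0 mul1mx expr2.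
  rewrite mulrA ler_wpM2r ?ler0n// ler_wpM2r ?ler_nat//.
  by rewrite sumr_ge0// => i _; rewrite exprn_ge0 ?dot_ge0.
apply: le_trans (rademacher_step_le k.+1) _.
apply: (@le_trans _ _ (K.*2.+1%:R * v * \sum_e \tr (rsum e ^+ k.+1.*2))).
  apply: ler_wpM2r.
    apply: sumr_ge0 => e _; apply: le_trans (opnorm_le_trace (rsum_sym e) _) => //.
    by rewrite exprn_ge0 ?opnorm_ge0.
  by rewrite ler_wpM2r// ler_nat ltnS leq_double.
apply: (@le_trans _ _ (K.*2.+1%:R * v * (K.*2.+1%:R ^+ k.+1 * v ^+ k *
    (\sum_i dot (x i) (x i) ^+ 2) * (2 ^ n)%:R))).
  by rewrite ler_wpM2l ?mulr_ge0// IH// ltnW.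
rewrite [K.*2.+1%:R ^+ k.+2]exprS [v ^+ k.+1]exprS.
by rewrite le_eqVlt; apply/orP; left; apply/eqP; ring.
Qed.

(** Average of the norm of a Rademacher sum: a moment of order 2m, with m at
    least the logarithm of the effective rank, costs only a factor sqrt m. *)
Lemma rademacher_opnorm m : (0 < m)%N -> \sum_i dot (x i) (x i) ^+ 2 <= 2 ^+ m * v ->
  \sum_e opnorm (rsum e) <= (2 ^ n)%:R * (2 * Num.sqrt (4 * m%:R * v)).
Proof.
case: m => // K _ tv.
have [v00|vn0] := eqVneq v 0.
  rewrite v00 mulr0 sqrtr0 !mulr0 big1// => e _.
  have x0 i : x i = 0.
    apply: dot_eq0; apply/eqP; rewrite -sqrf_eq0; apply/eqP.
    move: tv; rewrite v00 mulr0 => tv.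
    apply/eqP; rewrite eq_le exprn_ge0 ?dot_ge0// andbT (le_trans _ tv)//.
    by rewrite (bigD1 i)//= lerDl sumr_ge0// => j _; rewrite exprn_ge0 ?dot_ge0.
  apply/eqP; rewrite eq_le opnorm_ge0 andbT; apply: opnorm_le => // u.
  rewrite /rsum big1 ?mul0mx ?norm2_0 ?mul0r// => i _.
  by rewrite x0 mul0mx scaler0.
have vp : 0 < v by rewrite lt0r vn0.
pose T := Num.sqrt (4 * K.+1%:R * v).
have T2 : T ^+ 2 = 4 * K.+1%:R * v by rewrite sqr_sqrtr// !mulr_ge0.
have Tp : 0 < T by rewrite sqrtr_gt0 !mulr_gt0.
have TK : 0 < T ^+ (K.*2.+1) by rewrite exprn_gt0.
(* A norm above T is dominated by its power; T balances both terms. *)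
have aT a : 0 <= a -> a <= T + a ^+ K.+1.*2 / T ^+ K.*2.+1.
  move=> a0; have [aT|Ta] := leP a T.
    by rewrite (le_trans aT)// lerDl divr_ge0 ?exprn_ge0// ltW.
  rewrite (@le_trans _ _ (a ^+ K.+1.*2 / T ^+ K.*2.+1))//; last by rewrite lerDr ltW.
  rewrite ler_pdivlMr// doubleS [a ^+ _]exprS ler_wpM2l//.
  by rewrite lerXn2r ?nnegrE// ltW.
rewrite -/T (le_trans (ler_sum _ (fun e _ => aT _ (opnorm_ge0 (rsum e)))))//.
rewrite big_split/= sumr_const card_signs -mulr_natl.
suff : \sum_e opnorm (rsum e) ^+ K.+1.*2 / T ^+ K.*2.+1 <= (2 ^ n)%:R * T by lra.
rewrite -mulr_suml ler_pdivrMr//.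
apply: (@le_trans _ _ (\sum_e \tr (rsum e ^+ K.+1.*2))).
  by apply: ler_sum => e _; apply: opnorm_le_trace => //; exact: rsum_sym.
apply: le_trans (rademacher_moment (leqnn K)) _.
have TT : T * T ^+ K.*2.+1 = (4 * K.+1%:R * v) ^+ K.+1.
  by rewrite -exprS -doubleS -mul2n exprM T2.
rewrite [leLHS]mulrC -[leRHS]mulrA ler_wpM2l ?ler0n// TT.
rewrite (@le_trans _ _ (K.*2.+1%:R ^+ K.+1 * v ^+ K * (2 ^+ K.+1 * v)))//.
  by rewrite ler_wpM2l// mulr_ge0 ?exprn_ge0.
rewrite mulrACA -exprSr -exprMn exprMn [leRHS]exprMn ler_wpM2r ?exprn_ge0//.
rewrite -exprMn lerXn2r ?nnegrE ?mulr_ge0// -!natrM ler_nat.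
by rewrite muln2 -(mulnA 2 2) mul2n leq_double mul2n doubleS.
Qed.

End rademacher.

(** * Expectations of real random variables *)

Section mean_theory.
Context {d : measure_display} {T : measurableType d} {R : realType}.
Variable P : probability T R.
Implicit Types f g : T -> R.

Definition L1 f := P.-integrable setT (EFin \o f).

Lemma meanE f : mean P f = \int[P]_(w in setT) f w.
Proof. by rewrite /mean /Rintegral unlock. Qed.

Lemma expectationE f : 'E_P[f]%E = (\int[P]_w (f w)%:E)%E.
Proof. by rewrite unlock. Qed.

Lemma mean_EFin f : L1 f -> (\int[P]_w (f w)%:E)%E = (mean P f)%:E.
Proof. by move=> Lf; rewrite /mean expectationE fineK//; exact: integrable_fin_num. Qed.

Lemma L1_measurable f : L1 f -> measurable_fun setT f.
Proof. by move=> /integrableP[/measurable_EFinP]. Qed.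

Lemma eq_L1 f g : f =1 g -> L1 f -> L1 g.
Proof. by move=> /funext ->. Qed.

Lemma eq_mean f g : f =1 g -> mean P f = mean P g.
Proof. by move=> /funext ->. Qed.

Lemma L1_cst c : L1 (fun=> c).
Proof. exact: finite_measure_integrable_cst. Qed.

Lemma mean_cst c : mean P (fun=> c) = c.
Proof. by rewrite meanE Rintegral_cst//= probability_setT mulr1. Qed.

Lemma L1D f g : L1 f -> L1 g -> L1 (fun w => f w + g w).
Proof. by move=> Lf Lg; apply: (integrableD _ Lf Lg). Qed.

Lemma meanD f g : L1 f -> L1 g ->
  mean P (fun w => f w + g w) = mean P f + mean P g.
Proof. by move=> Lf Lg; rewrite !meanE RintegralD. Qed.

Lemma L1Zl c f : L1 f -> L1 (fun w => c * f w).
Proof. by move=> Lf; apply: (integrableZl measurableT c Lf). Qed.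

Lemma meanZl c f : L1 f -> mean P (fun w => c * f w) = c * mean P f.
Proof. by move=> Lf; rewrite !meanE RintegralZl. Qed.

Lemma L1B f g : L1 f -> L1 g -> L1 (fun w => f w - g w).
Proof.
move=> Lf /(L1Zl (-1)) Lg; apply: (eq_L1 _ (L1D Lf Lg)) => w.
by rewrite mulN1r.
Qed.

Lemma meanB f g : L1 f -> L1 g ->
  mean P (fun w => f w - g w) = mean P f - mean P g.
Proof. by move=> Lf Lg; rewrite !meanE RintegralB. Qed.

Lemma L1_sum (I : Type) (r : seq I) (F : I -> T -> R) : (forall i, L1 (F i)) ->
  L1 (fun w => \sum_(i <- r) F i w).
Proof.
move=> LF; elim: r => [|i r IH].
  by apply: eq_L1 (L1_cst 0) => w; rewrite big_nil.
by apply: eq_L1 (L1D (LF i) IH) => w; rewrite big_cons.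
Qed.

Lemma mean_sum (I : Type) (r : seq I) (F : I -> T -> R) : (forall i, L1 (F i)) ->
  mean P (fun w => \sum_(i <- r) F i w) = \sum_(i <- r) mean P (F i).
Proof.
move=> LF; elim: r => [|i r IH].
  by rewrite big_nil -[RHS](mean_cst 0); apply: eq_mean => w; rewrite big_nil.
rewrite big_cons -IH -meanD//; last exact: L1_sum.
by apply: eq_mean => w; rewrite big_cons.
Qed.

Lemma le_mean f g : L1 f -> L1 g -> (forall w, f w <= g w) -> mean P f <= mean P g.
Proof. by move=> Lf Lg fg; rewrite !meanE; apply: le_Rintegral. Qed.

Lemma mean_ge0 f : (forall w, 0 <= f w) -> 0 <= mean P f.
Proof. by move=> f0; rewrite meanE Rintegral_ge0. Qed.

Lemma L1_le f g : measurable_fun setT f -> L1 g -> (forall w, `|f w| <= g w) -> L1 f.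
Proof.
move=> mf Lg fg; apply: le_integrable Lg => //; first exact/measurable_EFinP.
by move=> w _ /=; rewrite lee_fin (le_trans (fg w))// ler_norm.
Qed.

Lemma L1_ge0 f : measurable_fun setT f -> (forall w, 0 <= f w) ->
  (\int[P]_w (f w)%:E < +oo)%E -> L1 f.
Proof.
move=> mf f0 foo; apply/integrableP; split; first exact/measurable_EFinP.
by under eq_integral do rewrite /= ger0_norm//.
Qed.

Lemma L1_mul f g : measurable_fun setT f -> measurable_fun setT g ->
  L1 (fun w => f w ^+ 2) -> L1 (fun w => g w ^+ 2) -> L1 (fun w => f w * g w).
Proof.
move=> mf mg Lf Lg; apply: (L1_le _ (L1D Lf Lg)); first exact: measurable_funM.
move=> w; rewrite ler_norml; nra.
Qed.

Lemma L1_norm f : L1 f -> L1 (fun w => `|f w|).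
Proof.
by move=> Lf; exact: integrable_abse Lf.
Qed.

Lemma L1_of_sq f : measurable_fun setT f -> L1 (fun w => f w ^+ 2) -> L1 f.
Proof.
move=> mf Lf; apply: (L1_le mf (L1D (L1_cst 1) Lf)) => w.
rewrite ler_norml; nra.
Qed.

Lemma mean_cauchy_schwarz f g : measurable_fun setT f -> measurable_fun setT g ->
  L1 (fun w => f w ^+ 2) -> L1 (fun w => g w ^+ 2) ->
  mean P (fun w => f w * g w) ^+ 2 <=
  mean P (fun w => f w ^+ 2) * mean P (fun w => g w ^+ 2).
Proof.
move=> mf mg Lf Lg; have Lfg := L1_mul mf mg Lf Lg.
set a := mean P (fun w => f w ^+ 2); set b := mean P (fun w => f w * g w).
set c := mean P (fun w => g w ^+ 2).
have q t : 0 <= a + 2 * t * b + t ^+ 2 * c.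
  have -> : a + 2 * t * b + t ^+ 2 * c = mean P (fun w => (f w + t * g w) ^+ 2).
    rewrite -meanZl// -meanZl// -!meanD//; try by [exact: L1Zl|apply: L1D => //; exact: L1Zl].
    by apply: eq_mean => w; ring.
  by apply: mean_ge0 => w; exact: sqr_ge0.
have a0 : 0 <= a by apply: mean_ge0 => w; exact: sqr_ge0.
have c0 : 0 <= c by apply: mean_ge0 => w; exact: sqr_ge0.
have [cz|cz] := eqVneq c 0.
  suff -> : b = 0 by rewrite expr0n/= mulr_ge0.
  apply/eqP; apply: contraT => b0.
  have := q (- (a + 1) / (2 * b)); rewrite cz mulr0 addr0.
  have -> : a + 2 * (- (a + 1) / (2 * b)) * b = -1 by field.
  lra.
have cp : 0 < c by rewrite lt0r cz.
have := q (- b / c).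
have -> : a + 2 * (- b / c) * b + (- b / c) ^+ 2 * c = (a * c - b ^+ 2) / c.
  by field; rewrite gt_eqF.
by rewrite pmulr_lge0 ?invr_gt0// subr_ge0.
Qed.

Lemma mean_sqr_le f : measurable_fun setT f -> L1 (fun w => f w ^+ 2) ->
  mean P f ^+ 2 <= mean P (fun w => f w ^+ 2).
Proof.
move=> mf Lf.
have := @mean_cauchy_schwarz f (fun=> 1) mf (measurable_cst (1 : R)) Lf.
have -> : mean P (fun w => f w * 1) = mean P f by apply: eq_mean => w; rewrite mulr1.
have -> : mean P (fun=> 1 ^+ 2) = 1 by rewrite mean_cst expr1n.
by rewrite mulr1; apply; exact: L1_cst.
Qed.

Lemma measurable_superlevel f c : measurable_fun setT f -> measurable [set w | c < f w].
Proof.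
move=> mf; rewrite -[X in measurable X]setTI.
have := mf measurableT _ (measurable_itv `]c, +oo[).
by rewrite /preimage/=; under eq_set do rewrite in_itv/= andbT.
Qed.

Lemma mean_markov f c : measurable_fun setT f -> L1 f -> (forall w, 0 <= f w) -> 0 < c ->
  (P [set w | (c < f w)%R] <= (mean P f / c)%:E)%E.
Proof.
move=> mf Lf f0 c0.
have mA := measurable_superlevel c mf.
have cA : (c%:E * P [set w | (c < f w)%R] <= (mean P f)%:E)%E.
  rewrite -mean_EFin// -[P _]mul1e -integral_cst// -ge0_integralZl_EFin ?(ltW c0)//.
  rewrite integral_mkcond; apply: ge0_le_integral => //.
  - by move=> w _; rewrite patchE; case: ifP => // _; rewrite mule1 lee_fin ltW.
  - apply/(measurable_restrictT _ mA); exact: measurable_cst.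
  - exact/measurable_EFinP.
  - move=> w _; rewrite patchE; case: ifPn => [|_]; last by rewrite lee_fin.
    by rewrite inE /= mule1 lee_fin => /ltW.
by rewrite mulrC EFinM lee_pdivlMl.
Qed.

Lemma ae_eq_mean f g : measurable_fun setT f -> measurable_fun setT g ->
  {ae P, forall w, f w = g w} -> mean P f = mean P g.
Proof.
move=> mf mg fg; rewrite !meanE; congr fine; apply: ae_eq_integral => //.
- exact/measurable_EFinP.
- exact/measurable_EFinP.
- by apply: filterS fg => w /= -> _.
Qed.

Lemma ae_le_mean f g : L1 f -> L1 g -> (forall w, 0 <= f w) -> (forall w, 0 <= g w) ->
  {ae P, forall w, f w <= g w} -> mean P f <= mean P g.
Proof.
move=> Lf Lg f0 g0 fg; rewrite -lee_fin -!mean_EFin//.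
apply: ae_ge0_le_integral => //.
- by move=> w _; rewrite lee_fin.
- exact/measurable_EFinP/L1_measurable.
- by move=> w _; rewrite lee_fin.
- exact/measurable_EFinP/L1_measurable.
- by apply: filterS fg => w /= + _; rewrite lee_fin.
Qed.

Lemma ae_eq_L1 f g : measurable_fun setT g -> L1 f -> {ae P, forall w, f w = g w} -> L1 g.
Proof.
move=> mg Lf fg; apply/integrableP; split; first exact/measurable_EFinP.
have /integrableP[mf] := Lf; apply: le_lt_trans.
apply: ae_ge0_le_integral => //; try exact: measurableT_comp.
  by apply/measurableT_comp => //; exact/measurable_EFinP.
by apply: filterS fg => w /= -> _.
Qed.

Lemma mean0_ae f : L1 f -> (forall w, 0 <= f w) -> mean P f = 0 ->
  {ae P, forall w, f w = 0}.
Proof.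
move=> Lf f0 mf0; have /integrableP[mf _] := Lf.
have /(ae_eq_integral_abs P measurableT mf) : (\int[P]_w `|(EFin \o f) w| = 0)%E.
  have -> : 0%E = (mean P f)%:E by rewrite mf0.
  rewrite -mean_EFin//.
  by apply: eq_integral => w _ /=; rewrite ger0_norm.
by apply: filterS => w /= /(_ I) [].
Qed.

End mean_theory.

(** * Exchangeability of a sample and an independent copy *)

Section rectangles.
Context {dv : measure_display} {V : measurableType dv} {m : nat}.

Definition rectangle (A : 'I_m -> set V) : set (m.-tuple V) :=
  [set t | forall k, A k (tnth t k)].

Definition rectangles : set (set (m.-tuple V)) :=
  [set rectangle A | A in [set A | forall k, measurable (A k)]].

Lemma rectangleE A : rectangle A =
  \bigcap_(k in [set: 'I_m]) ((fun t : m.-tuple V => tnth t k) @^-1` A k).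
Proof. by apply/seteqP; split=> [t h k _|t h k]; apply: h. Qed.

Lemma measurable_rectangle A : (forall k, measurable (A k)) -> measurable (rectangle A).
Proof.
move=> mA; rewrite rectangleE; apply: fin_bigcap_measurable => // k _.
by rewrite -[X in measurable X]setTI; exact: measurable_tnth.
Qed.

(** Rectangles generate the product sigma-algebra and are stable under
    intersection, so they determine probability laws. *)
Lemma measurable_tupleE : @measurable _ (m.-tuple V) = <<s rectangles >>.
Proof.
apply/seteqP; split.
  apply: smallest_sub; first exact: smallest_sigma_algebra.
  rewrite -bigcup_seq => _ [i _ [B mB <-]]; rewrite setTI.
  apply: sub_sigma_algebra; exists (fun k => if k == i then B else setT).
    by move=> k; case: ifP.
  apply/seteqP; split=> [t /(_ i)|t Bt k /=]; first by rewrite eqxx.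
  by case: eqVneq => // ->.
apply: smallest_sub; first exact: sigma_algebra_measurable.
by move=> _ [A mA <-]; exact: measurable_rectangle.
Qed.

Lemma rectangles_setI : setI_closed rectangles.
Proof.
move=> _ _ [A mA <-] [B mB <-]; exists (fun k => A k `&` B k).
  by move=> k; exact: measurableI.
apply/seteqP; split=> [t h|t [hA hB] k]; last by split; [exact: hA|exact: hB].
by split=> k; have [] := h k.
Qed.

End rectangles.

Section exchangeable.
Context {dv : measure_display} {V : measurableType dv}.
Context {d : measure_display} {T : measurableType d} {R : realType}.
Variables (P : probability T R) (n : nat) (Z : 'I_n -> T -> V).
Hypothesis mZ : forall i, measurable_fun setT (Z i).
Hypothesis iZ : forall A : 'I_n -> set V, (forall i, measurable (A i)) ->
  P (\bigcap_(i in [set: 'I_n]) (Z i @^-1` A i)) =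
  (\prod_(i < n) fine (P (Z i @^-1` A i)))%:E.

(** The observations at the first point followed by those at the second one,
    except that the i-th observations are swapped when b i holds. *)
Definition swapped (b : 'I_n -> bool) (w : T * T) : (n + n).-tuple V :=
  [tuple match fintype.split k with
         | inl i => Z i (if b i then w.2 else w.1)
         | inr i => Z i (if b i then w.1 else w.2)
         end | k < n + n].

Lemma measurable_swapped b : measurable_fun setT (swapped b).
Proof.
apply/measurable_fun_tnthP => k.
pose side (c : bool) (w : T * T) := if c then w.2 else w.1.
have ms c : measurable_fun setT (side c).
  by case: c; [exact: measurable_snd|exact: measurable_fst].
case ik : (fintype.split k) => [i|i].
  rewrite [X in measurable_fun _ X](_ : _ = Z i \o side (b i)).
    exact: measurableT_comp.
  by apply/funext => w /=; rewrite tnth_mktuple ik.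
rewrite [X in measurable_fun _ X](_ : _ = Z i \o side (~~ b i)).
  exact: measurableT_comp.
by apply/funext => w /=; rewrite tnth_mktuple ik /side; case: (b i).
Qed.

(** By independence the law of a rectangle is a product in which the swap only
    exchanges factors: the formula does not depend on b. *)
Lemma swapped_rectangle b (A : 'I_(n + n) -> set V) : (forall k, measurable (A k)) ->
  (P \x P)%E (swapped b @^-1` rectangle A) =
  (\prod_(i < n) (fine (P (Z i @^-1` A (lshift n i))) *
                  fine (P (Z i @^-1` A (rshift n i)))))%:E.
Proof.
move=> mA.
pose A1 i := if b i then A (rshift n i) else A (lshift n i).
pose A2 i := if b i then A (lshift n i) else A (rshift n i).
have mA1 i : measurable (A1 i) by rewrite /A1; case: ifP.
have mA2 i : measurable (A2 i) by rewrite /A2; case: ifP.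
have mI (B : 'I_n -> set V) : (forall i, measurable (B i)) ->
    measurable (\bigcap_(i in [set: 'I_n]) (Z i @^-1` B i)).
  move=> mB; apply: fin_bigcap_measurable => // i _.
  by rewrite -[X in measurable X]setTI; exact: mZ.
have -> : swapped b @^-1` rectangle A =
    (\bigcap_(i in [set: 'I_n]) (Z i @^-1` A1 i)) `*`
    (\bigcap_(i in [set: 'I_n]) (Z i @^-1` A2 i)).
  apply/seteqP; split=> [w h|w [/= h1 h2] k].
    split=> i _ /=.
      have := h (if b i then rshift n i else lshift n i).
      by rewrite /A1 tnth_mktuple; case bi : (b i);
        [rewrite (unsplitK (inr i))|rewrite (unsplitK (inl i))]; rewrite bi.
    have := h (if b i then lshift n i else rshift n i).
    by rewrite /A2 tnth_mktuple; case bi : (b i);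
      [rewrite (unsplitK (inl i))|rewrite (unsplitK (inr i))]; rewrite bi.
  rewrite tnth_mktuple -{1}(splitK k); case: (fintype.split k) => i /=.
    by have := h1 i I; have := h2 i I; rewrite /A1 /A2 /=; case: (b i).
  by have := h1 i I; have := h2 i I; rewrite /A1 /A2 /=; case: (b i).
rewrite product_measure1E; [|exact: mI|exact: mI].
transitivity ((\prod_(i < n) fine (P (Z i @^-1` A1 i)))%:E *
    (\prod_(i < n) fine (P (Z i @^-1` A2 i)))%:E)%E.
  by congr (_ * _)%E; [exact: (iZ mA1)|exact: (iZ mA2)].
rewrite -EFinM -big_split/=; congr (_%:E); apply: eq_bigr => i _.
by rewrite /A1 /A2; case: ifP => _ //; rewrite mulrC.
Qed.

Lemma integral_swapped b (f : (n + n).-tuple V -> \bar R) :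
  measurable_fun setT f -> (forall t, 0 <= f t)%E ->
  (\int[(P \x P)%E]_w f (swapped b w) = \int[(P \x P)%E]_w f (swapped xpred0 w))%E.
Proof.
move=> mf f0.
have tr c : (\int[pushforward (P \x P)%E (swapped c)]_t f t =
    \int[(P \x P)%E]_w f (swapped c w))%E.
  rewrite ge0_integral_pushforward//; first exact: measurable_swapped.
rewrite -!tr.
pose phi c : {mfun (T * T)%type >-> (n + n).-tuple V} :=
  HB.pack (swapped c) (isMeasurableFun.Build _ _ _ _ _ (measurable_swapped c)).
rewrite -[swapped b]/(phi b : _ -> _) -[swapped xpred0]/(phi xpred0 : _ -> _).
apply: eq_measure_integral => A mA _.
have P1 c : pushforward (P \x P)%E (phi c) setT = 1%E.
  rewrite /pushforward preimage_setT -setXTT product_measure1E//.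
  transitivity (1 * 1 : \bar R)%E; last by rewrite mule1.
  by congr (_ * _)%E; exact: probability_setT.
apply: (measure_unique rectangles (fun=> setT)) => //.
- exact: measurable_tupleE.
- exact: rectangles_setI.
- by move=> _; exists (fun=> setT) => //; apply/seteqP; split.
- by apply/seteqP; split=> // t _; exists 0%N.
- move=> _ [B mB <-].
  by rewrite -[LHS]/((P \x P)%E (swapped b @^-1` rectangle B)) swapped_rectangle//
    -(swapped_rectangle xpred0).
- by move=> k; rewrite -[X in (X < _)%E]/(pushforward (P \x P)%E (phi b) setT) P1 ltry.
Qed.

End exchangeable.

(** * Symmetrization *)

Section dual_norm.
Context {R : realType} {a b : nat}.

Definition pairing (D A : 'M[R]_(a, b)) : R := \sum_i \sum_j D i j * A i j.

(** A norm given as a supremum of linear functionals, which is what Jensen's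
    inequality needs, together with measurability and integrability. *)
Record dual_norm (N : 'M[R]_(a, b) -> R) (D : set 'M[R]_(a, b)) : Prop := DualNorm {
  dual_norm_measurable : forall d (T : measurableType d) (F : T -> 'M[R]_(a, b)),
    (forall i j, measurable_fun setT (fun w => F w i j)) ->
    measurable_fun setT (fun w => N (F w));
  dual_norm_ge0 : forall A, 0 <= N A;
  dual_normB : forall A B, N (A - B) <= N A + N B;
  dual_norm_le_sum : forall A, N A <= \sum_i \sum_j `|A i j|;
  dual_norm_pairing : forall E A, D E -> pairing E A <= N A;
  dual_norm_le : forall A c, 0 <= c -> (forall E, D E -> pairing E A <= c) -> N A <= c
}.

End dual_norm.

Section symmetrization.
Context {dv : measure_display} {V : measurableType dv}.
Context {d : measure_display} {T : measurableType d} {R : realType}.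
Variables (P : probability T R) (n : nat) (Z : 'I_n -> T -> V).
Hypothesis mZ : forall i, measurable_fun setT (Z i).
Hypothesis iZ : forall A : 'I_n -> set V, (forall i, measurable (A i)) ->
  P (\bigcap_(i in [set: 'I_n]) (Z i @^-1` A i)) =
  (\prod_(i < n) fine (P (Z i @^-1` A i)))%:E.
Variables (a b : nat) (H : V -> 'M[R]_(a, b)).
Hypothesis mH : forall i j, measurable_fun setT (fun v => H v i j).
Hypothesis LH : forall k i j, L1 P (fun w => H (Z k w) i j).
Variables (N : 'M[R]_(a, b) -> R) (D : set 'M[R]_(a, b)).
Hypothesis ND : dual_norm N D.

Definition signed_sum (e : {ffun 'I_n -> bool}) w : 'M[R]_(a, b) :=
  \sum_k (-1) ^+ e k *: H (Z k w).

Lemma signed_sumE e w i j :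
  signed_sum e w i j = \sum_k (-1) ^+ e k * H (Z k w) i j.
Proof. by rewrite summxE; apply: eq_bigr => k _; rewrite mxE. Qed.

Lemma L1_signed_sum e i j : L1 P (fun w => signed_sum e w i j).
Proof.
apply: eq_L1 (L1_sum (index_enum 'I_n) (F := fun k w => (-1) ^+ e k * H (Z k w) i j) _).
  by move=> w; rewrite signed_sumE.
by move=> k; exact: L1Zl.
Qed.

Lemma measurable_signed_sum e i j : measurable_fun setT (fun w => signed_sum e w i j).
Proof. exact: L1_measurable (L1_signed_sum e i j). Qed.

Lemma L1_dual_norm (F : T -> 'M[R]_(a, b)) : (forall i j, L1 P (fun w => F w i j)) ->
  L1 P (fun w => N (F w)).
Proof.
move=> LF; apply: (L1_le (g := fun w => \sum_i \sum_j `|F w i j|)).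
- by apply: (dual_norm_measurable ND) => i j; exact: L1_measurable.
- by apply: L1_sum => i; apply: L1_sum => j; exact: L1_norm.
- by move=> w; rewrite ger0_norm ?(dual_norm_ge0 ND)// (dual_norm_le_sum ND).
Qed.

Definition mean_mx (F : T -> 'M[R]_(a, b)) : 'M[R]_(a, b) :=
  \matrix_(i, j) mean P (fun w => F w i j).

Lemma jensen_dual_norm (F : T -> 'M[R]_(a, b)) A : (forall i j, L1 P (fun w => F w i j)) ->
  N (A - mean_mx F) <= mean P (fun w => N (A - F w)).
Proof.
move=> LF; have LAF i j : L1 P (fun w => (A - F w) i j).
  by apply: eq_L1 (L1B (L1_cst P (A i j)) (LF i j)) => w; rewrite !mxE.
have LN := L1_dual_norm LAF.
apply: (dual_norm_le ND); first by apply: mean_ge0 => w; exact: (dual_norm_ge0 ND).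
move=> E DE; have -> : pairing E (A - mean_mx F) = mean P (fun w => pairing E (A - F w)).
  rewrite /pairing mean_sum; last by move=> i; apply: L1_sum => j; exact: L1Zl.
  apply: eq_bigr => i _; rewrite mean_sum; last by move=> j; exact: L1Zl.
  apply: eq_bigr => j _; rewrite meanZl//; congr (_ * _).
  rewrite !mxE -[in LHS](mean_cst P (A i j)) -meanB//; last exact: L1_cst.
  by apply: eq_mean => w; rewrite !mxE.
apply: le_mean => //.
  by apply: L1_sum => i; apply: L1_sum => j; exact: L1Zl.
by move=> w; exact: (dual_norm_pairing ND).
Qed.

(** Replace the mean by an independent copy of the sample (Jensen), swap
    observations between both copies according to the signs, and split. *)
Lemma symmetrization e :
  mean P (fun w => N (signed_sum [ffun=> false] w - mean_mx (signed_sum [ffun=> false]))) <=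
  2 * mean P (fun w => N (signed_sum e w)).
Proof.
set S := signed_sum [ffun=> false]; set F := signed_sum e.
have LS i j : L1 P (fun w => S w i j) by exact: L1_signed_sum.
have LF i j : L1 P (fun w => F w i j) by exact: L1_signed_sum.
have LSM i j : L1 P (fun w => (S w - mean_mx S) i j).
  by apply: eq_L1 (L1B (LS i j) (L1_cst P (mean_mx S i j))) => w; rewrite !mxE.
have LSS w i j : L1 P (fun w' => (S w - S w') i j).
  by apply: eq_L1 (L1B (L1_cst P (S w i j)) (LS i j)) => w'; rewrite !mxE.
have N0 := dual_norm_ge0 ND.
pose f (t : (n + n).-tuple V) : \bar R :=
  (N (\sum_k (H (tnth t (lshift n k)) - H (tnth t (rshift n k)))))%:E.
have mf : measurable_fun setT f.
  apply/measurable_EFinP/(dual_norm_measurable ND) => i j.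
  rewrite [X in measurable_fun _ X](_ : _ = fun t : (n + n).-tuple V => \sum_k
    (H (tnth t (lshift n k)) i j - H (tnth t (rshift n k)) i j)); last first.
    by apply/funext => t; rewrite summxE; apply: eq_bigr => k _; rewrite !mxE.
  apply: measurable_sum => k; apply: measurable_funB;
    exact: (measurableT_comp (mH i j) (measurable_tnth _)).
have f0 t : (0 <= f t)%E by rewrite lee_fin.
have fe b' w : f (swapped Z b' w) =
    (N (\sum_k (-1) ^+ b' k *: (H (Z k w.1) - H (Z k w.2))))%:E.
  congr (N _)%:E; apply: eq_bigr => k _; rewrite !tnth_mktuple.
  rewrite (unsplitK (inl k)) (unsplitK (inr k)); case: (b' k) => //=.
    by rewrite expr1 scaleN1r opprB.
  by rewrite expr0 scale1r.
have step1 : ((mean P (fun w => N (S w - mean_mx S)))%:E <=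
    \int[(P \x P)%E]_w f (swapped Z xpred0 w))%E.
  rewrite -mean_EFin; last exact: L1_dual_norm.
  rewrite fubini_tonelli1; last first.
  - by move=> w; exact: f0.
  - by apply: (measurableT_comp mf); exact: measurable_swapped.
  apply: ge0_le_integral => //.
  - by move=> w _; rewrite lee_fin.
  - by apply/measurable_EFinP; apply: L1_measurable; exact: L1_dual_norm.
  - apply: measurable_fun_fubini_tonelli_F => //.
    by apply: (measurableT_comp mf); exact: measurable_swapped.
  move=> w _; rewrite /fubini_F.
  under eq_integral do rewrite fe/=.
  have -> : (fun w' => (N (\sum_k (-1) ^+ false *: (H (Z k w) - H (Z k w'))))%:E) =
      (fun w' => (N (S w - S w'))%:E).
    apply/funext => w'; congr (N _)%:E; rewrite /S /signed_sum -sumrB.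
    by apply: eq_bigr => k _; rewrite !ffunE scalerBr.
  rewrite mean_EFin ?lee_fin; last exact: L1_dual_norm.
  exact: jensen_dual_norm.
rewrite -lee_fin (le_trans step1)// -(integral_swapped mZ iZ e)//.
have mN c : measurable_fun setT (fun w : T * T => (N (F (if c then w.2 else w.1)))%:E).
  apply/measurable_EFinP/(dual_norm_measurable ND) => i j.
  have mF := measurable_signed_sum e i j.
  by case: c; apply: (measurableT_comp mF); [exact: measurable_snd|exact: measurable_fst].
have step2 : (\int[(P \x P)%E]_w f (swapped Z e w) <=
    \int[(P \x P)%E]_w ((N (F w.1))%:E + (N (F w.2))%:E))%E.
  apply: ge0_le_integral => //.
  - by apply: (measurableT_comp mf); exact: measurable_swapped.
  - by apply: emeasurable_funD; [exact: (mN false)|exact: (mN true)].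
  move=> w _; rewrite fe -EFinD lee_fin.
  have -> : \sum_k (-1) ^+ e k *: (H (Z k w.1) - H (Z k w.2)) = F w.1 - F w.2.
    by rewrite /F /signed_sum -sumrB; apply: eq_bigr => k _; rewrite scalerBr.
  exact: (dual_normB ND).
have LNF := L1_dual_norm LF.
have intc (c : R) : (\int[P]_w c%:E)%E = c%:E.
  by rewrite (mean_EFin (L1_cst P c)) mean_cst.
rewrite (le_trans step2)// ge0_integralD//; last 4 first.
- by move=> w _; rewrite lee_fin.
- exact: (mN false).
- by move=> w _; rewrite lee_fin.
- exact: (mN true).
rewrite !fubini_tonelli1; last 4 first.
- exact: (mN true).
- by move=> w; rewrite lee_fin.
- exact: (mN false).
- by move=> w; rewrite lee_fin.
rewrite /fubini_F /=.
under eq_integral do rewrite intc.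
rewrite mean_EFin// intc mulr_natl mulr2n EFinD.
by rewrite [X in (_ <= _ + X)%E](_ : _ = (mean P (fun w => N (F w)))%:E).
Qed.

End symmetrization.

(** * Measurability of norms *)

Section measurable_norms.
Context {R : realType}.

Lemma measurable_entry m n (i : 'I_m) (j : 'I_n) :
  measurable_fun setT (fun M : 'M[R]_(m, n) => M i j).
Proof.
move=> _ B mB; apply: sub_sigma_algebra; exists (i, j) => //=.
by exists B.
Qed.

Context {d : measure_display} {T : measurableType d}.

Lemma measurable_sqrt (f : T -> R) : measurable_fun setT f ->
  measurable_fun setT (fun w => Num.sqrt (f w)).
Proof.
move=> mf; have ms : measurable_fun setT (Num.sqrt : R -> R).
  by apply: continuous_measurable_fun => x; exact: sqrt_continuous.
exact: measurableT_comp ms mf.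
Qed.

Lemma measurable_dot p (F G : T -> 'cV[R]_p) :
  (forall i, measurable_fun setT (fun w => F w i 0)) ->
  (forall i, measurable_fun setT (fun w => G w i 0)) ->
  measurable_fun setT (fun w => dot (F w) (G w)).
Proof.
move=> mF mG; rewrite [X in measurable_fun _ X](_ : _ =
    fun w => \sum_i F w i 0 * G w i 0); last by apply/funext => w; rewrite dotE.
by apply: measurable_sum => i; apply: measurable_funM.
Qed.

Lemma measurable_norm2 p (F : T -> 'cV[R]_p) :
  (forall i, measurable_fun setT (fun w => F w i 0)) ->
  measurable_fun setT (fun w => norm2 (F w)).
Proof.
move=> mF; rewrite [X in measurable_fun _ X](_ : _ =
    fun w => Num.sqrt (dot (F w) (F w))); last by apply/funext => w; rewrite norm2E.
by apply: measurable_sqrt; exact: measurable_dot.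
Qed.

Lemma measurable_mulmx m n k (F : T -> 'M[R]_(m, n)) (G : T -> 'M[R]_(n, k)) :
  (forall i j, measurable_fun setT (fun w => F w i j)) ->
  (forall i j, measurable_fun setT (fun w => G w i j)) ->
  forall i j, measurable_fun setT (fun w => (F w *m G w) i j).
Proof.
move=> mF mG i j; rewrite [X in measurable_fun _ X](_ : _ =
    fun w => \sum_k F w i k * G w k j); last by apply/funext => w; rewrite mxE.
by apply: measurable_sum => l; apply: measurable_funM.
Qed.

(** Integer vectors are countably many, so that the operator norm is a
    countable supremum and hence measurable. *)
Definition int_vector p (k : nat) : 'cV[R]_p :=
  if unpickle k is Some z then map_mx intr (z : 'cV[int]_p) else 0.

Definition int_ratio p (A : 'M[R]_p) k : R :=
  norm2 (A *m int_vector p k) * (norm2 (int_vector p k))^-1.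

Lemma int_ratio_le p (A : 'M[R]_p) k : int_ratio A k <= opnorm A.
Proof.
rewrite /int_ratio; have [->|v0] := eqVneq (int_vector p k) 0.
  by rewrite mulmx0 norm2_0 mul0r opnorm_ge0.
by rewrite ler_pdivrMr ?norm2_gt0// norm2_mulmx_le.
Qed.

(** The integer part of N v has a direction that tends to that of v. *)
Lemma opnorm_int_ratio p (A : 'M[R]_p) : opnorm A = sups (int_ratio A) 0.
Proof.
have ub : has_ubound (sdrop (int_ratio A) 0).
  by exists (opnorm A) => _ [k _ <-]; exact: int_ratio_le.
set s := sups (int_ratio A) 0.
have sk k : int_ratio A k <= s by apply: ub_le_sup => //; exists k.
apply/eqP; rewrite eq_le; apply/andP; split; last first.
  apply: ge_sup; first by exists (int_ratio A 0), 0%N.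
  by move=> _ [k _ <-]; exact: int_ratio_le.
have s0 : 0 <= s by apply: le_trans (sk 0%N); rewrite mulr_ge0 ?invr_ge0 ?norm2_ge0.
apply: opnorm_le_dual => // u v u1 v1; apply: le_trans (cauchy_schwarz _ _) _.
apply: (@le_trans _ _ (norm2 (A *m v))); first by rewrite ler_piMl ?norm2_ge0.
rewrite leNgt; apply/negP => svA.
pose e := norm2 (A *m v) - s; have e0 : 0 < e by rewrite subr_gt0.
pose c := (s + opnorm A) * p%:R.
have c0 : 0 <= c by rewrite mulr_ge0 ?addr_ge0 ?opnorm_ge0.
have H N : N%:R * e <= c.
  pose z : 'cV[int]_p := \col_i Num.floor (N%:R * v i 0).
  pose zr : 'cV[R]_p := map_mx intr z.
  have : int_ratio A (pickle z) <= s by [].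
  rewrite /int_ratio /int_vector pickleK -/zr => hz.
  have nAz : norm2 (A *m zr) <= s * norm2 zr.
    have [->|z0] := eqVneq zr 0; first by rewrite mulmx0 norm2_0 mulr0.
    by rewrite -ler_pdivrMr ?norm2_gt0.
  have nd : norm2 (N%:R *: v - zr) <= p%:R.
    rewrite (le_trans (norm2_le_sum _))// -[X in _ <= X%:R]card_ord -sum1_card natr_sum.
    apply: ler_sum => i _; rewrite !mxE.
    have := Num.Theory.floor_itv (N%:R * v i 0).
    by rewrite intrD ler_norml => /andP[h1 h2]; apply/andP; split; lra.
  have nz : norm2 zr <= N%:R + p%:R.
    have -> : zr = N%:R *: v - (N%:R *: v - zr) by rewrite opprB addrC subrK.
    rewrite (le_trans (norm2D _ _))// norm2N lerD//.
    by rewrite norm2Z ger0_norm// ler_piMr.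
  have : N%:R * norm2 (A *m v) <= norm2 (A *m zr) + opnorm A * p%:R.
    rewrite -[X in X * _]ger0_norm// -norm2Z scalemxAr.
    have -> : N%:R *: v = zr + (N%:R *: v - zr) by rewrite addrC subrK.
    rewrite mulmxDr (le_trans (norm2D _ _))// lerD2l.
    by rewrite (le_trans (norm2_mulmx_le _ _))// ler_wpM2l ?opnorm_ge0.
  have : s * norm2 zr <= s * (N%:R + p%:R) by rewrite ler_wpM2l.
  rewrite /e /c; lra.
pose N := Num.truncn (c / e).
have := H N.+1; rewrite -ler_pdivlMr// leNgt => /negP; apply.
by have := Num.Theory.truncnS_gt (c / e).
Qed.

Lemma measurable_opnorm p (F : T -> 'M[R]_p) :
  (forall i j, measurable_fun setT (fun w => F w i j)) ->
  measurable_fun setT (fun w => opnorm (F w)).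
Proof.
move=> mF; rewrite [X in measurable_fun _ X](_ : _ =
    fun w => sups (fun k => int_ratio (F w) k) 0); last first.
  by apply/funext => w; rewrite opnorm_int_ratio.
apply: (@measurable_fun_sups _ _ _ setT (fun k w => int_ratio (F w) k)) => //.
  by move=> w _; exists (opnorm (F w)) => _ [k _ <-]; exact: int_ratio_le.
move=> k; apply: measurable_funM => //; apply: measurable_norm2 => i.
by apply: measurable_mulmx.
Qed.

End measurable_norms.

Section dual_norms.
Context {R : realType} {p : nat}.

Lemma dual_norm_norm2 :
  @dual_norm R p 1 (fun A => norm2 A) [set u | norm2 u <= 1].
Proof.
have pE (u v : 'cV[R]_p) : pairing u v = dot u v.
  by rewrite dotE; apply: eq_bigr => i _; rewrite big_ord1.
split.
- by move=> d T F mF; apply: measurable_norm2 => i.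
- by move=> A; exact: norm2_ge0.
- by move=> A B; rewrite (le_trans (norm2D _ _))// norm2N.
- move=> A; rewrite (le_trans (norm2_le_sum _))//; apply: ler_sum => i _.
  by rewrite big_ord1.
- move=> u v /= u1; rewrite pE (le_trans (cauchy_schwarz _ _))//.
  by rewrite ler_piMl ?norm2_ge0.
- move=> v c c0 h; have [->|v0] := eqVneq v 0; first by rewrite norm2_0.
  have nv := norm2_gt0 v0.
  have := h ((norm2 v)^-1 *: v); rewrite pE /= norm2Z normfV gtr0_norm// mulVf ?gt_eqF//.
  by move=> /(_ (lexx _)); rewrite dotZl -norm2_sqr expr2 mulKf// gt_eqF.
Qed.

Lemma dual_norm_opnorm :
  @dual_norm R p p (fun A => opnorm A)
    [set E | exists u v, [/\ norm2 u <= 1, norm2 v <= 1 & E = u *m v^T]].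
Proof.
have pE (u v : 'cV[R]_p) A : pairing (u *m v^T) A = dot u (A *m v).
  rewrite dotE; apply: eq_bigr => i _; rewrite mxE mulr_sumr; apply: eq_bigr => j _.
  by rewrite mxE big_ord1 !mxE -mulrA [v _ _ * _]mulrC.
split.
- by move=> d T F mF; exact: measurable_opnorm.
- by move=> A; exact: opnorm_ge0.
- move=> A B; rewrite (le_trans (opnormD _ _))// lerD2l.
  apply: opnorm_le; first exact: opnorm_ge0.
  by move=> v; rewrite mulNmx norm2N norm2_mulmx_le.
- exact: opnorm_le_sum.
- move=> _ A [u [v [u1 v1 ->]]]; rewrite pE (le_trans (dot_opnorm _ _ _))//.
  by rewrite ler_piMr ?opnorm_ge0// mulr_ile1 ?norm2_ge0.
- by move=> A c c0 h; apply: opnorm_le_dual => // u v u1 v1; rewrite -pE; apply: h; exists u, v.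
Qed.

End dual_norms.

(** * Equality in law and independence *)

Section law.
Context {dv : measure_display} {V : measurableType dv} {R : realType}.
Context {d : measure_display} {T : measurableType d} (P : probability T R).
Context {d' : measure_display} {T' : measurableType d'} (P' : probability T' R).
Variables (X : T -> V) (X' : T' -> V).
Hypothesis mX : measurable_fun setT X.
Hypothesis mX' : measurable_fun setT X'.
Hypothesis lawX : forall A, measurable A -> P' (X' @^-1` A) = P (X @^-1` A).

Lemma ge0_integral_law (f : V -> \bar R) : measurable_fun setT f -> (forall v, 0 <= f v)%E ->
  (\int[P']_w f (X' w) = \int[P]_w f (X w))%E.
Proof.
move=> mf f0.
have e' : (\int[pushforward P' X']_v f v = \int[P']_w f (X' w))%E.
  by rewrite ge0_integral_pushforward.
have e : (\int[pushforward P X]_v f v = \int[P]_w f (X w))%E.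
  by rewrite ge0_integral_pushforward.
rewrite -e -e'.
pose phi : {mfun T >-> V} := HB.pack X (isMeasurableFun.Build _ _ _ _ _ mX).
pose phi' : {mfun T' >-> V} := HB.pack X' (isMeasurableFun.Build _ _ _ _ _ mX').
rewrite -[X]/(phi : _ -> _) -[X']/(phi' : _ -> _).
by apply: eq_measure_integral => A mA _; exact: lawX.
Qed.

Lemma L1_law (h : V -> R) : measurable_fun setT h -> L1 P (h \o X) -> L1 P' (h \o X').
Proof.
move=> mh Lh; apply/integrableP; split.
  by apply/measurable_EFinP; exact: measurableT_comp.
have := @ge0_integral_law (fun v => `|(h v)%:E|%E).
move=> /= ->//; last by apply/measurable_EFinP/measurableT_comp.
by have /integrableP[] := Lh.
Qed.

Lemma mean_law (h : V -> R) : measurable_fun setT h -> L1 P (h \o X) ->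
  mean P' (h \o X') = mean P (h \o X).
Proof.
move=> mh Lh; have Lh' := L1_law mh Lh; rewrite !meanE; congr fine.
have mh' : measurable_fun setT (EFin \o h) by exact/measurable_EFinP.
transitivity (\int[pushforward P' X']_v (h v)%:E)%E.
  by rewrite (integral_pushforward mX' mh')//; exact: Lh'.
transitivity (\int[pushforward P X]_v (h v)%:E)%E; last first.
  by rewrite (integral_pushforward mX mh')//; exact: Lh.
pose phi : {mfun T >-> V} := HB.pack X (isMeasurableFun.Build _ _ _ _ _ mX).
pose phi' : {mfun T' >-> V} := HB.pack X' (isMeasurableFun.Build _ _ _ _ _ mX').
rewrite -[X]/(phi : _ -> _) -[X']/(phi' : _ -> _).
by apply: eq_measure_integral => A mA _; exact: lawX.
Qed.

Lemma ae_law (Q : set V) : measurable Q -> {ae P, forall w, Q (X w)} ->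
  {ae P', forall w, Q (X' w)}.
Proof.
move=> mQ hQ; have mXQ : measurable (X @^-1` ~` Q).
  by rewrite -[_ @^-1` _]setTI; apply: mX => //; exact: measurableC.
have P0 : P (X @^-1` (~` Q)) = 0%E by apply/negligibleP => //; exact: hQ.
exists (X' @^-1` ~` Q); split=> //.
  by rewrite -[_ @^-1` _]setTI; apply: mX' => //; exact: measurableC.
by rewrite lawX//; exact: measurableC.
Qed.

End law.

Section independence.
Context {du : measure_display} {U : measurableType du}.
Context {dv : measure_display} {V : measurableType dv} {R : realType}.
Context {d : measure_display} {T : measurableType d} (P : probability T R).
Variables (X : T -> U) (Y : T -> V).
Hypothesis mX : measurable_fun setT X.
Hypothesis mY : measurable_fun setT Y.
Hypothesis iXY : forall A B, measurable A -> measurable B ->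
  P (X @^-1` A `&` Y @^-1` B) = (P (X @^-1` A) * P (Y @^-1` B))%E.

(** The joint law is the product law, so Fubini's theorem applies. *)
Lemma integral_mul_independent (f : U -> R) (g : V -> R) :
  measurable_fun setT f -> measurable_fun setT g ->
  (forall u, 0 <= f u) -> (forall v, 0 <= g v) ->
  (\int[P]_w (f (X w) * g (Y w))%:E = \int[P]_w (f (X w))%:E * \int[P]_w (g (Y w))%:E)%E.
Proof.
move=> mf mg f0 g0.
have mXY : measurable_fun setT (fun w => (X w, Y w)) by exact: measurable_fun_pair.
have lawXY (A : set (U * V)) : measurable A ->
    P ((fun w => (X w, Y w)) @^-1` A) = (P \x P)%E ((fun w => (X w.1, Y w.2)) @^-1` A).
  have mXX : measurable_fun setT (fun w : T * T => (X w.1, Y w.2)).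
    by apply: measurable_fun_pair; apply: measurableT_comp.
  pose phi : {mfun T >-> (U * V)%type} := HB.pack (fun w => (X w, Y w))
    (isMeasurableFun.Build _ _ _ _ _ mXY).
  pose phi2 : {mfun (T * T)%type >-> (U * V)%type} := HB.pack
    (fun w : T * T => (X w.1, Y w.2)) (isMeasurableFun.Build _ _ _ _ _ mXX).
  pose G : set (set (U * V)) := [set A1 `*` A2 | A1 in measurable & A2 in measurable].
  move=> mA.
  apply: (measure_unique G (fun=> setT) _ _ _ _ (pushforward P phi)
    (pushforward (P \x P)%E phi2) _ _ A) => //.
  - by rewrite measurable_prod_measurableType.
  - move=> _ _ [A1 mA1 [A2 mA2 <-]] [B1 mB1 [B2 mB2 <-]].
    exists (A1 `&` B1); first exact: measurableI.
    by exists (A2 `&` B2); [exact: measurableI|rewrite setXI].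
  - by move=> _; exists setT => //; exists setT => //; rewrite setXTT.
  - by apply/seteqP; split=> // t _; exists 0%N.
  - move=> _ [A1 mA1 [A2 mA2 <-]].
    transitivity (P (X @^-1` A1 `&` Y @^-1` A2)) => //.
    transitivity ((P \x P)%E ((X @^-1` A1) `*` (Y @^-1` A2))) => //.
    rewrite iXY// product_measure1E//.
      by rewrite -[X in measurable X]setTI; exact: mX.
    by rewrite -[X in measurable X]setTI; exact: mY.
  - move=> k; rewrite -[X in (X < _)%E]/(P setT).
    by apply: le_lt_trans (probability_le1 _ _) _ => //; rewrite ltry.
pose h (z : U * V) : \bar R := (f z.1 * g z.2)%:E.
have mh : measurable_fun setT h.
  apply/measurable_EFinP; apply: measurable_funM.
    exact: measurableT_comp mf measurable_fst.
  exact: measurableT_comp mg measurable_snd.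
have h0 z : (0 <= h z)%E by rewrite lee_fin mulr_ge0.
have mXX : measurable_fun setT (fun w : T * T => (X w.1, Y w.2)).
  apply: measurable_fun_pair; first exact: measurableT_comp mX measurable_fst.
  exact: measurableT_comp mY measurable_snd.
transitivity (\int[(P \x P)%E]_w h (X w.1, Y w.2))%E.
  by apply: (@ge0_integral_law _ _ _ _ _ (P \x P)%E _ _ P _ _ mXX mXY).
rewrite fubini_tonelli1//; last exact: measurableT_comp mh mXX.
have mfX : measurable_fun setT (fun w => (f (X w))%:E).
  by apply/measurable_EFinP; exact: measurableT_comp mf mX.
have mgY : measurable_fun setT (fun w => (g (Y w))%:E).
  by apply/measurable_EFinP; exact: measurableT_comp mg mY.
rewrite /fubini_F -ge0_integralZr//; first last.
- by apply: integral_ge0 => w _; rewrite lee_fin.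
- by move=> w _; rewrite lee_fin.
apply: eq_integral => w _; rewrite -ge0_integralZl//; last by rewrite lee_fin.
by move=> w' _; rewrite lee_fin.
Qed.

Lemma L1_mul_independent (f : U -> R) (g : V -> R) :
  measurable_fun setT f -> measurable_fun setT g ->
  (forall u, 0 <= f u) -> (forall v, 0 <= g v) ->
  L1 P (f \o X) -> L1 P (g \o Y) -> L1 P (fun w => f (X w) * g (Y w)).
Proof.
move=> mf mg f0 g0 Lf Lg; apply: L1_ge0.
- by apply: measurable_funM; [exact: measurableT_comp mf mX|exact: measurableT_comp mg mY].
- by move=> w; rewrite mulr_ge0.
by rewrite integral_mul_independent// (mean_EFin Lf) (mean_EFin Lg) -EFinM ltry.
Qed.

Lemma mean_mul_independent_ge0 (f : U -> R) (g : V -> R) :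
  measurable_fun setT f -> measurable_fun setT g ->
  (forall u, 0 <= f u) -> (forall v, 0 <= g v) ->
  L1 P (f \o X) -> L1 P (g \o Y) ->
  mean P (fun w => f (X w) * g (Y w)) = mean P (f \o X) * mean P (g \o Y).
Proof.
move=> mf mg f0 g0 Lf Lg; apply: EFin_inj; rewrite -mean_EFin.
  by rewrite integral_mul_independent// (mean_EFin Lf) (mean_EFin Lg) EFinM.
exact: L1_mul_independent.
Qed.

(** A real function is the difference of two nonnegative ones, |f| + f and |f|. *)
Lemma mean_mul_independent (f : U -> R) (g : V -> R) :
  measurable_fun setT f -> measurable_fun setT g ->
  L1 P (f \o X) -> L1 P (g \o Y) ->
  mean P (fun w => f (X w) * g (Y w)) = mean P (f \o X) * mean P (g \o Y).
Proof.
move=> mf mg Lf Lg.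
pose fp u := `|f u| + f u; pose fn u := `|f u|.
pose gp v := `|g v| + g v; pose gn v := `|g v|.
have p0 (t : R) : 0 <= `|t| + t by have := ler_norm (- t); rewrite normrN; lra.
have mfn : measurable_fun setT fn by exact: measurableT_comp.
have mgn : measurable_fun setT gn by exact: measurableT_comp.
have mfp : measurable_fun setT fp by exact: measurable_funD.
have mgp : measurable_fun setT gp by exact: measurable_funD.
have Lfn : L1 P (fn \o X) by exact: L1_norm Lf.
have Lgn : L1 P (gn \o Y) by exact: L1_norm Lg.
have Lfp : L1 P (fp \o X) by exact: L1D Lfn Lf.
have Lgp : L1 P (gp \o Y) by exact: L1D Lgn Lg.
have fn0 u : 0 <= fn u by rewrite /fn.
have gn0 u : 0 <= gn u by rewrite /gn.
have e : (fun w => f (X w) * g (Y w)) =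
    fun w => (fp (X w) * gp (Y w) + fn (X w) * gn (Y w)) -
             (fp (X w) * gn (Y w) + fn (X w) * gp (Y w)).
  by apply/funext => w; rewrite /fp /fn /gp /gn; ring.
have L1' := L1_mul_independent mfp mgp (fun u => p0 (f u)) (fun v => p0 (g v)) Lfp Lgp.
have L2' := L1_mul_independent mfn mgn fn0 gn0 Lfn Lgn.
have L3' := L1_mul_independent mfp mgn (fun u => p0 (f u)) gn0 Lfp Lgn.
have L4' := L1_mul_independent mfn mgp fn0 (fun v => p0 (g v)) Lfn Lgp.
rewrite e meanB; [|exact: L1D|exact: L1D]; rewrite !meanD//.
rewrite !mean_mul_independent_ge0//; try by move=> *; exact: p0.
have -> : mean P (fp \o X) = mean P (fn \o X) + mean P (f \o X) by rewrite -meanD.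
have -> : mean P (gp \o Y) = mean P (gn \o Y) + mean P (g \o Y) by rewrite -meanD.
ring.
Qed.

End independence.

(** * Rademacher averages of the sample moments *)

Section rademacher_averages.
Context {R : realType} {p n : nat}.

Lemma sum_rsign2 (i j : 'I_n) : i != j ->
  \sum_(e : {ffun 'I_n -> bool}) rsign e i * rsign e j = 0 :> R.
Proof.
move=> ij; set s := \sum_e _; suff : s = - s by move=> h; lra.
rewrite {1}/s (reindex_inj (inv_inj (flipK i))) /s -sumrN; apply: eq_bigr => e _.
by rewrite rsign_flip rsign_flip_neq 1?eq_sym// mulNr.
Qed.

(** The mean square of a Rademacher sum is the sum of the squares, as distinct
    signs are uncorrelated. *)
Lemma rademacher_norm2 (z : 'I_n -> 'cV[R]_p) :
  \sum_(e : {ffun 'I_n -> bool}) norm2 (\sum_k rsign e k *: z k) <=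
  (2 ^ n)%:R * Num.sqrt (\sum_k dot (z k) (z k)).
Proof.
set t := \sum_k dot (z k) (z k); have t0 : 0 <= t by rewrite sumr_ge0// => k _; exact: dot_ge0.
have sq : \sum_(e : {ffun 'I_n -> bool}) norm2 (\sum_k rsign e k *: z k) ^+ 2 =
    (2 ^ n)%:R * t.
  under eq_bigr do rewrite norm2_sqr dot_suml.
  rewrite exchange_big mulr_sumr; apply: eq_bigr => k _ /=.
  under eq_bigr do rewrite dot_sumr.
  rewrite exchange_big (bigD1 k)//= [X in _ + X]big1 ?addr0; last first.
    move=> l lk; under eq_bigr do rewrite dotZl dotZr mulrA.
    by rewrite -mulr_suml sum_rsign2 ?mul0r// eq_sym.
  under eq_bigr do rewrite dotZl dotZr mulrA rsign_sq mul1r.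
  by rewrite sumr_const card_signs mulr_natl.
have [tz|tn] := eqVneq t 0.
  rewrite tz sqrtr0 mulr0 big1// => e _.
  have z0 k : z k = 0.
    apply: dot_eq0; apply/eqP; rewrite eq_le dot_ge0 andbT -[leRHS]tz /t (bigD1 k)//=.
    by rewrite lerDl sumr_ge0// => l _; exact: dot_ge0.
  by rewrite big1 ?norm2_0// => k _; rewrite z0 scaler0.
set T := Num.sqrt t; have Tp : 0 < T by rewrite sqrtr_gt0 lt0r tn.
have T2 : T ^+ 2 = t by rewrite sqr_sqrtr.
(* The mean is compared with the root mean square T, by the inequality of
   arithmetic and geometric means. *)
have aT (a : R) : a <= 2^-1 * (T + a ^+ 2 / T).
  have -> : 2^-1 * (T + a ^+ 2 / T) = a + (2 * T)^-1 * (a - T) ^+ 2.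
    by field; rewrite gt_eqF.
  by rewrite lerDl mulr_ge0 ?sqr_ge0// invr_ge0 mulr_ge0// ltW.
rewrite (le_trans (ler_sum _ (fun e _ => aT _)))//.
rewrite -mulr_sumr big_split/= sumr_const card_signs -mulr_suml sq -T2 -mulr_natl.
by rewrite le_eqVlt; apply/orP; left; apply/eqP; field; rewrite gt_eqF.
Qed.

Lemma quad_outer (z : 'I_n -> 'cV[R]_p) u :
  dot u ((\sum_k z k *m (z k)^T) *m u) = \sum_k dot (z k) u ^+ 2.
Proof.
rewrite mulmx_suml dot_sumr; apply: eq_bigr => k _.
have := @dot_mul_outer R p u u (z k) 1%:M 1%:M.
by rewrite mul1mx mulmx1 !mul1mx => ->; rewrite dotC expr2.
Qed.

(** Vectors in a space of dimension r: the trace is at most r times the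
    norm, so the logarithm of r is what the moment method pays. *)
Lemma rademacher_range (z : 'I_n -> 'cV[R]_p) (A : 'M[R]_p) k m :
  (0 < k)%N -> (\rank A <= 2 ^ k)%N -> 0 <= m ->
  (forall i, dot (z i) (z i) <= m) -> (forall i, z i \in mxrange A) ->
  \sum_e opnorm (rsum z e) <=
  (2 ^ n)%:R * (2 * Num.sqrt (4 * k%:R * (m * opnorm (\sum_i z i *m (z i)^T)))).
Proof.
move=> k0 rk m0 zm zA; set G := \sum_i z i *m (z i)^T.
have zG u : \sum_i dot (z i) u ^+ 2 <= opnorm G * dot u u.
  by rewrite -quad_outer -norm2_sqr expr2; exact: dot_opnorm.
apply: rademacher_opnorm => //.
- by rewrite mulr_ge0// opnorm_ge0.
- move=> u; rewrite -mulrA; apply: (@le_trans _ _ (m * \sum_i dot (z i) u ^+ 2)).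
    by rewrite mulr_sumr; apply: ler_sum => i _; rewrite ler_wpM2r ?sqr_ge0.
  by rewrite ler_wpM2l.
apply: (@le_trans _ _ (m * \sum_i dot (z i) (z i))).
  by rewrite mulr_sumr; apply: ler_sum => i _; rewrite expr2 ler_wpM2r ?dot_ge0.
rewrite mulrCA ler_wpM2l// mulrC.
have -> : \sum_i dot (z i) (z i) =
    \sum_j \sum_i dot (z i) (projmx (mxrange A) *m delta_mx j 0) ^+ 2.
  rewrite exchange_big; apply: eq_bigr => i _ /=; rewrite dotE; apply: eq_bigr => j _.
  rewrite (dot_sym _ _ (projmx_sym _)) projmxE orthproj_id// dotC dot_delta.
  by rewrite expr2.
apply: (@le_trans _ _ (opnorm G * \tr (projmx (mxrange A)))).
  rewrite /mxtrace mulr_sumr; apply: ler_sum => j _; apply: le_trans (zG _) _.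
  rewrite ler_wpM2l ?opnorm_ge0//.
  rewrite -(dot_sym _ _ (projmx_sym _)) mulmxA projmx_idem dot_delta -colE mxE.
  exact: lexx.
rewrite ler_wpM2l ?opnorm_ge0// (le_trans (mxtrace_projmx_range A))//.
by rewrite -natrX ler_nat.
Qed.

End rademacher_averages.

(** * Concentration of the sample moments *)

Section concentration.
Context {R : realType} {p n : nat}.
Context {d : measure_display} {T : measurableType d} (P : probability T R).
Context {d' : measure_display} {T' : measurableType d'} (P' : probability T' R).
Variables (x : T -> 'cV[R]_p) (y : T -> R).
Variable Z : 'I_n -> T' -> ('cV[R]_p * R)%type.
Hypothesis mx : measurable_fun setT x.
Hypothesis my : measurable_fun setT y.
Hypothesis mZ : forall i, measurable_fun setT (Z i).
Hypothesis iidZ : iid_copies P P' x y Z.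
Hypothesis n0 : (0 < n)%N.
Hypothesis Lx : forall i, L1 P (fun w => x w i 0 ^+ 2).
Hypothesis Ly : L1 P (fun w => y w ^+ 2).

Let iZ : forall A : 'I_n -> set ('cV[R]_p * R), (forall i, measurable (A i)) ->
  P' (\bigcap_(i in [set: 'I_n]) (Z i @^-1` A i)) =
  (\prod_(i < n) fine (P' (Z i @^-1` A i)))%:E.
Proof. by case: iidZ. Qed.

Let mxy : measurable_fun setT (fun w => (x w, y w)).
Proof. exact: measurable_fun_pair. Qed.

Let mfst i : measurable_fun setT (fun v : 'cV[R]_p * R => v.1 i 0).
Proof. exact: measurableT_comp (measurable_entry i 0) measurable_fst. Qed.

Let msnd : measurable_fun setT (fun v : 'cV[R]_p * R => v.2).
Proof. exact: measurable_snd. Qed.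

Let mxi i : measurable_fun setT (fun w => x w i 0).
Proof. exact: measurableT_comp (mfst i) mxy. Qed.

(** Each observation has the law of the pair, by the first half of the i.i.d.
    hypothesis. *)
Lemma mean_sample (h : 'cV[R]_p * R -> R) k : measurable_fun setT h ->
  L1 P (fun w => h (x w, y w)) ->
  L1 P' (fun w => h (Z k w)) /\ mean P' (fun w => h (Z k w)) = mean P (fun w => h (x w, y w)).
Proof.
move=> mh Lh; have lawZ := iidZ.1 k; split; first exact: (L1_law mxy (mZ k) lawZ mh Lh).
exact: (mean_law mxy (mZ k) lawZ mh Lh).
Qed.

Let n_gt0 : 0 < n%:R :> R. Proof. by rewrite ltr0n. Qed.

Definition max_norm (B : {vspace 'cV[R]_p}) w : R :=
  \big[Num.max/0]_(i < n) norm2 (orthproj B (Z i w).1) ^+ 2.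

Lemma max_norm_ge B w i : norm2 (orthproj B (Z i w).1) ^+ 2 <= max_norm B w.
Proof. by rewrite /max_norm; exact: (le_bigmax _ (fun i => norm2 (orthproj B (Z i w).1) ^+ 2)). Qed.

Lemma max_norm_ge0 B w : 0 <= max_norm B w.
Proof. by rewrite /max_norm; elim/big_rec: _ => // i t _ t0; rewrite le_max t0 orbT. Qed.

Lemma max_norm_le B w c : 0 <= c -> (forall i, norm2 (orthproj B (Z i w).1) ^+ 2 <= c) ->
  max_norm B w <= c.
Proof.
by move=> c0 h; rewrite /max_norm; elim/big_ind: _ => // a b ac bc; rewrite ge_max ac bc.
Qed.

Lemma max_norm_le_sum B w : max_norm B w <= \sum_i norm2 (orthproj B (Z i w).1) ^+ 2.
Proof.
apply: max_norm_le => [|i]; first by rewrite sumr_ge0// => i _; rewrite sqr_ge0.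
by rewrite (bigD1 i)//= lerDl sumr_ge0// => j _; rewrite sqr_ge0.
Qed.

Lemma measurable_orthproj B (i : 'I_p) :
  measurable_fun setT (fun v : 'cV[R]_p => orthproj B v i 0).
Proof.
rewrite [X in measurable_fun _ X](_ : _ = fun v : 'cV[R]_p => (projmx B *m v) i 0); last first.
  by apply/funext => v; rewrite projmxE.
by apply: (measurable_mulmx (F := fun=> projmx B) (G := id)) => k l //; exact: measurable_entry.
Qed.

Lemma measurable_fst_mem (W : {vspace 'cV[R]_p}) :
  measurable [set v : 'cV[R]_p * R | v.1 \in W].
Proof.
pose h (v : 'cV[R]_p * R) := norm2 (v.1 - orthproj W v.1).
rewrite (_ : [set v | _] = setT `&` h @^-1` [set 0]).
  apply: (_ : measurable_fun setT h) => //.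
  apply: measurable_norm2 => i.
  rewrite [X in measurable_fun _ X](_ : _ = fun v : 'cV[R]_p * R =>
    v.1 i 0 - orthproj W v.1 i 0).
    apply: measurable_funB => //.
    exact: measurableT_comp (measurable_orthproj _ i) measurable_fst.
  by apply/funext => v; rewrite !mxE.
apply/seteqP; split=> [v /= vr|v [_ /norm2_eq0/eqP]] /=.
  by split=> //; rewrite /h orthproj_id// subrr norm2_0.
by rewrite subr_eq0 => /eqP ->; exact: orthproj_mem.
Qed.

Lemma measurable_proj_norm B : measurable_fun setT
  (fun v : 'cV[R]_p * R => norm2 (orthproj B v.1) ^+ 2).
Proof.
apply: measurable_funX; apply: measurable_norm2 => i.
exact: measurableT_comp (measurable_orthproj B i) measurable_fst.
Qed.

Lemma L1_proj_norm B : L1 P (fun w => norm2 (orthproj B (x w)) ^+ 2).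
Proof.
apply: (L1_le (g := fun w => \sum_i x w i 0 ^+ 2)).
- exact: measurableT_comp (measurable_proj_norm B) mxy.
- exact: L1_sum.
move=> w; rewrite ger0_norm ?exprn_ge0 ?norm2_ge0//.
apply: (@le_trans _ _ (norm2 (x w) ^+ 2)).
  by rewrite lerXn2r ?nnegrE ?norm2_ge0// norm2_orthproj.
by rewrite norm2_sqr dotE.
Qed.

Lemma L1_sample_proj_norm B k : L1 P' (fun w => norm2 (orthproj B (Z k w).1) ^+ 2).
Proof. exact: (mean_sample k (measurable_proj_norm B) (L1_proj_norm B)).1. Qed.

Lemma L1_max_norm B : L1 P' (max_norm B).
Proof.
apply: (L1_le (g := fun w => \sum_i norm2 (orthproj B (Z i w).1) ^+ 2)).
- rewrite /max_norm; elim: (index_enum 'I_n) => [|i s IH].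
    by under eq_fun do rewrite big_nil; exact: measurable_cst.
  under eq_fun do rewrite big_cons; apply: measurable_maxr => //.
  exact: L1_measurable (L1_sample_proj_norm B i).
- by apply: L1_sum => i; exact: L1_sample_proj_norm.
by move=> w; rewrite ger0_norm ?max_norm_ge0 ?max_norm_le_sum.
Qed.

(** Cauchy-Schwarz for the mean of a geometric mean. *)
Lemma mean_sqrtM (f g : T' -> R) : L1 P' f -> L1 P' g ->
  (forall w, 0 <= f w) -> (forall w, 0 <= g w) ->
  L1 P' (fun w => Num.sqrt (f w * g w)) /\
  mean P' (fun w => Num.sqrt (f w * g w)) <= Num.sqrt (mean P' f * mean P' g).
Proof.
move=> Lf Lg f0 g0.
have e : (fun w => Num.sqrt (f w * g w)) = fun w => Num.sqrt (f w) * Num.sqrt (g w).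
  by apply/funext => w; rewrite sqrtrM.
have ef : f = fun w => Num.sqrt (f w) ^+ 2 by apply/funext => w; rewrite sqr_sqrtr.
have eg : g = fun w => Num.sqrt (g w) ^+ 2 by apply/funext => w; rewrite sqr_sqrtr.
have ms := @measurable_sqrt R _ T'.
have mf := ms _ (L1_measurable Lf); have mg := ms _ (L1_measurable Lg).
rewrite e; rewrite ef in Lf; rewrite eg in Lg; split; first exact: L1_mul.
rewrite [in X in _ <= X]ef [in X in _ <= X]eg.
have := mean_cauchy_schwarz mf mg Lf Lg.
set a := mean _ _; set b := mean _ _ * mean _ _ => ab.
have b0 : 0 <= b by rewrite mulr_ge0// mean_ge0// => w; exact: sqr_ge0.
have a0 : 0 <= a by apply: mean_ge0 => w; rewrite mulr_ge0 ?sqrtr_ge0.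
by rewrite -(@ler_pXn2r _ 2) ?nnegrE ?sqrtr_ge0// sqr_sqrtr.
Qed.

Definition Hvec (v : 'cV[R]_p * R) : 'cV[R]_p := v.2 *: v.1.
Definition Hmat (v : 'cV[R]_p * R) : 'M[R]_p := v.1 *m v.1^T.

Let mHvec i j : measurable_fun setT (fun v => Hvec v i j).
Proof.
rewrite [X in measurable_fun _ X](_ : _ = fun v : 'cV[R]_p * R => v.2 * v.1 i 0).
  by apply: measurable_funM.
by apply/funext => v; rewrite mxE !ord1.
Qed.

Let mHmat i j : measurable_fun setT (fun v => Hmat v i j).
Proof.
rewrite [X in measurable_fun _ X](_ : _ = fun v : 'cV[R]_p * R => v.1 i 0 * v.1 j 0).
  by apply: measurable_funM.
by apply/funext => v; rewrite mxE big_ord1 mxE.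
Qed.

Lemma L1_Hvec i j : L1 P (fun w => Hvec (x w, y w) i j).
Proof.
apply: eq_L1 (L1_mul my (mxi i) Ly (Lx i)) => w.
by rewrite mxE !ord1.
Qed.

Lemma L1_Hmat i j : L1 P (fun w => Hmat (x w, y w) i j).
Proof.
apply: eq_L1 (L1_mul (mxi i) (mxi j) (Lx i) (Lx j)) => w.
by rewrite mxE big_ord1 mxE.
Qed.

Let L1Z_Hvec k i j := (mean_sample k (mHvec i j) (L1_Hvec i j)).1.
Let L1Z_Hmat k i j := (mean_sample k (mHmat i j) (L1_Hmat i j)).1.

Lemma sigmav_hat_sum w : sigmav_hat Z w = n%:R^-1 *: \sum_k Hvec (Z k w).
Proof.
rewrite /sigmav_hat; congr (_ *: _); apply/colP => i; rewrite !mxE summxE.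
by apply: eq_bigr => k _; rewrite !mxE mulrC.
Qed.

Lemma Sigma_hat_sum w : Sigma_hat Z w = n%:R^-1 *: \sum_k Hmat (Z k w).
Proof.
rewrite /Sigma_hat; congr (_ *: _); apply/matrixP => i j; rewrite !mxE summxE.
by apply: eq_bigr => k _; rewrite !mxE big_ord1 !mxE.
Qed.

Let e0 : {ffun 'I_n -> bool} := [ffun=> false].

Let signed_sum0 a b (H : 'cV[R]_p * R -> 'M[R]_(a, b)) w :
  signed_sum Z H e0 w = \sum_k H (Z k w).
Proof. by apply: eq_bigr => k _; rewrite ffunE expr0 scale1r. Qed.

Let mean_signed_sum0 a b (H : 'cV[R]_p * R -> 'M[R]_(a, b)) :
  (forall i j, measurable_fun setT (fun v => H v i j)) ->
  (forall i j, L1 P (fun w => H (x w, y w) i j)) ->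
  mean_mx P' (signed_sum Z H e0) = n%:R *: \matrix_(i, j) mean P (fun w => H (x w, y w) i j).
Proof.
move=> mH LH; apply/matrixP => i j; rewrite !mxE.
transitivity (\sum_(k < n) mean P' (fun w => H (Z k w) i j)).
  rewrite -mean_sum; last by move=> k; exact: (mean_sample k (mH i j) (LH i j)).1.
  by apply: eq_mean => w; rewrite signed_sum0 summxE.
rewrite (eq_bigr (fun=> mean P (fun w => H (x w, y w) i j))); last first.
  by move=> k _; exact: (mean_sample k (mH i j) (LH i j)).2.
by rewrite sumr_const card_ord mulr_natl.
Qed.

Lemma sigmavE : sigmav P x y = \matrix_(i, j) mean P (fun w => Hvec (x w, y w) i j).
Proof.
apply/colP => i; rewrite !mxE; apply: eq_mean => w.
by rewrite mxE mulrC.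
Qed.

Lemma SigmaE : Sigma P x = \matrix_(i, j) mean P (fun w => Hmat (x w, y w) i j).
Proof.
apply/matrixP => i j; rewrite !mxE; apply: eq_mean => w.
by rewrite mxE big_ord1 mxE.
Qed.

Let dev_vec w : signed_sum Z Hvec e0 w - mean_mx P' (signed_sum Z Hvec e0) =
  n%:R *: (sigmav_hat Z w - sigmav P x y).
Proof.
rewrite mean_signed_sum0//; last exact: L1_Hvec.
rewrite -sigmavE signed_sum0 scalerBr sigmav_hat_sum scalerA divff ?scale1r//.
by rewrite gt_eqF.
Qed.

Let dev_mat w : signed_sum Z Hmat e0 w - mean_mx P' (signed_sum Z Hmat e0) =
  n%:R *: (Sigma_hat Z w - Sigma P x).
Proof.
rewrite mean_signed_sum0//; last exact: L1_Hmat.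
rewrite -SigmaE signed_sum0 scalerBr Sigma_hat_sum scalerA divff ?scale1r//.
by rewrite gt_eqF.
Qed.

Lemma L1_sigmav_dev i j : L1 P' (fun w => (sigmav_hat Z w - sigmav P x y) i j).
Proof.
apply: eq_L1 (L1B (L1Zl n%:R^-1 (L1_sum (index_enum 'I_n) (fun k => L1Z_Hvec k i j)))
  (L1_cst P' (sigmav P x y i j))) => w.
by rewrite [RHS]mxE sigmav_hat_sum !mxE summxE.
Qed.

Lemma L1_Sigma_hat i j : L1 P' (fun w => Sigma_hat Z w i j).
Proof.
apply: eq_L1 (L1Zl n%:R^-1 (L1_sum (index_enum 'I_n) (fun k => L1Z_Hmat k i j))) => w.
by rewrite Sigma_hat_sum !mxE summxE.
Qed.

Lemma L1_Sigma_dev i j : L1 P' (fun w => (Sigma_hat Z w - Sigma P x) i j).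
Proof.
apply: eq_L1 (L1B (L1_Sigma_hat i j) (L1_cst P' (Sigma P x i j))) => w.
by rewrite [RHS]mxE; congr (_ + _); rewrite [RHS]mxE.
Qed.

Lemma L1_norm2_dev : L1 P' (fun w => norm2 (sigmav_hat Z w - sigmav P x y)).
Proof. exact: (L1_dual_norm dual_norm_norm2 L1_sigmav_dev). Qed.

Lemma L1_opnorm_dev : L1 P' (fun w => opnorm (Sigma_hat Z w - Sigma P x)).
Proof. exact: (L1_dual_norm dual_norm_opnorm L1_Sigma_dev). Qed.

Lemma L1_opnorm_hat : L1 P' (fun w => opnorm (Sigma_hat Z w)).
Proof. exact: (L1_dual_norm dual_norm_opnorm L1_Sigma_hat). Qed.

Let two_n : 0 < (2 ^ n)%:R :> R. Proof. by rewrite ltr0n expn_gt0. Qed.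

(** Symmetrization holds for every choice of signs, so its right-hand side may
    be averaged over them; a pointwise bound of the average is then enough. *)
Let average_signs (D : R) (F : {ffun 'I_n -> bool} -> T' -> R) (G : T' -> R) c :
  (forall e, n%:R * D <= 2 * mean P' (F e)) -> (forall e, L1 P' (F e)) -> L1 P' G ->
  (forall e w, 0 <= F e w) -> (forall w, 0 <= G w) -> 0 <= c ->
  {ae P', forall w, \sum_e F e w <= (2 ^ n)%:R * (c * G w)} ->
  n%:R * D <= 2 * (c * mean P' G).
Proof.
move=> hD LF LG F0 G0 c0 FG; rewrite -(ler_pM2l two_n).
apply: (@le_trans _ _ (2 * mean P' (fun w => \sum_e F e w))).
  have -> : (2 ^ n)%:R * (n%:R * D) = \sum_(e : {ffun 'I_n -> bool}) (n%:R * D).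
    by rewrite sumr_const card_signs -[RHS]mulr_natl.
  rewrite mean_sum// mulr_sumr.
  by apply: ler_sum => e _; exact: hD.
rewrite mulrCA ler_wpM2l// -meanZl// -meanZl; last exact: L1Zl.
apply: ae_le_mean => //.
- exact: L1_sum.
- by apply: L1Zl; exact: L1Zl.
- by move=> w; rewrite sumr_ge0.
- by move=> w; rewrite !mulr_ge0.
Qed.

(** Conditionally on the sample the signs only see the norms of y_i x_i; the
    factor x_i is replaced by the largest one, and y_i^2 averages. *)
Lemma sigmav_deviation :
  mean P' (fun w => norm2 (sigmav_hat Z w - sigmav P x y)) <=
  2 * Num.sqrt (mean P' (max_norm fullv) * mean P (fun w => y w ^+ 2) / n%:R).
Proof.
set D := mean P' _; set m := max_norm fullv.
have Lys k : L1 P' (fun w => (Z k w).2 ^+ 2) /\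
    mean P' (fun w => (Z k w).2 ^+ 2) = mean P (fun w => y w ^+ 2).
  by apply: (@mean_sample (fun v => v.2 ^+ 2) k _ Ly); exact: measurable_funX.
pose g w := \sum_(k < n) (Z k w).2 ^+ 2.
have Lg : L1 P' g by apply: L1_sum => k; case: (Lys k).
have g0 w : 0 <= g w by rewrite sumr_ge0// => k _; exact: sqr_ge0.
have mg : mean P' g = n%:R * mean P (fun w => y w ^+ 2).
  rewrite mean_sum; last by move=> k; case: (Lys k).
  rewrite (eq_bigr (fun=> mean P (fun w => y w ^+ 2))); last by move=> k _; case: (Lys k).
  by rewrite sumr_const card_ord mulr_natl.
have [LG hG] := mean_sqrtM (L1_max_norm fullv) Lg (max_norm_ge0 fullv) g0.
have hD e : n%:R * D <= 2 * mean P' (fun w => norm2 (signed_sum Z Hvec e w)).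
  apply: le_trans (symmetrization mZ iZ mHvec L1Z_Hvec dual_norm_norm2 e).
  rewrite /D -meanZl; last exact: L1_norm2_dev.
  rewrite le_eqVlt; apply/orP; left; apply/eqP; apply: eq_mean => w.
  by rewrite dev_vec norm2Z ger0_norm// ltW.
have := average_signs (c := 1) hD _ LG _ _ ler01.
have LF e : L1 P' (fun w => norm2 (signed_sum Z Hvec e w)).
  exact: (L1_dual_norm dual_norm_norm2 (L1_signed_sum L1Z_Hvec e)).
move=> /(_ LF (fun e w => norm2_ge0 _) (fun w => sqrtr_ge0 _)); rewrite !mul1r => h.
have {}h : n%:R * D <= 2 * mean P' (fun w => Num.sqrt (max_norm fullv w * g w)).
  apply: h; apply: aeW => w; rewrite mul1r.
  apply: le_trans (rademacher_norm2 (fun k => Hvec (Z k w))) _.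
  rewrite ler_wpM2l// ler_wsqrtr// mulr_sumr; apply: ler_sum => k _.
  rewrite dotZl dotZr mulrA -expr2 mulrC ler_wpM2r ?sqr_ge0//.
  by rewrite -norm2_sqr -[(Z k w).1](orthproj_id (memvf _)); exact: max_norm_ge.
rewrite -(ler_pM2l n_gt0) (le_trans h)// mulrCA ler_wpM2l//.
apply: le_trans hG _; rewrite mg.
have -> : mean P' (max_norm fullv) * (n%:R * mean P (fun w => y w ^+ 2)) =
    n%:R ^+ 2 * (mean P' m * mean P (fun w => y w ^+ 2) / n%:R).
  by rewrite /m; field; rewrite gt_eqF.
by rewrite sqrtrM ?sqr_ge0// sqrtr_sqr ger0_norm// ltW.
Qed.

(** Conditionally on the sample the Rademacher bound involves the norm of the
    sample moment matrix, which is at most that of the population plus the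
    deviation itself: hence an inequality with the deviation on both sides. *)
Lemma Sigma_deviation (k : nat) : (0 < k)%N -> (\rank (Sigma P x) <= 2 ^ k)%N ->
  {ae P, forall w, x w \in mxrange (Sigma P x)} ->
  mean P' (fun w => opnorm (Sigma_hat Z w - Sigma P x)) ^+ 2 <=
  64 * k%:R * mean P' (max_norm fullv) / n%:R *
    (opnorm (Sigma P x) + mean P' (fun w => opnorm (Sigma_hat Z w - Sigma P x))).
Proof.
move=> k0 rk xr; set D := mean P' _; set m := max_norm fullv.
have Zr : {ae P', forall w, forall i, (Z i w).1 \in mxrange (Sigma P x)}.
  apply: filter_forall => i.
  exact: ae_law mxy (mZ i) (iidZ.1 i) _ (measurable_fst_mem _) xr.
have [LG hG] := mean_sqrtM (L1_max_norm fullv) L1_opnorm_hat (max_norm_ge0 fullv)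
  (fun w => opnorm_ge0 _).
have hD e : n%:R * D <= 2 * mean P' (fun w => opnorm (signed_sum Z Hmat e w)).
  apply: le_trans (symmetrization mZ iZ mHmat L1Z_Hmat dual_norm_opnorm e).
  rewrite /D -meanZl; last exact: L1_opnorm_dev.
  apply: le_mean.
  - by apply: L1Zl; exact: L1_opnorm_dev.
  - apply: eq_L1 (L1_dual_norm dual_norm_opnorm (F := fun w => n%:R *: (Sigma_hat Z w - Sigma P x)) _).
      by move=> w; rewrite dev_mat.
    by move=> i j; apply: eq_L1 (L1Zl n%:R (L1_Sigma_dev i j)) => w; rewrite [RHS]mxE.
  move=> w; rewrite dev_mat; set A := _ - _.
  have ni : 0 <= n%:R^-1 :> R by rewrite invr_ge0 ltW.
  have := opnormZ (n%:R *: A) ni.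
  by rewrite scalerA mulVf ?gt_eqF// scale1r ler_pdivlMl.
pose c : R := 2 * Num.sqrt (4 * k%:R * n%:R).
have c0 : 0 <= c by rewrite mulr_ge0 ?sqrtr_ge0.
have := average_signs (c := c) hD _ LG _ _ c0.
have LF e : L1 P' (fun w => opnorm (signed_sum Z Hmat e w)).
  exact: (L1_dual_norm dual_norm_opnorm (L1_signed_sum L1Z_Hmat e)).
move=> /(_ LF (fun e w => opnorm_ge0 _) (fun w => sqrtr_ge0 _)) h.
have {}h : n%:R * D <= 2 * (c * mean P' (fun w =>
    Num.sqrt (max_norm fullv w * opnorm (Sigma_hat Z w)))).
  apply: h; apply: filterS Zr => w Zr.
  have zm i : dot (Z i w).1 (Z i w).1 <= m w.
    by rewrite -norm2_sqr -[(Z i w).1](orthproj_id (memvf _)); exact: max_norm_ge.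
  have := rademacher_range k0 rk (max_norm_ge0 fullv w) zm Zr.
  move=> /le_trans; apply; rewrite ler_wpM2l// /c -[X in _ <= X]mulrA ler_wpM2l//.
  rewrite -sqrtrM ?mulr_ge0// ler_wsqrtr// -[X in _ <= X]mulrA ler_wpM2l ?mulr_ge0//.
  rewrite [X in _ <= X]mulrCA ler_wpM2l ?max_norm_ge0//.
  have -> : \sum_i (Z i w).1 *m (Z i w).1^T = n%:R *: Sigma_hat Z w.
    by rewrite Sigma_hat_sum scalerA divff ?scale1r// gt_eqF.
  by apply: opnormZ; rewrite ltW.
have E1 : mean P' (fun w => opnorm (Sigma_hat Z w)) <= opnorm (Sigma P x) + D.
  rewrite -(mean_cst P' (opnorm (Sigma P x))) /D -meanD//; last 2 first.
  - exact: L1_cst.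
  - exact: L1_opnorm_dev.
  apply: le_mean; [exact: L1_opnorm_hat|apply: L1D; [exact: L1_cst|exact: L1_opnorm_dev]|].
  move=> w; rewrite -[X in opnorm X <= _](subrK (Sigma P x)) addrC.
  exact: opnormD.
have D0 : 0 <= D by apply: mean_ge0 => w; exact: opnorm_ge0.
have m0 : 0 <= mean P' m by apply: mean_ge0 => w; exact: max_norm_ge0.
have s0 : 0 <= opnorm (Sigma P x) + D by rewrite addr_ge0 ?opnorm_ge0.
have {}h : n%:R * D <= 2 * (c * Num.sqrt (mean P' m * (opnorm (Sigma P x) + D))).
  apply: le_trans h _; rewrite ler_wpM2l// ler_wpM2l// (le_trans hG)//.
  by rewrite ler_wsqrtr// ler_wpM2l.
have : (n%:R * D) ^+ 2 <= (2 * (c * Num.sqrt (mean P' m * (opnorm (Sigma P x) + D)))) ^+ 2.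
  by rewrite lerXn2r ?nnegrE ?mulr_ge0 ?sqrtr_ge0// ltW.
rewrite !exprMn !sqr_sqrtr ?mulr_ge0// => h2.
rewrite -(ler_pM2l (exprn_gt0 2 n_gt0)) (le_trans h2)//.
rewrite le_eqVlt; apply/orP; left; apply/eqP.
by rewrite /m; field; rewrite gt_eqF.
Qed.

End concentration.

(** * Second moments of random vectors *)

Section second_moments.
Context {R : realType} {p : nat}.
Context {d : measure_display} {T : measurableType d} (P : probability T R).
Implicit Types (u v : T -> 'cV[R]_p) (y : T -> R).

(** Square integrability, together with the measurability that makes products
    integrable. *)
Definition L2 (f : T -> R) := measurable_fun setT f /\ L1 P (fun w => f w ^+ 2).

Definition L2v u := forall i, L2 (fun w => u w i 0).

Lemma L2_L1 f : L2 f -> L1 P f.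
Proof. by case=> mf Lf; exact: L1_of_sq. Qed.

Lemma L2_mul f g : L2 f -> L2 g -> L1 P (fun w => f w * g w).
Proof. by case=> mf Lf [mg Lg]; exact: L1_mul. Qed.

Lemma L2Z c f : L2 f -> L2 (fun w => c * f w).
Proof.
case=> mf Lf; split; first exact: measurable_funM.
by apply: eq_L1 (L1Zl (c ^+ 2) Lf) => w; rewrite exprMn.
Qed.

Lemma L2D f g : L2 f -> L2 g -> L2 (fun w => f w + g w).
Proof.
move=> Lf Lg; split; first exact: measurable_funD Lf.1 Lg.1.
apply: eq_L1 (L1D (L1D Lf.2 (L1Zl 2 (L2_mul Lf Lg))) Lg.2) => w.
by rewrite sqrrD mulr_natl.
Qed.

Lemma L2_sum (I : Type) (r : seq I) (F : I -> T -> R) : (forall i, L2 (F i)) ->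
  L2 (fun w => \sum_(i <- r) F i w).
Proof.
move=> LF; elim: r => [|i r IH].
  split; first by under eq_fun do rewrite big_nil; exact: measurable_cst.
  by apply: eq_L1 (L1_cst P 0) => w; rewrite big_nil expr0n.
have [mf Lf] := L2D (LF i) IH; split.
  by under eq_fun do rewrite big_cons.
by apply: eq_L1 Lf => w; rewrite big_cons.
Qed.

Lemma ae_eq_L2 f g : measurable_fun setT g -> L2 f -> {ae P, forall w, f w = g w} -> L2 g.
Proof.
move=> mg [mf Lf] fg; split=> //; apply: ae_eq_L1 Lf _.
  exact: measurable_funX.
by apply: filterS fg => w ->.
Qed.

Lemma L2v_square u : measurable_fun setT u -> square_integrable P u -> L2v u.
Proof.
move=> mu su i; have mi j : measurable_fun setT (fun w => u w j 0).
  exact: measurableT_comp (measurable_entry j 0) mu.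
split=> //; apply: (L1_le (g := fun w => norm2 (u w) ^+ 2)).
- exact: measurable_funX.
- apply: L1_ge0; [|by move=> w; exact: sqr_ge0|by rewrite -expectationE].
  by apply: measurable_funX; exact: measurable_norm2.
move=> w; rewrite ger0_norm ?sqr_ge0// -[leLHS]real_normK ?num_real//.
by rewrite lerXn2r ?nnegrE ?norm2_ge0 ?norm2_entry.
Qed.

Lemma L2v_mulmx (A : 'M[R]_p) u : L2v u -> L2v (fun w => A *m u w).
Proof.
move=> Lu i; have [mf Lf] := L2_sum (index_enum 'I_p) (fun k => L2Z (A i k) (Lu k)).
split; first by under eq_fun do rewrite mxE.
by apply: eq_L1 Lf => w; rewrite mxE.
Qed.

Lemma L2v_dot b u : L2v u -> L2 (fun w => dot b (u w)).
Proof.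
move=> Lu; have [mf Lf] := L2_sum (index_enum 'I_p) (fun k => L2Z (b k 0) (Lu k)).
split; first by under eq_fun do rewrite dotE.
by apply: eq_L1 Lf => w; rewrite dotE.
Qed.

Lemma mean_dot (b : 'cV[R]_p) u f : L2v u -> L2 f ->
  mean P (fun w => dot b (u w) * f w) = dot b (sigmav P u f).
Proof.
move=> Lu Lf; rewrite dotE -[LHS](eq_mean P (f := fun w => \sum_i b i 0 * (u w i 0 * f w))).
  rewrite mean_sum; last by move=> i; apply: L1Zl; exact: L2_mul.
  by apply: eq_bigr => i _; rewrite meanZl ?mxE//; exact: L2_mul.
by move=> w; rewrite dotE mulr_suml; apply: eq_bigr => i _; rewrite mulrA.
Qed.

Lemma crossmom_mulmxE u v (b : 'cV[R]_p) : L2v u -> L2v v ->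
  crossmom P u v *m b = sigmav P u (fun w => dot b (v w)).
Proof.
move=> Lu Lv; apply/matrixP => i j; rewrite !mxE !ord1.
rewrite -[RHS](eq_mean P (f := fun w => \sum_k b k 0 * (u w i 0 * v w k 0))).
  rewrite mean_sum; last by move=> k; apply: L1Zl; exact: L2_mul.
  by apply: eq_bigr => k _; rewrite mxE meanZl; [exact: mulrC|exact: L2_mul].
by move=> w; rewrite dotE mulr_sumr; apply: eq_bigr => k _; rewrite mulrCA.
Qed.

(** Moment matrices are handled through their bilinear forms. *)
Lemma dot_crossmom a b u v : L2v u -> L2v v ->
  dot a (crossmom P u v *m b) = mean P (fun w => dot a (u w) * dot b (v w)).
Proof. by move=> Lu Lv; rewrite crossmom_mulmxE// mean_dot//; exact: L2v_dot. Qed.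

Lemma sigmav_mulmx (A : 'M[R]_p) u f : L2v u -> L2 f ->
  sigmav P (fun w => A *m u w) f = A *m sigmav P u f.
Proof.
move=> Lu Lf; apply/matrixP => i j; rewrite !ord1 -[RHS](dot_delta _ i) dot_mulmxr -mean_dot// mxE.
by apply: eq_mean => w; rewrite -dot_mulmxr dot_delta.
Qed.

Lemma crossmom_mulmx (A B : 'M[R]_p) u v : L2v u -> L2v v ->
  crossmom P (fun w => A *m u w) (fun w => B *m v w) = A *m crossmom P u v *m B^T.
Proof.
move=> Lu Lv; apply: mulmx_eqP => b; rewrite crossmom_mulmxE; try exact: L2v_mulmx.
rewrite sigmav_mulmx//; last by apply: L2v_dot; exact: L2v_mulmx.
rewrite -!mulmxA [in RHS]crossmom_mulmxE//; congr (_ *m _).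
apply/matrixP => i j; rewrite !mxE; apply: eq_mean => w.
by rewrite dot_mulmxr.
Qed.

Lemma Sigma_psd u : L2v u -> psd (Sigma P u).
Proof.
move=> Lu; split.
  by apply/matrixP => i j; rewrite !mxE; apply: eq_mean => w; rewrite mulrC.
move=> b; rewrite dot_crossmom//; apply: mean_ge0 => w.
by rewrite -expr2 sqr_ge0.
Qed.

Lemma ae_sigmav u v f g : L2v u -> L2v v -> L2 f -> L2 g ->
  {ae P, forall w, u w = v w} -> {ae P, forall w, f w = g w} ->
  sigmav P u f = sigmav P v g.
Proof.
move=> Lu Lv Lf Lg uv fg; apply/matrixP => i j; rewrite !mxE; apply: ae_eq_mean.
- by apply: measurable_funM; [exact: (Lu i).1|exact: Lf.1].
- by apply: measurable_funM; [exact: (Lv i).1|exact: Lg.1].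
by apply: filterS2 uv fg => w -> ->.
Qed.

Lemma ae_crossmom u u' v v' : L2v u -> L2v u' -> L2v v -> L2v v' ->
  {ae P, forall w, u w = u' w} -> {ae P, forall w, v w = v' w} ->
  crossmom P u v = crossmom P u' v'.
Proof.
move=> Lu Lu' Lv Lv' uv uv'; apply/matrixP => i j; rewrite !mxE; apply: ae_eq_mean.
- by apply: measurable_funM; [exact: (Lu i).1|exact: (Lv j).1].
- by apply: measurable_funM; [exact: (Lu' i).1|exact: (Lv' j).1].
by apply: filterS2 uv uv' => w -> ->.
Qed.

Lemma proj_rvE B u : proj_rv B u = fun w => projmx B *m u w.
Proof. by apply/funext => w; rewrite /proj_rv projmxE. Qed.

Lemma Sigma_proj B u : L2v u ->
  Sigma P (proj_rv B u) = projmx B *m Sigma P u *m projmx B.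
Proof. by move=> Lu; rewrite proj_rvE /Sigma crossmom_mulmx// projmx_sym. Qed.

Lemma sigmav_proj B u f : L2v u -> L2 f ->
  sigmav P (proj_rv B u) f = projmx B *m sigmav P u f.
Proof. by move=> Lu Lf; rewrite proj_rvE sigmav_mulmx. Qed.

Lemma L2v_proj B u : L2v u -> L2v (proj_rv B u).
Proof. by move=> Lu; rewrite proj_rvE; exact: L2v_mulmx. Qed.

End second_moments.

(** * The latent factor model *)

Section latent_factor.
Context {R : realType} {p : nat}.
Context {d : measure_display} {T : measurableType d} (P : probability T R).
Variables (x q e : T -> 'cV[R]_p) (y eps : T -> R).
Variables (By : {vspace 'cV[R]_p}) (alpha : 'cV[R]_p) (sigma : R).
Hypotheses (mq : measurable_fun setT q).
Hypotheses (me : measurable_fun setT e) (mepsi : measurable_fun setT eps).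
Hypotheses (Lx : L2v P x) (Ly : L2 P y).
Hypothesis relevant : splits_relevance P x y By.
Hypothesis model : latent_factor_model P x y By q alpha eps sigma e.

Local Notation Sx := (Sigma P x).
Local Notation sxy := (sigmav P x y).
Local Notation Sq := (Sigma P q).
Local Notation sqy := (sigmav P q y).
Local Notation Se := (Sigma P e).
Local Notation Bc := (orthc_in (mxrange Sx) By).

Let Lq : L2v P q. Proof. exact: L2v_square mq (lfm_q_square model). Qed.
Let Le : L2v P e. Proof. exact: L2v_square me (lfm_e_square model). Qed.

Let Leps : L2 P eps.
Proof.
have L : L2 P (fun w => y w + -1 * dot alpha (q w)).
  by apply: L2D => //; apply: L2Z; exact: L2v_dot.
apply: ae_eq_L2 L _ => //; apply: filterS (lfm_y model) => w ->.
by rewrite -/(dot (q w) alpha) dotC; lra.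
Qed.

Let x_split : {ae P, forall w, x w = projmx By *m x w + projmx Bc *m x w}.
Proof.
apply: filterS2 (lfm_x model) (lfm_xy model) => w {1}-> <-.
by rewrite /proj_rv !projmxE.
Qed.

(** Both parts of x lie in the range of its second-moment matrix. *)
Lemma lfm_in_range : {ae P, forall w, x w \in mxrange Sx}.
Proof.
apply: filterS x_split => w ->; rewrite !projmxE memvD//.
  case: relevant => [+ _ _]; move/subvP; apply; exact: orthproj_mem.
by move: (orthproj_mem Bc (x w)); rewrite memv_cap => /andP[].
Qed.

(** The complement of the relevant subspace is uncorrelated with y. *)
Lemma sigmav_relevant : projmx By *m sxy = sxy.
Proof.
have E : sxy = sigmav P (fun w => (projmx By + projmx Bc) *m x w) y.
  apply: ae_sigmav => //; first exact: L2v_mulmx.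
    by apply: filterS x_split => w {1}->; rewrite mulmxDl.
  exact: aeW.
rewrite {2}E sigmav_mulmx// mulmxDl.
case: relevant => [_ + _]; rewrite sigmav_proj// => ->.
by rewrite addr0.
Qed.

(** The complement is uncorrelated with the relevant part, so the relevant
    subspace is invariant under the second-moment matrix. *)
Lemma Sigma_relevant : Sx *m projmx By = Sigma P (proj_rv By x).
Proof.
have E : Sx = crossmom P (fun w => (projmx By + projmx Bc) *m x w) (fun w => 1%:M *m x w).
  apply: ae_crossmom => //; try exact: L2v_mulmx.
    by apply: filterS x_split => w {1}->; rewrite mulmxDl.
  by apply: aeW => w; rewrite mul1mx.
rewrite Sigma_proj// {1}E crossmom_mulmx// trmx1 mulmx1 mulmxDl mulmxDl -/(Sigma P x).
case: relevant => [_ _ +]; rewrite !proj_rvE crossmom_mulmx// projmx_sym => ->.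
by rewrite addr0.
Qed.

Let mean_entry (u : T -> 'cV[R]_p) i : L2v P u -> centered P u -> mean P (fun w => u w i 0) = 0.
Proof. by move=> Lu cu; rewrite /mean cu. Qed.

Let mean_eps : mean P eps = 0.
Proof. by rewrite /mean (lfm_eps_centered model). Qed.

Let indep := lfm_independent model.

Let indep_qe A B : measurable A -> measurable B ->
  P (q @^-1` A `&` e @^-1` B) = (P (q @^-1` A) * P (e @^-1` B))%E.
Proof.
move=> mA mB; have := indep mA mB (@measurableT _ R).
by rewrite preimage_setT setIT probability_setT mule1.
Qed.

Let indep_eeps A B : measurable A -> measurable B ->
  P (e @^-1` A `&` eps @^-1` B) = (P (e @^-1` A) * P (eps @^-1` B))%E.
Proof.
move=> mA mB; have := indep (@measurableT _ 'cV[R]_p) mA mB.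
by rewrite preimage_setT setTI probability_setT mul1e.
Qed.

Let cross_qe : crossmom P q e = 0.
Proof.
apply/matrixP => i j; rewrite !mxE.
rewrite (mean_mul_independent mq me indep_qe (measurable_entry i 0) (measurable_entry j 0)).
- by rewrite [mean P ((fun M : 'cV[R]_p => M j 0) \o e)](mean_entry _ Le (lfm_e_centered model)) mulr0.
- exact: (L2_L1 (Lq i)).
- exact: (L2_L1 (Le j)).
Qed.

Let cross_eq : crossmom P e q = 0.
Proof.
have <- : (crossmom P q e)^T = crossmom P e q.
  by apply/matrixP => i j; rewrite !mxE; apply: eq_mean => w; rewrite mulrC.
by rewrite cross_qe trmx0.
Qed.

Let cross_ey : sigmav P e y = 0.
Proof.
have -> : sigmav P e y = sigmav P e (fun w => dot alpha (q w) + eps w).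
  apply: ae_sigmav => //; first by apply: L2D => //; exact: L2v_dot.
    exact: aeW.
  by apply: filterS (lfm_y model) => w ->; rewrite -/(dot (q w) alpha) dotC.
apply/matrixP => i j; rewrite !mxE.
rewrite -[LHS](eq_mean P (f := fun w => e w i 0 * dot alpha (q w) + e w i 0 * eps w)); last first.
  by move=> w; rewrite mulrDr.
rewrite meanD; [|by apply: L2_mul => //; exact: L2v_dot|exact: L2_mul].
rewrite (mean_mul_independent me mepsi indep_eeps (measurable_entry i 0) (@measurable_id _ _ _)).
- rewrite [mean P (id \o eps)]mean_eps mulr0 addr0.
  have := crossmom_mulmxE alpha Le Lq; rewrite cross_eq mul0mx => /matrixP/(_ i 0).
  by rewrite !mxE.
- exact: (L2_L1 (Le i)).
- exact: (L2_L1 Leps).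
Qed.

Let z w := 1%:M *m q w + sigma%:M *m e w.

Let Lz' : L2v P z.
Proof.
move=> i; have [mf Lf] := L2D (L2v_mulmx 1%:M Lq i) (L2v_mulmx sigma%:M Le i).
by split; [under eq_fun do rewrite mxE|apply: eq_L1 Lf => w; rewrite [in RHS]mxE].
Qed.

Let proj_model : {ae P, forall w, projmx By *m x w = z w}.
Proof.
by apply: filterS (lfm_xy model) => w h; rewrite /z mul1mx mul_scalar_mx -h projmxE.
Qed.

(** Independence kills the cross moments of the latent part and the noise. *)
Lemma Sigma_latent : Sigma P (proj_rv By x) = Sq + sigma ^+ 2 *: Se.
Proof.
apply: mulmx_eqP => b; rewrite proj_rvE.
have Lz : L2v P (fun w => projmx By *m x w) by exact: L2v_mulmx.
rewrite crossmom_mulmxE//.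
have -> : sigmav P (fun w => projmx By *m x w) (fun w => dot b (projmx By *m x w)) =
    sigmav P z (fun w => dot b (z w)).
  apply: ae_sigmav => //; try exact: L2v_dot.
  by apply: filterS proj_model => w ->.
apply/matrixP => i j; rewrite {j}ord1 -[LHS]dot_delta -[RHS]dot_delta -mean_dot//; last exact: L2v_dot.
have E w : dot (delta_mx i 0) (z w) * dot b (z w) =
    dot (delta_mx i 0) (q w) * dot b (q w) + sigma * (dot (delta_mx i 0) (q w) * dot b (e w))
    + (sigma * (dot (delta_mx i 0) (e w) * dot b (q w))
      + sigma ^+ 2 * (dot (delta_mx i 0) (e w) * dot b (e w))).
  by rewrite /z mul1mx mul_scalar_mx !dotDr !dotZr; ring.
have L u v c : L2v P u -> L2v P v -> L1 P (fun w => dot c (u w) * dot b (v w)).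
  by move=> Lu Lv; apply: L2_mul; exact: L2v_dot.
rewrite (eq_mean P E) !meanD ?meanZl; do 20? [exact: L | apply: L1Zl | apply: L1D].
rewrite -!dot_crossmom// cross_qe cross_eq !mul0mx dot0r !mulr0 addr0 add0r.
by rewrite mulmxDl dotDr -scalemxAl dotZr.
Qed.

(** The noise e is uncorrelated with q and with the residual, hence with y. *)
Lemma sigmav_latent : sxy = sqy.
Proof.
rewrite -sigmav_relevant -sigmav_mulmx//.
rewrite (ae_sigmav (L2v_mulmx _ Lx) Lz' Ly Ly proj_model); last exact: aeW.
apply/matrixP => i j; rewrite {j}ord1 -[LHS]dot_delta -[RHS]dot_delta -!mean_dot//.
have E w : dot (delta_mx i 0) (z w) * y w =
    dot (delta_mx i 0) (q w) * y w + sigma * (dot (delta_mx i 0) (e w) * y w).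
  by rewrite /z mul1mx mul_scalar_mx !dotDr !dotZr; ring.
have L u c : L2v P u -> L1 P (fun w => dot c (u w) * y w).
  by move=> Lu; apply: L2_mul => //; exact: L2v_dot.
rewrite (eq_mean P E) meanD ?meanZl; do 20? [exact: L | apply: L1Zl | apply: L1D].
by rewrite [X in sigma * X]mean_dot// cross_ey dot0r mulr0 addr0.
Qed.

(** The largest eigenvalue of the noise is 1.  The trace, unlike the matrix, is
    bounded in terms of p only, which lets the constant depend on the latent
    moments alone. *)
Lemma Se_trace : \tr Se <= p%:R.
Proof.
have [sS _] := Sigma_psd Le.
apply: le_trans (mxtrace_le_head sS) _; rewrite -[leRHS]mulr1 ler_wpM2l//.
by move: (lfm_e_norm model); rewrite /eigval/= nth0 => ->.
Qed.

Lemma Sq_psd : psd Sq. Proof. exact: Sigma_psd. Qed.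
Lemma Se_psd : psd Se. Proof. exact: Sigma_psd. Qed.

End latent_factor.

(** * The Moore-Penrose inverse and the latent least-squares coefficients *)

Section moore_penrose.
Context {R : realType} {p : nat}.
Implicit Types (A S : 'M[R]_p) (u v : 'cV[R]_p).

(** A symmetric matrix is invertible on its range: compress any generalized
    inverse to the range. *)
Lemma mpinvP A : A^T = A -> is_mpinv A (mpinv A).
Proof.
move=> sA; apply: (@xgetPex _ 0 [set S | is_mpinv A S]).
pose Pi := projmx (mxrange A).
have APi : A *m Pi = A by apply: mulmx_eqP => u; rewrite -mulmxA projmxE orthproj_mxrange.
have sPi : Pi^T = Pi := projmx_sym _.
have PiA : Pi *m A = A by rewrite -[LHS]trmxK trmx_mul sPi sA APi.
have ginv G : A *m G *m A = A -> Pi *m G *m A = Pi.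
  move=> AGA; apply: mulmx_eqP => u; apply/eqP; rewrite -subr_eq0; apply/eqP.
  apply: (range_ker sA).
    by rewrite -!mulmxA !projmxE memvB// orthproj_mem.
  by rewrite mulmxBr !mulmxA APi AGA subrr.
have [G AGA] : exists G, A *m G *m A = A by exists (pinvmx A); rewrite mulmxKpV.
have AGtA : A *m G^T *m A = A.
  by have := congr1 trmx AGA; rewrite !trmx_mul sA mulmxA.
have E1 := ginv _ AGA; have E2 := ginv _ AGtA.
have E3 : A *m G *m Pi = Pi.
  by have := congr1 trmx E2; rewrite !trmx_mul trmxK sA sPi mulmxA.
exists (Pi *m G *m Pi); split.
- by rewrite !mulmxA APi -mulmxA PiA AGA.
- rewrite -!mulmxA [A *m _]mulmxA APi mulmxA [A *m _]mulmxA E3.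
  by rewrite !mulmxA -[_ *m Pi *m Pi]mulmxA projmx_idem.
- by rewrite !mulmxA APi E3 sPi.
- by rewrite -!mulmxA PiA mulmxA E1 sPi.
Qed.

Lemma mulmx_mpinv A v : A^T = A -> v \in mxrange A -> A *m (mpinv A *m v) = v.
Proof.
move=> sA /mxrangeP[z ->]; have [AMA _ _ _] := mpinvP sA.
by rewrite !mulmxA AMA.
Qed.

Lemma mpinv_range A v : A^T = A -> mpinv A *m v \in mxrange A.
Proof.
move=> sA; have [_ MAM _ MA] := mpinvP sA; apply/mxrangeP.
by exists ((mpinv A)^T *m mpinv A *m v); rewrite -[in LHS]MAM -[in LHS]MA trmx_mul sA !mulmxA.
Qed.

(** Cauchy-Schwarz for the semi-inner product of S. *)
Lemma opnorm_quad_le S c : psd S -> 0 <= c -> (forall u, dot u (S *m u) <= c * dot u u) ->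
  opnorm S <= c.
Proof.
move=> [sS S0] c0 Sc; apply: opnorm_le_dual => // u v u1 v1.
have u1' : dot u u <= 1 by rewrite -norm2_sqr expr_le1// norm2_ge0.
have v1' : dot v v <= 1 by rewrite -norm2_sqr expr_le1// norm2_ge0.
have := S0 (u - v); rewrite mulmxBr !dotBl !dotBr.
have -> : dot v (S *m u) = dot u (S *m v) by rewrite (dot_sym _ _ sS) dotC.
have := Sc u; have := Sc v.
have : c * dot u u <= c by rewrite -[leRHS]mulr1 ler_wpM2l.
have : c * dot v v <= c by rewrite -[leRHS]mulr1 ler_wpM2l.
lra.
Qed.

(** A matrix whose columns are combinations of r vectors has rank r only if
    these vectors are independent. *)
Lemma krylov_self_rank S v : mxrange S = krylov S v (\rank S) -> independent_krylov S v (\rank S).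
Proof.
move=> rS c c0; set K := krylovmx S v (\rank S) in c0.
have [C SC] : exists C, S = K *m C.
  have ex j : exists c, col j S = K *m c.
    by apply/krylovP; rewrite -rS; apply/mxrangeP; exists (delta_mx j 0); rewrite colE.
  have /choice[f fE] := ex.
  exists (\matrix_(i, j) f j i 0); apply/matrixP => i j; rewrite mxE.
  by have /matrixP/(_ i 0) := fE j; rewrite !mxE => ->; apply: eq_bigr => k _; rewrite mxE.
have rK : (\rank S <= \rank K)%N by rewrite {1}SC; exact: mxrankM_maxl.
have fK : row_free K^T by rewrite -row_leq_rank mxrank_tr.
apply: trmx_inj; rewrite trmx0; apply: (row_free_inj fK).
by rewrite -trmx_mul c0 mul0mx trmx0.
Qed.

End moore_penrose.

(** * The constants of the perturbation bounds *)

Section constants.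
Context {R : realType}.

Lemma moment_dist_perturbation p (S : 'M[R]_p) (v : 'cV[R]_p) S' v' :
  0 < opnorm S -> 0 < norm2 v ->
  moment_dist S v S' v' <=
  ((p * p)%:R * opnorm S + p%:R * norm2 v) * perturbation S v S' v'.
Proof.
move=> S0 v0; set t := perturbation S v S' v'; rewrite mulrDl /moment_dist.
have tS : opnorm (S' - S) <= opnorm S * t.
  by rewrite mulrC -ler_pdivrMr// /t /perturbation le_max lexx.
have tv : norm2 (v' - v) <= norm2 v * t.
  by rewrite mulrC -ler_pdivrMr// /t /perturbation le_max lexx orbT.
apply: lerD.
  apply: (@le_trans _ _ (\sum_(i < p) \sum_(j < p) (opnorm S * t))).
    apply: ler_sum => i _; apply: ler_sum => j _; apply: le_trans tS.
    by have := opnorm_entry (S' - S) i j; rewrite !mxE.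
  by rewrite !sumr_const !card_ord -mulrnA -[X in X <= _]mulr_natl mulrA.
apply: (@le_trans _ _ (\sum_(i < p) (norm2 v * t))).
  apply: ler_sum => i _; apply: le_trans tv.
  by have := norm2_entry (v' - v) i; rewrite !mxE.
by rewrite sumr_const card_ord -[X in X <= _]mulr_natl mulrA.
Qed.

(** The bound that the sample constant has to satisfy: the factor
    |v| / |S| is a lower bound of the norm of the latent coefficients
    [norm2_sxy_le]. *)
Definition sample_bound p (S : 'M[R]_p) (v : 'cV[R]_p) s c : Prop :=
  forall S' v', psd S' -> perturbation S v S' v' <= c^-1 ->
  norm2 (pls S' v' s - pls S v s) <=
  c * perturbation S v S' v' * (norm2 v / opnorm S).

(** The constant is chosen, not computed; the value 1 serves the populations
    for which no such bound holds. *)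
Definition sample_constant p (S : 'M[R]_p) (v : 'cV[R]_p) s : R :=
  xget 1 [set c | 1 <= c /\ sample_bound S v s c].

Lemma sample_constant_ge1 p (S : 'M[R]_p) (v : 'cV[R]_p) s : 1 <= sample_constant S v s.
Proof. by rewrite /sample_constant; case: xgetP => [c _ [] | _]. Qed.

Lemma perturbation_ge0 p (S : 'M[R]_p) (v : 'cV[R]_p) S' v' : 0 <= perturbation S v S' v'.
Proof. by rewrite le_max divr_ge0// opnorm_ge0. Qed.

(** Three requirements are summed in the constant: it is at least 1, small
    perturbations stay in the Lipschitz neighbourhood, and it dominates the
    Lipschitz constant after normalization. *)
Lemma sample_constantP p (S : 'M[R]_p) (v : 'cV[R]_p) s : psd S -> gram S v s \in unitmx ->
  0 < opnorm S -> 0 < norm2 v -> sample_bound S v s (sample_constant S v s).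
Proof.
move=> pS gS S0 v0.
suff : [set c | 1 <= c /\ sample_bound S v s c] (sample_constant S v s) by case.
apply: xgetPex; have [eta [L [eta0 L0 Lip]]] := pls_lipschitz gS.
set D := (p * p)%:R * opnorm S + p%:R * norm2 v.
have D0 : 0 <= D by rewrite addr_ge0// mulr_ge0// ltW.
set rat := norm2 v / opnorm S; have rat0 : 0 < rat by rewrite divr_gt0.
pose c := 1 + D / eta + L * D / rat; have t1 : 0 <= D / eta by rewrite divr_ge0// ltW.
have t2 : 0 <= L * D / rat by apply: divr_ge0; [exact: mulr_ge0|exact: ltW].
have c1 : 1 <= c by rewrite /c -addrA lerDl addr_ge0.
have c0 : 0 < c by apply: lt_le_trans c1.
exists c; split=> // S' v' pS' tc; set t := perturbation S v S' v' in tc *.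
have t0 : 0 <= t := perturbation_ge0 _ _ _ _.
have mt : moment_dist S v S' v' <= D * t := moment_dist_perturbation S' v' S0 v0.
have Dtc : D * t <= eta.
  apply: (@le_trans _ _ (D * c^-1)); first by rewrite ler_wpM2l.
  by rewrite ler_pdivrMr// mulrC -ler_pdivrMr// /c; lra.
have [gS' h] := Lip S' v' pS' (le_trans mt Dtc).
rewrite (pls_closedE pS gS) (le_trans h)// (le_trans (ler_wpM2l L0 mt))//.
rewrite -/rat mulrA [X in _ <= X]mulrAC ler_wpM2r// -ler_pdivrMr// /c; lra.
Qed.

Definition latent_bound p (S : 'M[R]_p) (v : 'cV[R]_p) c : Prop :=
  forall s t E, (s <= \rank S)%N -> 0 <= t -> psd E -> \tr E <= p%:R ->
  t < eigval S (\rank S) / (2 * (c + 1)) ->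
  gram (S + t *: E) v s \in unitmx /\
  norm2 (pls (S + t *: E) v s - pls S v s) <=
  5 * (c + 1) * (t / eigval S (\rank S)) * norm2 (mpinv S *m v).

(** As for [sample_constant]; it depends on the latent moments alone, so one
    value must serve all noises and all numbers of steps. *)
Definition latent_constant p (S : 'M[R]_p) (v : 'cV[R]_p) : R :=
  xget 1 [set c | 1 <= c /\ latent_bound S v c].

Lemma latent_constant_ge1 p (S : 'M[R]_p) (v : 'cV[R]_p) : 1 <= latent_constant S v.
Proof. by rewrite /latent_constant; case: xgetP => [c _ [] | _]. Qed.

(** There are finitely many numbers of steps, and the constants for each of
    them are summed. *)
Lemma latent_constantP p (S : 'M[R]_p) (v : 'cV[R]_p) : psd S ->
  (forall s, (s <= \rank S)%N -> gram S v s \in unitmx) ->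
  0 < eigval S (\rank S) -> 0 < norm2 (mpinv S *m v) ->
  latent_bound S v (latent_constant S v).
Proof.
move=> pS gS lam0 a0; set r := \rank S; set lam := eigval S r; set a := norm2 _ in a0.
suff : [set c | 1 <= c /\ latent_bound S v c] (latent_constant S v) by case.
apply: xgetPex.
have ex (s : 'I_r.+1) : exists c, 0 <= c /\ forall t E, 0 <= t -> psd E -> \tr E <= p%:R ->
    c * t <= lam -> gram (S + t *: E) v s \in unitmx /\
    norm2 (pls (S + t *: E) v s - pls S v s) <= c * t / lam * a.
  have sr : (s <= r)%N by rewrite -ltnS.
  have [eta [L [eta0 L0 Lip]]] := pls_lipschitz (gS s sr).
  pose D : R := (p * p * p)%:R.
  have D0 : 0 <= D by [].
  have t1 : 0 <= D * lam / eta by rewrite divr_ge0 ?mulr_ge0// ltW.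
  have t2 : 0 <= L * D * lam / a by rewrite divr_ge0 ?mulr_ge0// ltW.
  exists (D * lam / eta + L * D * lam / a); split; first exact: addr_ge0.
  move=> t E t0 pE trE tl.
  have pSE : psd (S + t *: E) by apply: psdD => //; exact: psdZ.
  have mt : moment_dist S v (S + t *: E) v <= D * t.
    rewrite /moment_dist [X in _ + X]big1 ?addr0; last by move=> i _; rewrite subrr normr0.
    apply: (@le_trans _ _ (\sum_(i < p) \sum_(j < p) (t * p%:R))).
      apply: ler_sum => i _; apply: ler_sum => j _.
      rewrite !mxE addrAC subrr add0r normrM ger0_norm// ler_wpM2l//.
      by apply: le_trans trE; exact: psd_entry_le.
    by rewrite !sumr_const !card_ord -mulrnA -[X in X <= _]mulr_natl mulrCA mulrC /D !natrM.
  have Dt : D * t <= eta.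
    have : D * lam / eta * t <= lam.
      by apply: le_trans tl; rewrite mulrDl lerDl mulr_ge0.
    have -> : D * lam / eta * t = lam * (D * t / eta) by field; rewrite gt_eqF.
    by rewrite -[leRHS]mulr1 ler_pM2l// ler_pdivrMr// mul1r.
  have [gS' h] := Lip _ v pSE (le_trans mt Dt).
  split=> //; rewrite (pls_closedE pS (gS s sr)) (le_trans h)// (le_trans (ler_wpM2l L0 mt))//.
  have -> : (D * lam / eta + L * D * lam / a) * t / lam * a = L * (D * t) + D * t / eta * a.
    by field; rewrite !gt_eqF.
  by rewrite lerDl !mulr_ge0// ?invr_ge0// ltW.
have /choice[f fP] := ex.
pose c := 1 + \sum_s f s.
have c1 : 1 <= c by rewrite lerDl sumr_ge0// => s _; case: (fP s).
exists c; split=> // s t E sr t0 pE trE tl.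
have c0 : 0 < 2 * (c + 1) by lra.
have sr' : (s < r.+1)%N by [].
have [fs0 /(_ t E t0 pE trE)] := fP (Ordinal sr').
have fc : f (Ordinal sr') <= c.
  rewrite /c (bigD1 (Ordinal sr'))//=.
  have : 0 <= \sum_(i < r.+1 | i != Ordinal sr') f i by rewrite sumr_ge0// => i _; case: (fP i).
  lra.
have h1 : f (Ordinal sr') * t <= lam.
  apply: (@le_trans _ _ (c * t)); first by rewrite ler_wpM2r.
  move: tl; rewrite ltr_pdivlMr// -/r -/lam => tl.
  have : 0 <= c * t by rewrite mulr_ge0//; lra.
  lra.
move=> /(_ h1)[gu h]; split=> //; apply: le_trans h _.
rewrite -/r -/lam -/a ler_wpM2r ?(ltW a0)// -mulrA ler_wpM2r//; last by lra.
by rewrite divr_ge0// ltW.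
Qed.

End constants.

(** * Error of the PLS coefficients in the latent factor model *)

(** The columns of A times the Krylov matrix are the next powers of A applied to
    v, so that equal powers also give equal Gram matrices. *)
Lemma eq_krylov (R : realType) p (A B : 'M[R]_p) v s :
  (forall k, A ^+ k *m v = B ^+ k *m v) ->
  krylovmx A v s = krylovmx B v s /\ gram A v s = gram B v s.
Proof.
move=> AB; have KK : krylovmx A v s = krylovmx B v s.
  by apply/matrixP => i k; have /matrixP/(_ i 0) := AB k; rewrite !mxE.
split=> //; rewrite /gram -!mulmxA KK; congr (_ *m _).
apply: mulmx_eqP => c; rewrite -!mulmxA -{1}KK !krylovmx_mul !mulmx_sumr.
apply: eq_bigr => k _; rewrite -!scalemxAr !mulmxA -[A *m _]exprS AB.
by rewrite exprS.
Qed.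

Section pls_error.
Context {R : realType} {p : nat}.
Context {d : measure_display} {T : measurableType d} (P : probability T R).
Variables (x q e : T -> 'cV[R]_p) (y eps : T -> R).
Variables (By : {vspace 'cV[R]_p}) (alpha : 'cV[R]_p) (sigma : R) (s : nat).
Hypotheses (mq : measurable_fun setT q).
Hypotheses (me : measurable_fun setT e) (mepsi : measurable_fun setT eps).
Hypotheses (Lx : L2v P x) (Ly : L2 P y).
Hypothesis relevant : splits_relevance P x y By.
Hypothesis model : latent_factor_model P x y By q alpha eps sigma e.
Hypothesis sxy0 : sigmav P x y != 0.

Local Notation Sx := (Sigma P x).
Local Notation sxy := (sigmav P x y).
Local Notation Sq := (Sigma P q).
Local Notation sqy := (sigmav P q y).
Local Notation Se := (Sigma P e).
Local Notation rq := (\rank Sq).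
Local Notation a := (mpinv Sq *m sqy).

Hypothesis s_rq : (1 <= s <= rq)%N.
Hypothesis small : sigma ^+ 2 < eigval Sq rq / (2 * (latent_constant Sq sqy + 1)).

Let pSq : psd Sq := Sq_psd mq model.
Let pSe : psd Se := Se_psd me model.
Let pSx : psd Sx := Sigma_psd Lx.

Let s_xq : sxy = sqy.
Proof. exact: (sigmav_latent mq me mepsi Lx Ly relevant model). Qed.

Let SL : Sigma P (proj_rv By x) = Sq + sigma ^+ 2 *: Se.
Proof. exact: (Sigma_latent mq me Lx model). Qed.

Let sqy_range : sqy \in mxrange Sq.
Proof.
have /andP[r1 _] := lfm_q_rank model.
rewrite (lfm_krylov model); have := krylov_power Sq sqy (Ordinal r1).
by rewrite expr0 mul1mx.
Qed.

Let ik : independent_krylov Sq sqy rq.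
Proof. exact: krylov_self_rank (lfm_krylov model). Qed.

Let gram_q j : (j <= rq)%N -> gram Sq sqy j \in unitmx.
Proof. by move=> jr; apply: gram_unit => //; exact: independent_krylov_le ik. Qed.

Lemma mul_alphaLS : Sq *m a = sqy.
Proof. exact: mulmx_mpinv pSq.1 sqy_range. Qed.

Lemma alphaLS_gt0 : 0 < norm2 a.
Proof.
apply: norm2_gt0; apply/eqP => a0; move: sxy0.
by rewrite s_xq -mul_alphaLS a0 mulmx0 eqxx.
Qed.

Let lam_gt0 : 0 < eigval Sq rq.
Proof.
have : 0 < eigval Sq rq / (2 * (latent_constant Sq sqy + 1)).
  by apply: le_lt_trans small; exact: sqr_ge0.
have c1 := latent_constant_ge1 Sq sqy.
by rewrite pmulr_lgt0// invr_gt0; lra.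
Qed.

(** The latent part is a compression of the second-moment matrix of x minus a
    positive semidefinite noise, so its norm is not larger. *)
Lemma norm2_sxy_le : norm2 sxy <= opnorm Sx * norm2 a.
Proof.
rewrite s_xq -{1}mul_alphaLS (le_trans (norm2_mulmx_le _ _))// ler_wpM2r ?norm2_ge0//.
apply: opnorm_quad_le => //; first exact: opnorm_ge0.
move=> u; apply: (@le_trans _ _ (dot u (Sigma P (proj_rv By x) *m u))).
  rewrite SL mulmxDl dotDr lerDl -scalemxAl dotZr mulr_ge0 ?sqr_ge0//.
  exact: pSe.2.
rewrite Sigma_proj// -!mulmxA dot_mulmxr projmx_sym.
apply: (le_trans (dot_opnorm _ _ _)); rewrite ler_wpM2l ?opnorm_ge0//.
by rewrite projmxE -norm2_sqr expr2 ler_pM ?norm2_ge0 ?norm2_orthproj.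
Qed.

Lemma opnorm_Sx_gt0 : 0 < opnorm Sx.
Proof.
rewrite lt_neqAle opnorm_ge0 andbT; apply/eqP => S0.
have := norm2_sxy_le; rewrite -S0 mul0r => h.
by have := norm2_gt0 sxy0; rewrite ltNge h.
Qed.

Let exp_relevant k : Sx ^+ k *m sxy = (Sq + sigma ^+ 2 *: Se) ^+ k *m sxy /\
  projmx By *m (Sx ^+ k *m sxy) = Sx ^+ k *m sxy.
Proof.
have SP := Sigma_relevant Lx relevant model.
have Psxy := sigmav_relevant Lx Ly relevant model.
rewrite -SL; elim: k => [|k [IH1 IH2]]; first by rewrite !expr0 !mul1mx.
have E : Sx ^+ k.+1 *m sxy = Sigma P (proj_rv By x) *m (Sx ^+ k *m sxy).
  by rewrite exprS -mulmxE -mulmxA -{1}IH2 mulmxA SP.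
split; first by rewrite E IH1 mulmxA exprS.
by rewrite E Sigma_proj// !mulmxA projmx_idem.
Qed.

Let latent_s : gram (Sq + sigma ^+ 2 *: Se) sqy s \in unitmx /\
  norm2 (pls (Sq + sigma ^+ 2 *: Se) sqy s - pls Sq sqy s) <=
  5 * (latent_constant Sq sqy + 1) * (sigma ^+ 2 / eigval Sq rq) * norm2 a.
Proof.
have /andP[_ sr] := s_rq.
apply: (latent_constantP pSq gram_q lam_gt0 alphaLS_gt0) => //; first exact: sqr_ge0.
exact: (Se_trace me model).
Qed.

Lemma gram_population : gram Sx sxy s \in unitmx.
Proof.
have [_ ->] := eq_krylov s (fun k => (exp_relevant k).1).
by rewrite s_xq; case: latent_s.
Qed.

(** The population coefficients differ from those of the latent features by the
    effect of the noise only, and the latent coefficients after s steps are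
    within one norm of the full ones. *)
Lemma pls_population_error : norm2 (pls Sx sxy s - a) <=
  (7 / 2 * Num.sqrt (rq - s)%:R
   + 5 * (latent_constant Sq sqy + 1) * (sigma ^+ 2 / eigval Sq rq)) * norm2 a.
Proof.
have gx := gram_population; have [g1 bound] := latent_s.
have /andP[s1 sr] := s_rq.
have aK : a \in krylov Sq sqy rq by rewrite -(lfm_krylov model); exact: mpinv_range pSq.1.
have -> : pls Sx sxy s = pls (Sq + sigma ^+ 2 *: Se) sqy s.
  have pS1 : psd (Sq + sigma ^+ 2 *: Se) by apply: psdD => //; exact: psdZ (sqr_ge0 _) pSe.
  have [K G] := eq_krylov s (fun k => (exp_relevant k).1).
  rewrite (pls_closedE pSx gx) (pls_closedE pS1 g1) /pls_closed G K.
  by rewrite s_xq.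
have -> : pls (Sq + sigma ^+ 2 *: Se) sqy s - a =
    (pls Sq sqy s - a) + (pls (Sq + sigma ^+ 2 *: Se) sqy s - pls Sq sqy s).
  by rewrite [RHS]addrC addrA subrK.
rewrite mulrDl (le_trans (norm2D _ _))// lerD//.
have a0 := ltW alphaLS_gt0.
have aE := esym mul_alphaLS.
have [rs|rs] := eqVneq s rq.
  rewrite {1}rs (pls_full pSq ik aK aE) subrr norm2_0 mulr_ge0// mulr_ge0 ?sqrtr_ge0//.
have sr' : (0 < rq - s)%N by rewrite subn_gt0 ltn_neqAle rs.
apply: le_trans (pls_shrinkage pSq ik aK aE sr) _.
have : 1 <= Num.sqrt (rq - s)%:R :> R by rewrite -[leLHS]sqrtr1 ler_wsqrtr// ler1n.
move=> h; rewrite -[leLHS]mul1r ler_wpM2r//; lra.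
Qed.

(** The reduced features keep the whole cross moment: this makes one of the two
    ratios equal to 1, and their moment matrix nonzero, so that its condition
    number is at least 1. *)
Lemma Mtilde_ge c : 1 <= c -> 2 * (4 * c + 1) <= Mtilde P x y By s c.
Proof.
move=> c1; have /andP[s1 _] := s_rq.
have Psxy := sigmav_relevant Lx Ly relevant model.
have LP : L2v P (proj_rv By x) by exact: L2v_proj.
rewrite /Mtilde /parsimonious sigmav_proj// Psxy; set B := krylov _ _ _.
have sB : projmx B *m sxy = sxy.
  rewrite projmxE orthproj_id//.
  by have := krylov_power (Sigma P (proj_rv By x)) sxy (Ordinal s1); rewrite expr0 mul1mx.
have -> : sigmav P (proj_rv B (proj_rv By x)) y = sxy by rewrite !sigmav_proj// Psxy.
rewrite divff ?gt_eqF ?norm2_gt0//.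
set Xs := Sigma P _; set kap := kappa2 Xs; set m := Num.max _ _.
have m1 : 1 <= m by rewrite le_max lexx orbT.
have k1 : 1 <= kap.
  apply: kappa2_ge1; first by apply: Sigma_psd; exact: L2v_proj.
  apply/eqP => X0; have : dot sxy (Xs *m sxy) = 0 by rewrite X0 mul0mx dot0r.
  rewrite /Xs Sigma_proj// -!mulmxA sB dot_mulmxr projmx_sym sB SL mulmxDl dotDr.
  have h1 := pSq.2 sxy.
  have : 0 <= dot sxy ((sigma ^+ 2 *: Se) *m sxy).
    by rewrite -scalemxAl dotZr mulr_ge0 ?sqr_ge0//; exact: pSe.2.
  move=> h2 h3; have /(psd_ker pSq) h : dot sxy (Sq *m sxy) = 0 by lra.
  have := range_ker pSq.1 _ h; rewrite {1}s_xq => /(_ sqy_range) /eqP.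
  by rewrite (negbTE sxy0).
have km : 1 <= kap * m by rewrite -[leLHS]mulr1 ler_pM.
have -> : 2 * kap * (4 * c + 1) * m = 2 * (4 * c + 1) * (kap * m) by ring.
by rewrite -[leLHS]mulr1 ler_wpM2l//; lra.
Qed.

(** The condition on M t puts the perturbation below the inverse of the sample
    constant; the scale of the Lipschitz bound is at most the norm of the latent
    coefficients, by [norm2_sxy_le]. *)
Lemma pls_sample_error Shat shat t : psd Shat -> 
  let M := Mtilde P x y By s (sample_constant Sx sxy s) in
  perturbation Sx sxy Shat shat <= t -> M * t < 1 ->
  norm2 (pls Shat shat s - a) / norm2 a <=
  7 / 2 * Num.sqrt (rq - s)%:R
  + 5 * (latent_constant Sq sqy + 1) * (sigma ^+ 2 / eigval Sq rq)
  + 5 / 2 * M * t.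
Proof.
move=> pS M tE Mt; rewrite ler_pdivrMr ?alphaLS_gt0//.
set c := sample_constant Sx sxy s in M Mt *.
have c1 : 1 <= c := sample_constant_ge1 _ _ _.
have M1 : 2 * (4 * c + 1) <= M := Mtilde_ge c1.
have t0 : 0 <= t by apply: le_trans tE; exact: perturbation_ge0.
have ct : c * t <= 1.
  by apply: le_trans (ltW Mt); rewrite ler_wpM2r//; lra.
have c0 : 0 < c by lra.
have tc : perturbation Sx sxy Shat shat <= c^-1.
  by apply: le_trans tE _; rewrite -[leRHS]mul1r ler_pdivlMr// mulrC.
have := sample_constantP pSx gram_population opnorm_Sx_gt0 (norm2_gt0 sxy0) pS tc.
rewrite -/c => h.
have -> : pls Shat shat s - a = (pls Sx sxy s - a) + (pls Shat shat s - pls Sx sxy s).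
  by rewrite [RHS]addrC addrA subrK.
rewrite mulrDl (le_trans (norm2D _ _))// lerD// ?pls_population_error//.
apply: le_trans h _; rewrite ler_pM//.
- by rewrite mulr_ge0 ?perturbation_ge0// ltW.
- by rewrite divr_ge0 ?norm2_ge0 ?opnorm_ge0.
- apply: (@le_trans _ _ (c * t)); first by rewrite ler_wpM2l// ltW.
  by rewrite ler_wpM2r//; lra.
- by rewrite ler_pdivrMr ?opnorm_Sx_gt0// mulrC norm2_sxy_le.
Qed.

End pls_error.

(** * The perturbation event *)

Section moment_ratio.
Context {R : realType}.
Context {d : measure_display} {T : measurableType d} (P : probability T R).

(** Jensen's inequality for the square. *)
Lemma moment_ratio_ge1 (f : T -> R) : measurable_fun setT f -> L1 P (fun w => f w ^+ 4) ->
  0 < mean P (fun w => f w ^+ 2) -> 1 <= moment_ratio P f.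
Proof.
move=> mf L4 m2; rewrite /moment_ratio ler_pdivlMr ?powR_gt0// mul1r.
have E : (fun w => f w ^+ 4) = fun w => (f w ^+ 2) ^+ 2.
  by apply/funext => w; rewrite -exprM.
have := @mean_sqr_le _ _ _ P (fun w => f w ^+ 2) (measurable_funX 2 mf).
rewrite -E => /(_ L4) h.
have -> : (2^-1 : R) = 2%:R * 4^-1 by field.
rewrite powRrM powR_mulrn; last exact: ltW.
apply: ge0_ler_powR; rewrite ?invr_ge0 ?nnegrE ?sqr_ge0//.
by apply: mean_ge0 => w; rewrite exprn_even_ge0.
Qed.

Lemma moment_ratio_ge0 (f : T -> R) : 0 <= moment_ratio P f.
Proof. by rewrite divr_ge0 ?powR_ge0. Qed.

(** Markov's inequality says nothing at level 0, but there a zero mean makes the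
    variable vanish almost surely. *)
Lemma prob_gt_le (f : T -> R) c (nu : R) : L1 P f -> (forall w, 0 <= f w) -> 0 <= c -> 0 < nu ->
  mean P f <= c * nu -> (P [set w | (c < f w)%R] <= nu%:E)%E.
Proof.
move=> Lf f0 c0 nu0 fc; have [cz|cn] := eqVneq c 0.
  have f0' : mean P f = 0.
    by apply/eqP; rewrite eq_le mean_ge0// andbT (le_trans fc)// cz mul0r.
  have mA := measurable_superlevel c (L1_measurable Lf).
  rewrite (@measure_negligible _ _ _ P)// ?lee_fin ?ltW//.
  apply: negligibleS (mean0_ae Lf f0 f0') => w /=.
  by rewrite cz => fw; apply/eqP; rewrite gt_eqF.
have cp : 0 < c by rewrite lt0r cn.
apply: le_trans (mean_markov (L1_measurable Lf) Lf f0 cp) _.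
by rewrite lee_fin ler_pdivrMr// mulrC.
Qed.

End moment_ratio.

Lemma ln2_ge (R : realType) : 2^-1 <= ln 2 :> R.
Proof.
rewrite -[leLHS]expRK ler_ln ?posrE ?expR_gt0//.
have := @expR_ge1Dx R (- 2^-1); rewrite expRN => h.
rewrite -[leLHS]invrK invf_ple ?posrE ?invr_gt0 ?expR_gt0//; lra.
Qed.

(** Rounding the binary logarithm up costs at most 1, which is at most twice
    the natural logarithm of a rank that is at least 2. *)
Lemma log2_bound (R : realType) (r : nat) : (1 < r)%N ->
  exists k, [/\ (0 < k)%N, (r <= 2 ^ k)%N & k%:R <= 4 * ln r%:R :> R].
Proof.
move=> r1; have /= /andP[lo hi] := up_log_bounds (ltnSn 1) r1.
set k := up_log 2 r in lo hi; exists k.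
have k0 : (0 < k)%N by rewrite up_log_gt0.
have r0 : 0 < r%:R :> R by rewrite ltr0n (ltn_trans _ r1).
have l2 := ln2_ge R.
have lr : ln 2 <= ln r%:R :> R by rewrite ler_ln ?posrE// ler_nat.
split=> //.
have h : k.-1%:R * ln 2 <= ln r%:R :> R.
  rewrite mulr_natl -lnXn// ler_ln ?posrE ?exprn_gt0//.
  by rewrite -natrX ler_nat ltnW.
have kE : k%:R = k.-1%:R + 1 :> R by rewrite natr1 prednK.
have h' : k.-1%:R * 2^-1 <= k.-1%:R * ln 2 :> R by rewrite ler_wpM2l.
rewrite kE; lra.
Qed.

Section deviation_arithmetic.
Context {R : realType}.
Variables L o sy del V K l a D : R.
Hypotheses (L1 : 1 <= L) (o0 : 0 <= o) (sy0 : 0 < sy) (del0 : 0 <= del).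
Hypotheses (V0 : 0 < V) (K0 : 0 <= K) (KV : 99 * L * Num.sqrt (sy * o) <= K * V).
Hypotheses (l0 : 2^-1 <= l) (a0 : 0 <= a) (al : a * l <= 3 * (L * o * del ^+ 2)).

(** The variables stand for the quantities of the same names in the constants
    of the theorem: L is a moment ratio, o and S are operator norms, sy is the
    second moment of y, V the norm of the cross moment, l a logarithm, a the
    expected largest squared norm divided by n, and D a mean deviation. *)
Lemma deviation_sqr_le : 99 ^+ 2 * (L * o * del ^+ 2) * sy <= (K * del * V) ^+ 2.
Proof.
have L0 : 0 <= L := le_trans ler01 L1.
have so0 : 0 <= sy * o by rewrite mulr_ge0// ltW.
have q0 : 0 <= L * o * del ^+ 2 by rewrite !mulr_ge0 ?sqr_ge0.
apply: (@le_trans _ _ ((99 * L * Num.sqrt (sy * o) * del) ^+ 2)).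
  rewrite !exprMn sqr_sqrtr//.
  have -> : 99 ^+ 2 * L ^+ 2 * (sy * o) * del ^+ 2 =
    L * (99 ^+ 2 * (L * o * del ^+ 2) * sy) by ring.
  by rewrite -[leLHS]mul1r ler_wpM2r// mulr_ge0 ?(ltW sy0)// mulr_ge0 ?sqr_ge0.
rewrite lerXn2r ?nnegrE//; last by rewrite [leRHS]mulrAC ler_wpM2r.
  by rewrite !mulr_ge0 ?sqrtr_ge0.
by rewrite !mulr_ge0// ltW.
Qed.

Lemma vector_deviation_bound : D <= 2 * Num.sqrt (a * sy) -> D <= V * (K * del).
Proof.
have KdV2 := deviation_sqr_le.
have L0 : 0 <= L := le_trans ler01 L1.
have so0 : 0 <= sy * o by rewrite mulr_ge0// ltW.
have q0 : 0 <= L * o * del ^+ 2 by rewrite !mulr_ge0 ?sqr_ge0.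
move=> /le_trans; apply.
have rhs0 : 0 <= V * (K * del) by rewrite !mulr_ge0// ltW.
have as0 : 0 <= a * sy by rewrite mulr_ge0// ltW.
have lhs0 : 0 <= 2 * Num.sqrt (a * sy) by rewrite mulr_ge0 ?sqrtr_ge0.
rewrite -(@ler_pXn2r _ 2) ?nnegrE//.
rewrite exprMn sqr_sqrtr// [V * _]mulrC; apply: le_trans KdV2.
have h1 : a * 2^-1 <= 3 * (L * o * del ^+ 2) by apply: le_trans al; rewrite ler_wpM2l.
rewrite [leLHS]mulrA ler_wpM2r ?(ltW sy0)//; lra.
Qed.

(** The deviation D appears on both sides of its bound.  If it were larger than
    S K del, which is at most S, the right-hand side would be less than D^2. *)
Lemma matrix_deviation_bound (S k : R) : 0 < S -> V ^+ 2 <= sy * S -> k <= 4 * l ->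
  0 <= D -> D ^+ 2 <= 64 * k * a * (S + D) -> K * del <= 1 -> D <= S * (K * del).
Proof.
have KdV2 := deviation_sqr_le.
have L0 : 0 <= L := le_trans ler01 L1.
have so0 : 0 <= sy * o by rewrite mulr_ge0// ltW.
have q0 : 0 <= L * o * del ^+ 2 by rewrite !mulr_ge0 ?sqr_ge0.
move=> S0 VS kl D0 hD; set kap := K * del => k1.
have kap0 : 0 <= kap by rewrite mulr_ge0.
have := al; move: KdV2 q0; set q := L * o * del ^+ 2 => KdV2 q0 al'.
have AL : 64 * k * a <= 768 * q.
  have : k * a <= 4 * l * a by rewrite ler_wpM2r.
  lra.
have qS : 99 ^+ 2 * q <= kap ^+ 2 * S.
  have h : 99 ^+ 2 * q * sy <= (kap ^+ 2 * S) * sy.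
    apply: (le_trans KdV2).
    by rewrite exprMn -/kap -mulrA [S * sy]mulrC ler_wpM2l ?sqr_ge0.
  by rewrite ler_pM2r in h.
have AS : 64 * k * a <= 8 / 100 * (kap ^+ 2 * S) by lra.
rewrite leNgt; apply/negP => Dk.
have h1 : D ^+ 2 <= 8 / 100 * (kap ^+ 2 * S) * (S + D).
  by apply: le_trans hD _; rewrite ler_wpM2r// addr_ge0// ltW.
have D_gt0 : 0 < D by apply: le_lt_trans Dk; rewrite mulr_ge0// ltW.
have h2 : kap ^+ 2 * S * S <= D ^+ 2.
  have -> : kap ^+ 2 * S * S = (S * kap) ^+ 2 by ring.
  by rewrite lerXn2r ?nnegrE ?(ltW Dk)// mulr_ge0// ltW.
have h3 : kap ^+ 2 * S * D <= D ^+ 2.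
  rewrite [leRHS]expr2 ler_wpM2r// (le_trans _ (ltW Dk))// mulrC ler_wpM2l// ?(ltW S0)//.
  by rewrite expr2 -[leRHS]mulr1 ler_wpM2l.
have : 0 < D ^+ 2 by rewrite exprn_gt0.
lra.
Qed.

End deviation_arithmetic.

Section perturbation_event.
Context {R : realType} {p n : nat}.
Context {d : measure_display} {T : measurableType d} (P : probability T R).
Context {d' : measure_display} {T' : measurableType d'} (P' : probability T' R).
Variables (x : T -> 'cV[R]_p) (y : T -> R).
Variable Z : 'I_n -> T' -> ('cV[R]_p * R)%type.
Variables (By B : {vspace 'cV[R]_p}) (s : nat).
Hypothesis mx : measurable_fun setT x.
Hypothesis mZ : forall i, measurable_fun setT (Z i).
Hypothesis iidZ : iid_copies P P' x y Z.
Hypothesis n0 : (0 < n)%N.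
Hypothesis Lx : L2v P x.
Hypothesis Ly : L2 P y.
Hypothesis finite4 : finite_moment_ratios P x y.
Hypothesis xr : {ae P, forall w, x w \in mxrange (Sigma P x)}.
Hypothesis By_sub : (By <= mxrange (Sigma P x))%VS.
Hypothesis worst : is_worst_subspace P P' x y Z By s B.
Hypothesis sxy0 : sigmav P x y != 0.
Hypothesis y0 : 0 < mean P (fun w => y w ^+ 2).

Local Notation Sx := (Sigma P x).
Local Notation sxy := (sigmav P x y).
Local Notation m_ V := (mean P' (max_norm Z V)).

Let my : measurable_fun setT y. Proof. exact: Ly.1. Qed.
Let Lx2 i : L1 P (fun w => x w i 0 ^+ 2). Proof. exact: (Lx i).2. Qed.

Let LM V : L1 P' (max_norm Z V). Proof. exact: (L1_max_norm mx my mZ iidZ Lx2). Qed.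

Let m_ge0 V : 0 <= m_ V. Proof. by apply: mean_ge0 => w; exact: max_norm_ge0. Qed.

Let L_sub_ge1 V : (V <= mxrange Sx)%VS -> 1 <= L_sub P x V.
Proof.
move=> VS; rewrite /L_sub; case: ifPn => // m0; apply: moment_ratio_ge1.
- by apply: measurable_norm2 => i; exact: (L2v_proj V Lx i).1.
- apply: L1_ge0; last by rewrite -expectationE; exact: finite4.2.
    apply: measurable_funX; apply: measurable_norm2 => i; exact: (L2v_proj V Lx i).1.
  by move=> w; rewrite exprn_ge0 ?norm2_ge0.
by rewrite lt0r m0 mean_ge0// => w; rewrite exprn_ge0 ?norm2_ge0.
Qed.

(** The operator norm cancels in the product that defines the score; when it is
    zero, the projection vanishes almost surely, also for the sample. *)
Let max_le_score V : (V <= mxrange Sx)%VS -> m_ V <= subspace_score P P' x Z V.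
Proof.
move=> VS; rewrite /subspace_score /rho; set o := opnorm _.
have [oz|on] := eqVneq o 0; last first.
  rewrite -mulrA (mulrCA o) divff// mulr1 -[leLHS]mul1r.
  by rewrite ler_wpM2r ?m_ge0 ?L_sub_ge1.
rewrite oz mulr0 mul0r.
have S0 := opnorm_eq0 oz.
have nz : mean P (fun w => norm2 (orthproj V (x w)) ^+ 2) = 0.
  have LV := L2v_proj V Lx.
  rewrite -[LHS](eq_mean P (f := fun w => \sum_i proj_rv V x w i 0 * proj_rv V x w i 0)); last first.
    by move=> w; rewrite norm2_sqr dotE.
  rewrite mean_sum; last by move=> i; exact: L2_mul.
  by rewrite big1// => i _; move/matrixP: S0 => /(_ i i); rewrite !mxE.
have my' := mean_sample mx my mZ iidZ.
apply: (@le_trans _ _ (mean P' (fun w => \sum_i norm2 (orthproj V (Z i w).1) ^+ 2))).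
  apply: le_mean; first exact: LM.
    by apply: L1_sum => i; exact: (L1_sample_proj_norm mx my mZ iidZ Lx2).
  by move=> w; exact: max_norm_le_sum.
rewrite mean_sum; last by move=> i; exact: (L1_sample_proj_norm mx my mZ iidZ Lx2).
rewrite big1// => i _.
have [_ ->//] := my' (fun v => norm2 (orthproj V v.1) ^+ 2) i (measurable_proj_norm V) (L1_proj_norm mx my Lx2 V).
Qed.

Let Bs := parsimonious P x y By s.

Let Bs_sub : (Bs <= By)%VS.
Proof.
apply: krylov_sub => k; rewrite sigmav_proj// Sigma_proj//.
case: {k}(nat_of_ord k) => [|k]; first by rewrite expr0 mul1mx projmxE orthproj_mem.
by rewrite exprS -mulmxE -!mulmxA projmxE orthproj_mem.
Qed.

Let sample_range : {ae P', forall w, forall i, (Z i w).1 \in mxrange Sx}.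
Proof.
apply: filter_forall => i.
exact: ae_law (measurable_fun_pair mx my) (mZ i) (iidZ.1 i) _ (measurable_fst_mem _) xr.
Qed.

(** Pythagoras: the whole sample is controlled by its three components. *)
Let max_norm_split : m_ fullv <= 3 * subspace_score P P' x Z B.
Proof.
case: worst => _ max.
pose c1 := orthc_in By Bs; pose c2 := orthc_in (mxrange Sx) By.
have sc V : V \in [:: Bs; c1; c2] -> (V <= mxrange Sx)%VS ->
    m_ V <= subspace_score P P' x Z B.
  by move=> Vc VS; apply: le_trans (max_le_score VS) _; exact: max.
have b1 : m_ Bs <= subspace_score P P' x Z B.
  by apply: sc; [rewrite !inE eqxx|exact: subv_trans Bs_sub By_sub].
have b2 : m_ c1 <= subspace_score P P' x Z B.
  by apply: sc; [rewrite !inE eqxx orbT|apply: subv_trans By_sub; exact: capvSl].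
have b3 : m_ c2 <= subspace_score P P' x Z B.
  by apply: sc; [rewrite !inE eqxx !orbT|exact: capvSl].
suff h : m_ fullv <= m_ Bs + m_ c1 + m_ c2.
  have -> : 3 = 1 + 1 + 1 :> R by ring.
  by rewrite !mulrDl !mul1r (le_trans h)// !lerD.
rewrite -!meanD; try exact: LM; last exact: L1D.
apply: ae_le_mean; [exact: LM|by apply: L1D => //; exact: L1D| | |].
- by move=> w; exact: max_norm_ge0.
- by move=> w; rewrite !addr_ge0 ?max_norm_ge0.
apply: filterS sample_range => w zr; apply: max_norm_le.
  by rewrite !addr_ge0 ?max_norm_ge0.
move=> i; rewrite (orthproj_id (memvf _)) -{1}(orthproj_id (zr i)).
rewrite (norm2_orthc_in _ By_sub) (norm2_orthc_in _ Bs_sub).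
by rewrite !lerD ?max_norm_ge.
Qed.

Let B_range : (B <= mxrange Sx)%VS.
Proof.
case: worst => + _; rewrite !inE => /or3P[] /eqP ->.
- exact: subv_trans Bs_sub By_sub.
- by apply: subv_trans By_sub; exact: capvSl.
- exact: capvSl.
Qed.

Let o := opnorm (Sigma P (proj_rv B x)).
Let r := rho P P' x Z B.
Let L := L_sub P x B.
Let S := opnorm Sx.
Let V := norm2 sxy.
Let sy := mean P (fun w => y w ^+ 2).
Let l : R := ln (\rank Sx)%:R.
Let del := delta P P' x Z B.
Let K := Kconst P x y 1 B.

Let o_ge0 : 0 <= o. Proof. exact: opnorm_ge0. Qed.
Let r_ge0 : 0 <= r. Proof. exact: divr_ge0 (m_ge0 B) o_ge0. Qed.
Let L_ge1 : 1 <= L. Proof. exact: L_sub_ge1. Qed.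
Let L_ge0 : 0 <= L. Proof. exact: le_trans ler01 L_ge1. Qed.
Let V_gt0 : 0 < V. Proof. exact: norm2_gt0. Qed.

(** Cauchy-Schwarz for the cross moment.  It makes the first term in the
    maximum of K large enough for the matrix bound too. *)
Let V2_le : V ^+ 2 <= sy * S.
Proof.
have E : V ^+ 2 = mean P (fun w => dot sxy (x w) * y w) by rewrite mean_dot// norm2_sqr.
have [mf Lf] := L2v_dot sxy Lx.
have := mean_cauchy_schwarz mf my Lf Ly.2; rewrite -E -/sy => h.
have E2 : mean P (fun w => dot sxy (x w) ^+ 2) = dot sxy (Sx *m sxy).
  by rewrite dot_crossmom//; apply: eq_mean => w; rewrite expr2.
rewrite E2 in h.
have h2 : dot sxy (Sx *m sxy) <= S * V ^+ 2 by rewrite expr2; exact: dot_opnorm.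
rewrite -(ler_pM2l (exprn_gt0 2 V_gt0)) -expr2 (le_trans h)//.
by rewrite [leRHS]mulrCA mulrC ler_wpM2l 1?mulrC// ltW.
Qed.

Let S_gt0 : 0 < S.
Proof.
have : 0 < sy * S by apply: lt_le_trans V2_le; rewrite exprn_gt0.
by rewrite pmulr_rgt0.
Qed.

Let K_ge : 99 * L * Num.sqrt (sy * o) <= K * V.
Proof.
rewrite /K /Kconst -/o -/S -/V -/L -/sy mulr1.
rewrite (powR12_sqrt o_ge0) (powR12_sqrt (ltW y0)) -sqrtrM ?(ltW y0)//.
set M := Num.max _ _.
have MV : Num.sqrt (sy * o) <= M * V.
  by rewrite -ler_pdivrMr// le_max lexx.
have Ly1 : 1 <= moment_ratio P y.
  apply: moment_ratio_ge1 => //; apply: L1_ge0; last by rewrite -expectationE; exact: finite4.1.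
    exact: measurable_funX.
  by move=> w; rewrite exprn_even_ge0.
have q0 := sqrtr_ge0 (sy * o).
apply: (@le_trans _ _ (99 * L * (M * V))).
  by rewrite ler_wpM2l ?mulr_ge0.
have -> : 99 * moment_ratio P y * L * M * V = moment_ratio P y * (99 * L * (M * V)) by ring.
rewrite -[leLHS]mul1r ler_wpM2r//; apply: mulr_ge0; first exact: mulr_ge0.
exact: le_trans q0 MV.
Qed.

Hypothesis rx : (1 < \rank Sx)%N.

Let l_ge : 2^-1 <= l.
Proof.
apply: le_trans (ln2_ge R) _; rewrite ler_ln ?posrE ?ler_nat// ltr0n.
exact: ltn_trans rx.
Qed.

Let n_gt0 : 0 < n%:R :> R. Proof. by rewrite ltr0n. Qed.

Let l_ge0 : 0 <= l. Proof. by apply: le_trans l_ge; rewrite invr_ge0. Qed.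

Let del2 : del ^+ 2 = r * l / n%:R.
Proof. by rewrite sqr_sqrtr//; apply: divr_ge0; [exact: mulr_ge0|exact: ltW]. Qed.

Let del_ge0 : 0 <= del. Proof. exact: sqrtr_ge0. Qed.

Let K_ge0 : 0 <= K.
Proof.
have : 0 <= K * V by apply: le_trans K_ge; rewrite !mulr_ge0 ?sqrtr_ge0.
by rewrite pmulr_lge0.
Qed.

Let m_le : m_ fullv / n%:R * l <= 3 * (L * o * del ^+ 2).
Proof.
rewrite del2 -mulrA [n%:R^-1 * _]mulrC.
have -> : 3 * (L * o * (r * l / n%:R)) = 3 * (L * o * r) * (l / n%:R) by ring.
by apply: (ler_wpM2r _ max_norm_split); apply: divr_ge0 => //; exact: ltW.
Qed.

Let a_ge0 : 0 <= m_ fullv / n%:R.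
Proof. by apply: divr_ge0; [exact: m_ge0|exact: ltW]. Qed.

Lemma sigmav_mean_dev :
  mean P' (fun w => norm2 (sigmav_hat Z w - sxy)) <= V * (K * del).
Proof.
apply: (vector_deviation_bound L_ge1 o_ge0 y0 del_ge0 V_gt0 K_ge0 K_ge l_ge a_ge0 m_le).
by rewrite mulrAC; exact: (sigmav_deviation mx my mZ iidZ n0 Lx2 Ly.2).
Qed.

Lemma Sigma_mean_dev : K * del <= 1 ->
  mean P' (fun w => opnorm (Sigma_hat Z w - Sx)) <= S * (K * del).
Proof.
have [k [k0 rk kl]] := log2_bound R rx.
apply: (matrix_deviation_bound L_ge1 o_ge0 y0 del_ge0 V_gt0 K_ge0 K_ge a_ge0 m_le
  S_gt0 V2_le kl).
  by apply: mean_ge0 => w; exact: opnorm_ge0.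
by rewrite mulrA; exact: (Sigma_deviation mx my mZ iidZ n0 Lx2 k0 rk xr).
Qed.

Theorem perturbation_event_probability nu : K * del <= 1 -> 0 < nu ->
  ((1 - 2 * nu)%:E <= P' [set w | (perturbation Sx sxy (Sigma_hat Z w) (sigmav_hat Z w)
     <= K * nu^-1 * del)%R])%E.
Proof.
move=> k1 nu0; set E := [set w | _]; set t := K * nu^-1 * del.
have t0 : 0 <= t.
  by apply: mulr_ge0 => //; apply: divr_ge0 => //; exact: ltW.
have L1' := L1_opnorm_dev mx my mZ iidZ Lx2.
have L2' := L1_norm2_dev mx my mZ iidZ Lx2 Ly.2.
have tnu : t * nu = K * del by rewrite /t; field; rewrite gt_eqF.
have p1 : (P' [set w | (S * t < opnorm (Sigma_hat Z w - Sx))%R] <= nu%:E)%E.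
  apply: prob_gt_le L1' (fun w => opnorm_ge0 _) _ nu0 _; first by apply: mulr_ge0 => //; exact: ltW.
  by rewrite -mulrA tnu; exact: Sigma_mean_dev.
have p2 : (P' [set w | (V * t < norm2 (sigmav_hat Z w - sxy))%R] <= nu%:E)%E.
  apply: prob_gt_le L2' (fun w => norm2_ge0 _) _ nu0 _; first by apply: mulr_ge0 => //; exact: ltW.
  by rewrite -mulrA tnu; exact: sigmav_mean_dev.
pose F1 := [set w | S * t < opnorm (Sigma_hat Z w - Sx)].
pose F2 := [set w | V * t < norm2 (sigmav_hat Z w - sxy)].
have EF : E = ~` (F1 `|` F2).
  apply/seteqP; split=> w; rewrite /E /F1 /F2 /= /perturbation ge_max !ler_pdivrMr//.
    by rewrite ![_ * t]mulrC => /andP[a b] []; rewrite ltNge ?a ?b.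
  by move/not_orP => []/negP + /negP; rewrite -!leNgt ![t * _]mulrC => -> ->.
have m1 : measurable F1 := measurable_superlevel _ (L1_measurable L1').
have m2 : measurable F2 := measurable_superlevel _ (L1_measurable L2').
rewrite EF probability_setC; last exact: measurableU.
rewrite EFinB leeB//.
apply: le_trans (measureU2 _ m1 m2) _.
have -> : (2 * nu)%:E = (nu%:E + nu%:E)%E by rewrite -EFinD; congr EFin; ring.
exact: leeD.
Qed.

End perturbation_event.

(** * Accuracy of the sample PLS coefficients *)

Theorem theorem3p8 (R : realType) :
  exists (C : R)
         (Ct : forall p : nat, 'M[R]_p -> 'cV[R]_p -> nat -> R)
         (Cq : forall p : nat, 'M[R]_p -> 'cV[R]_p -> R),
  [/\ 1 <= C,
      forall p S v s, 1 <= Ct p S v s,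
      forall p S v, 1 <= Cq p S v
    & forall (p : nat)
        (* population *)
        (d : measure_display) (T : measurableType d) (P : probability T R)
        (x : {RV P >-> 'cV[R]_p}) (y : {RV P >-> R})
        (By : {vspace 'cV[R]_p})
        (q : {RV P >-> 'cV[R]_p}) (alpha : 'cV[R]_p) (eps : {RV P >-> R})
        (sigma : R) (e : {RV P >-> 'cV[R]_p})
        (* for each sample size m, a sample of m observations *)
        (dS : nat -> measure_display) (TS : forall m, measurableType (dS m))
        (PS : forall m, probability (TS m) R)
        (Z : forall m, 'I_m -> {RV (PS m) >-> ('cV[R]_p * R)%type})
        (s : nat) (Bt : nat -> {vspace 'cV[R]_p}) (n : nat) (nu : R),
      let Sx := Sigma P x in
      let sxy := sigmav P x y in
      let Sq := Sigma P q in
      let sqy := sigmav P q y in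
      let rx := \rank Sx in
      let rq := \rank Sq in
      let Shat := Sigma_hat (Z n) in
      let shat := sigmav_hat (Z n) in
      let M := Mtilde P x y By s (Ct p Sx sxy s) in
      let K := Kconst P x y C (Bt n) in
      let rho_n := rho P (PS n) x (Z n) (Bt n) in
      let delta_ m := delta P (PS m) x (Z m) (Bt m) in
      let alphaLS := mpinv Sq *m sqy in
      let E := [set w | perturbation Sx sxy (Shat w) (shat w)
                        <= K * nu^-1 * delta_ n] in
      centered P x -> 'E_P[y]%E = 0%E ->
      square_integrable P x -> ('E_P[fun w => (y w ^+ 2)%R] < +oo)%E ->
      sxy != 0 ->
      0 < mean P (fun w => y w ^+ 2) ->
      (1 <= rx <= p)%N ->
      finite_moment_ratios P x y ->
      is_relevant_subspace P x y By ->
      latent_factor_model P x y By q alpha eps sigma e ->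
      sigma ^+ 2 < eigval Sq rq / (2 * (Cq p Sq sqy + 1)) ->
      (forall m, iid_copies P (PS m) x y (Z m)) ->
      (0 < n)%N ->
      (1 <= s <= rq)%N ->
      (forall m, is_worst_subspace P (PS m) x y (Z m) By s (Bt m)) ->
      {ae PS n, forall w,
        (\dim (krylov Sx sxy p) <= \dim (krylov (Shat w) (shat w) p))%N} ->
      delta_ @ \oo --> 0 ->
      M * K * delta_ n < 2^-1 ->
      M * K * delta_ n < nu -> nu < 2^-1 ->
      (* When rx = 1 the factor ln rx vanishes, E is the event that the sample
         moments equal the population moments, and the probability bound
         fails in general. *)
      ((1 < rx)%N -> ((1 - 2 * nu)%:E <= PS n E)%E) /\
      (forall w, E w ->
        norm2 (pls (Shat w) (shat w) s - alphaLS) / norm2 alphaLS <=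
          7 / 2 * Num.sqrt (rq - s)%:R
          + 5 * (Cq p Sq sqy + 1) * (sigma ^+ 2 / eigval Sq rq)
          + 5 / 2 * M * K
            * Num.sqrt (rho_n * ln rx%:R / (n%:R * nu ^+ 2)))].
Proof.
exists 1, (@sample_constant R), (@latent_constant R); split=> //.
- by move=> *; exact: sample_constant_ge1.
- by move=> *; exact: latent_constant_ge1.
move=> p d T P x y By q alpha eps sigma e dS TS PS Z s Bt n nu Sx sxy Sq sqy rx rq
  Shat shat M K rho_n delta_ alphaLS E _ _ x2 y2 sxy0 y0 _ finite4 [relevant _] model
  small iidZ n0 s_rq worst _ _ MKd MKnu nu2.
have mx : measurable_fun setT x by [].
have my : measurable_fun setT y by [].
have mq : measurable_fun setT q by [].
have me : measurable_fun setT e by [].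
have mepsi : measurable_fun setT eps by [].
have mZ i : measurable_fun setT (Z n i) by [].
have Lx : L2v P x by exact: L2v_square.
have Ly : L2 P y.
  split=> //; apply: L1_ge0; [exact: measurable_funX|by move=> w; exact: sqr_ge0|].
  by rewrite -expectationE.
have M1 : 10 <= M.
  have c1 := sample_constant_ge1 Sx sxy s.
  have := Mtilde_ge mq me mepsi Lx Ly relevant model sxy0 s_rq c1.
  by apply: le_trans; lra.
have K0 : 0 <= K.
  have L0 : 0 <= L_sub P x (Bt n) by rewrite /L_sub; case: ifP => // _; exact: moment_ratio_ge0.
  have y1 := moment_ratio_ge0 P y.
  apply: mulr_ge0; first by apply: mulr_ge0 => //; apply: mulr_ge0 => //; rewrite mulr1.
  by rewrite le_max (divr_ge0 (opnorm_ge0 _) (opnorm_ge0 _)) orbT.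
have d0 : 0 <= delta_ n by exact: sqrtr_ge0.
have Kd0 : 0 <= K * delta_ n by exact: mulr_ge0.
have nu0 : 0 < nu.
  by apply: le_lt_trans MKnu; rewrite -mulrA mulr_ge0//; lra.
split.
  move=> rx1; have Kd1 : K * delta_ n <= 1.
    have : 10 * (K * delta_ n) <= M * K * delta_ n by rewrite -mulrA ler_wpM2r.
    lra.
  exact: (perturbation_event_probability mx mZ (iidZ n) n0 Lx Ly finite4
    (lfm_in_range relevant model) (let: And3 h _ _ := relevant in h) (worst n)).
move=> w Ew.
have pS : psd (Shat w).
  by apply: psdZ; [rewrite invr_ge0|exact: psd_outer].
have Mt : M * (K * nu^-1 * delta_ n) < 1.
  by rewrite mulrA mulrAC mulrA ltr_pdivrMr// mul1r mulrAC.
have -> : Num.sqrt (rho_n * ln rx%:R / (n%:R * nu ^+ 2)) = delta_ n / nu.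
  have -> : rho_n * ln rx%:R / (n%:R * nu ^+ 2) = (nu^-1) ^+ 2 * (rho_n * ln rx%:R / n%:R).
    by field; rewrite !gt_eqF// ltr0n.
  rewrite sqrtrM ?sqr_ge0// sqrtr_sqr ger0_norm ?invr_ge0 ?(ltW nu0)//.
  by rewrite mulrC.
have := pls_sample_error mq me mepsi Lx Ly relevant model sxy0 s_rq small pS Ew Mt.
rewrite -/M => /le_trans; apply; rewrite lerD2l le_eqVlt; apply/orP; left; apply/eqP.
by field; rewrite gt_eqF.
Qed.
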